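(* Let $p_0(x), p_1(x)$ be two zero-mean Gaussian probability density functions on $\mathbb{R}^n$ with positive definite covariance matrices $P_0, P_1\in\mathbb{S}^n_{++}$, respectively. Let $(p_t^{\rm info}(x), v_t^{\rm info}(x))_{t\in[0,1]}$ be the minimizer of $$\inf_{p_t,v_t}\left\{4\int_0^1 \mathcal{E}_{p_t}\!\left(\|v_t(x)\|_{P_t^{-1}}^2\right)dt \;\Big|\; \frac{\partial p_t}{\partial t}+\nabla_x\cdot(p_tv_t)=0,\ p_t|_{t=0}=p_0,\ p_t|_{t=1}=p_1\right\},$$ where $P_t=\mathcal{E}_{p_t}(xx')$. Then $p_t^{\rm info}$ is zero-mean Gaussian with covariance matrix $$P_t^{\rm info}=P_0^{1/2}\left(P_0^{-1/2}P_1P_0^{-1/2}\right)^tP_0^{1/2},$$ and $v_t^{\rm info}(x)=A^{\rm info}x$ almost surely, where $$A^{\rm info}=\tfrac12P_0^{1/2}\log\left(P_0^{-1/2}P_1P_0^{-1/2}\right)P_0^{-1/2}.$$ Moreover, the optimal value equals $\left\|\log\left(P_0^{-1/2}P_1P_0^{-1/2}\right)\right\|_{\rm F}^2$.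
   Context: $\mathbb{S}^n_{++}$ is the set of real symmetric positive definite $n\times n$ matrices; $'$ denotes transpose; $P^{1/2}$ is the unique positive definite square root; $\log$ and real powers of positive definite matrices are the usual (spectral) ones; $\|\cdot\|_{\rm F}$ is the Frobenius norm. For a density $p$ on $\mathbb{R}^n$, $\mathcal{E}_p(g(x))=\int_{\mathbb{R}^n}g(x)p(x)\,dx$. For $W\in\mathbb{S}^n_{++}$, $\|v\|_W^2=v'Wv$. The infimum is over time-dependent probability densities $p_t$ on $\mathbb{R}^n$, $t\in[0,1]$, with the prescribed endpoints $p_0,p_1$, and time-dependent velocity fields $v_t:\mathbb{R}^n\to\mathbb{R}^n$, related by the continuity equation. Admissible pairs are: $t\mapsto p_t$ narrowly continuous with finite second moments, $v$ Borel measurable with $\int_0^1\mathcal{E}_{p_t}(\|v_t(x)\|_2^2)\,dt<\infty$, and the continuity equation holding in the sense of distributions. ''Almost surely'' means for $p_t^{\rm info}$-almost every $x$, for almost every $t$. *)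

(* Defs.v *)
From HB Require Import structures.
From mathcomp Require Import all_boot all_order all_algebra.
From mathcomp Require Import all_classical all_reals all_analysis.
From mathcomp Require Import measurable_realfun.

Set Implicit Arguments.
Unset Strict Implicit.
Unset Printing Implicit Defensive.

Import Order.TTheory GRing.Theory Num.Theory.
Import numFieldNormedType.Exports.

Local Open Scope classical_set_scope.
Local Open Scope ring_scope.

Section borel.
Context (R : realType) (m n : nat).

HB.instance Definition _ := @isMeasurable.Build default_measure_display
  'M[R]_(m, n) <<s [set U : set 'M[R]_(m, n) | open U] >>
  (@sigma_algebra0 _ setT _) (@sigma_algebraC _ _)
  (@sigma_algebra_bigcup _ setT _).

Lemma measurable_open_mx (U : set 'M[R]_(m, n)) : open U -> measurable U.
Proof. exact: sub_sigma_algebra. Qed.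

End borel.

Section lebesgue_cV.
Context (R : realType).

Lemma measurable_open_prod n (U : set (R * 'cV[R]_n)) :
  open U -> measurable U.
Proof.
move=> oU.
pose B (i : rat * 'cV[rat]_n * rat) : set (R * 'cV[R]_n) :=
  ball (ratr i.1.1 : R) (ratr i.2) `*` ball (map_mx ratr i.1.2 : 'cV[R]_n) (ratr i.2).
have mB i : measurable (B i).
  apply: measurableX; first by apply: open_measurable; exact: (@ball_open R R).
  by apply: measurable_open_mx; exact: ball_open.
have -> : U = \bigcup_i (if `[< B i `<=` U >] then B i else set0).
  apply/seteqP; split=> [[x y] Uxy|z [i _]]; last by case: asboolP => // + Bz; exact.
  have : nbhs (x, y) U by exact: open_nbhs_nbhs.
  move=> /nbhs_ballP[e /= e0 eU].
  have /rat_in_itvoo[r] : 0 < e / 2 by rewrite divr_gt0.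
  rewrite in_itv/= => /andP[r0 re].
  have rnear (a : R) : exists q : rat, ball (ratr q : R) (ratr r) a.
    have /rat_in_itvoo[q] : a < a + ratr r by rewrite ltrDl.
    rewrite in_itv/= => /andP[aq qr]; exists q.
    by rewrite /ball/= ltr_distl qr ltrBlDr (lt_trans aq)// ltrDl.
  have [q xq] := rnear x.
  have /choice[c yc] : forall i, exists q : rat, ball (ratr q : R) (ratr r) (y i 0).
    by move=> i; exact: rnear.
  exists (q, \col_i c i, r) => //.
  case: asboolP => [_|[]].
    split => //=; split => // i j; rewrite !mxE ord1; exact: yc.
  move=> [x' y'] [/= x'q [_ y'c]]; apply: eU; split => /=.
    have -> : e = e / 2 + e / 2 by rewrite -splitr.
    apply: (@ball_triangle _ _ (ratr q : R)).
      by apply: ball_sym; apply: le_ball xq; exact: ltW.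
    by apply: le_ball x'q; exact: ltW.
  split => // i j; rewrite ord1.
  have -> : e = e / 2 + e / 2 by rewrite -splitr.
  apply: (@ball_triangle _ _ (ratr (c i) : R)).
    by apply: ball_sym; apply: le_ball (yc i); exact: ltW.
  by have := y'c i j; rewrite !mxE ord1; apply: le_ball; exact: ltW.
apply: countable_bigcupT_measurable => // i.
by case: ifP => // _; exact: measurable0.
Qed.

Definition cons_cV n (z : R * 'cV[R]_n) : 'cV[R]_n.+1 :=
  col_mx z.1%:M z.2 : 'cV[R]_(1 + n).

Lemma continuous_cons_cV n : continuous (@cons_cV n).
Proof.
move=> [x y]; apply/cvg_ballP => e e0.
exists (ball x e, ball y e) => /=; first by split; exact: nbhsx_ballx.
move=> [x' y'] [/= bx [_ by_]]; refine (conj e0 _) => i j; rewrite ord1.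
rewrite /cons_cV -[i](@splitK 1 n); case: (fintype.split _) => k /=.
  by rewrite !(@col_mxEu R 1 n 1) !mxE ord1 eqxx !mulr1n.
by rewrite !(@col_mxEd R 1 n 1); exact: by_.
Qed.

Lemma measurable_cons_cV n : measurable_fun setT (@cons_cV n).
Proof.
apply: (@measurability _ _ _ _ setT _ [set U : set 'cV[R]_n.+1 | open U]) => //.
move=> _ [U oU <-]; rewrite setTI; apply: measurable_open_prod.
by apply: open_comp => // z _; exact: continuous_cons_cV.
Qed.

(* The iterated product of the Lebesgue measure on R (a unit mass for n = 0).
   The canonical instance is named because the measure structure of a
   pushforward depends on a proof of measurability of the map. *)
Fixpoint lebesgue_cV (n : nat) : {measure set 'cV[R]_n -> \bar R} :=
  if n is n'.+1 then
    measure_function_pushforward__canonical__measure_function_Measure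
      (@lebesgue_measure R \x^ lebesgue_cV n')%E (@measurable_cons_cV n')
  else \d_(0 : 'cV[R]_0).

End lebesgue_cV.
Arguments lebesgue_cV {R n}.

Section matrices.
Context (R : realType) (n : nat).
Implicit Types (A P W : 'M[R]_n) (v : 'cV[R]_n).

Definition posdefmx P : Prop :=
  P^T = P /\ forall x : 'cV[R]_n, x != 0 -> 0 < (x^T *m P *m x) 0 0.

Definition sqrtmx P : 'M[R]_n :=
  xget 0 [set S | posdefmx S /\ S *m S = P].

(* f applied to a symmetric matrix through an orthogonal diagonalization: if
   A = Q diag(d) Q', then f(A) = Q diag(f(d)) Q', which does not depend on the
   choice of Q and d. *)
Definition spectral_fun (f : R -> R) A : 'M[R]_n :=
  xget 0 [set B | exists (Q : 'M[R]_n) (d : 'rV[R]_n),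
    [/\ Q^T *m Q = 1%:M, A = Q *m diag_mx d *m Q^T
      & B = Q *m diag_mx (map_mx f d) *m Q^T]].

Definition logmx A : 'M[R]_n := spectral_fun (@ln R) A.
Definition powmx A (t : R) : 'M[R]_n := spectral_fun (fun x => x `^ t) A.

Definition frobenius A : R := Num.sqrt (\sum_i \sum_j A i j ^+ 2).

Definition sqnormW W v : R := (v^T *m W *m v) 0 0.
Definition sqnorm2 v : R := (v^T *m v) 0 0.

End matrices.

Section densities.
Context (R : realType) (n : nat).
Implicit Types p : 'cV[R]_n -> R.

Definition is_density p : Prop :=
  [/\ measurable_fun setT p, forall x, 0 <= p x
    & (\int[lebesgue_cV]_x (p x)%:E = 1)%E].

Definition density_measure p (A : set 'cV[R]_n) : \bar R :=
  (\int[lebesgue_cV]_(x in A) (p x)%:E)%E.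

Definition expect p (g : 'cV[R]_n -> R) : \bar R :=
  (\int[lebesgue_cV]_x (g x * p x)%:E)%E.

Definition second_moment p : 'M[R]_n :=
  \matrix_(i, j) fine (expect p (fun x => x i 0 * x j 0)).

Definition gaussian_pdf (P : 'M[R]_n) (x : 'cV[R]_n) : R :=
  (Num.sqrt ((2 * pi) ^+ n * \det P))^-1 *
  expR (- (x^T *m invmx P *m x) 0 0 / 2).

(* Densities are identified when they agree Lebesgue-almost everywhere. *)
Definition density_eq p q : Prop := {ae lebesgue_cV, forall x, p x = q x}.

End densities.

(* f is of class C^k on a finite-dimensional space V: all iterated directional
   derivatives up to order k exist, and those of order k are continuous. *)
Fixpoint classC (R : realType) (V : normedModType R) (k : nat) (f : V -> R)
    : Prop :=
  if k is k'.+1 then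
    forall v, (forall x, derivable f x v) /\ classC k' ('D_v f)
  else continuous f.

Section paths.
Context (R : realType) (n : nat).

Definition test_function (phi : R * 'cV[R]_n -> R) : Prop :=
  [/\ forall k, classC k phi,
      compact (closure [set z | phi z != 0])
    & closure [set z | phi z != 0] `<=` `]0, 1[ `*` setT].

Implicit Types (p : R -> 'cV[R]_n -> R) (v : R -> 'cV[R]_n -> 'cV[R]_n).

(* dp/dt + div (p v) = 0 in the sense of distributions on ]0, 1[ x R^n. For a
   smooth phi, the derivative along (0, v) is the inner product of the gradient
   of phi in x with v. *)
Definition continuity_equation p v : Prop :=
  forall phi, test_function phi ->
    \int[lebesgue_measure]_(t in `[0, 1]) \int[lebesgue_cV]_x
      (('D_(1, 0) phi (t, x) + 'D_(0, v t x) phi (t, x)) * p t x) = 0.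

Definition narrowly_continuous p : Prop :=
  forall f : 'cV[R]_n -> R, continuous f ->
    (exists M : R, forall x, `|f x| <= M) ->
    {within `[0, 1], continuous (fun t => fine (expect (p t) f))}.

Definition admissible (p0 p1 : 'cV[R]_n -> R) p v : Prop :=
  [/\ [/\ forall t : R, t \in `[0, 1] -> is_density (p t),
          forall t : R, t \in `[0, 1] -> (expect (p t) (@sqnorm2 R n) < +oo)%E
        & narrowly_continuous p],
      measurable_fun ((`[0, 1]%classic : set R) `*` [set: 'cV[R]_n])
        (fun z : R * 'cV[R]_n => v z.1 z.2),
      (\int[lebesgue_measure]_(t in `[0%R, 1%R])
         expect (p t) (fun x => sqnorm2 (v t x)) < +oo)%E,
      continuity_equation p v
    & density_eq (p 0) p0 /\ density_eq (p 1) p1].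

Definition cost p v : \bar R :=
  (4%:E * \int[lebesgue_measure]_(t in `[0%R, 1%R])
    expect (p t) (fun x => sqnormW (invmx (second_moment (p t))) (v t x)))%E.

Definition is_minimizer (p0 p1 : 'cV[R]_n -> R) p v : Prop :=
  admissible p0 p1 p v /\
  forall q w, admissible p0 p1 q w -> (cost p v <= cost q w)%E.

End paths.

(* Main.v *)
(* Write P0 = K K' and P1 = K diag(exp l) K'. The linear flow
   z |-> K diag(exp(t l / 2)) z transports the standard Gaussian to the candidate
   path, which therefore has covariance K diag(exp(t l)) K', velocity
   x |-> K diag(l / 2) K^-1 x and constant cost sum_i l_i^2.

   For an arbitrary admissible pair, testing the continuity equation against
   truncated quadratic functions shows that P_t = E[x x'] is absolutely
   continuous with derivative B + B', where B = E[x v']. Let V P V' = I be the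
   Cholesky normalization of K^-1 P_t K^-T and U = V K^-1, so that
   P_t^-1 = U' U. With x* = U x and v* = U v,
     4 E|v|^2_{P^-1} = sum_i E(2 v*_i - l_i x*_i)^2
                       + sum_i (4 l_i E[x*_i v*_i] - l_i^2),
   and 2 E[x*_i v*_i] is the derivative of the logarithm of the i-th Cholesky
   pivot, which integrates to l_i. Hence the cost is at least sum_i l_i^2, and
   equality forces 2 v*_i = l_i x*_i. Running the elimination from each
   coordinate in turn, this gives v = K diag(l / 2) K^-1 x. Finally a solution
   of the continuity equation with this velocity is constant along the flow,
   when tested against products of bump functions of the flow coordinates;
   thus it is the candidate path. *)

From HB Require Import structures.
Require Import Defs.
From mathcomp Require Import all_boot all_order all_algebra.
From mathcomp Require Import all_classical all_reals all_analysis.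
From mathcomp Require Import measurable_realfun.
From mathcomp Require Import perm.
From mathcomp Require complex.
From mathcomp Require Import ring lra.
Import Order.TTheory GRing.Theory Num.Theory.
Import numFieldNormedType.Exports.
Set Implicit Arguments.
Unset Strict Implicit.
Unset Printing Implicit Defensive.
Local Open Scope classical_set_scope.
Local Open Scope ring_scope.

(** * Spectral theorem for real symmetric matrices *)

(** A competitor need not be Gaussian and its velocity is only measurable, so the energy estimate
    uses nothing of it beyond [P] and [B], after passing to a representative that is regular at
    every real time. Quadratic functions are not test functions, and removing their truncation
    requires a bound on E|x|^2 uniform in time, which admissibility does not state; it comes from a
    differential inequality closed at the maximum over time.

    Cholesky pivots replace eigenvalues because they are rational in the entries of [P_t]: they stay
    absolutely continuous whatever the multiplicities. They stay positive because a law with a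
    density charges no hyperplane. Subtracting the constant [l_i] before squaring does the work of
    Cauchy-Schwarz and displays the equality case. The normalizing frame moves with [t], so equality
    is a priori known only in that frame; but the row of the first eliminated coordinate is a scalar
    multiple of a fixed row of [K^-1], and the scalar cancels. Uniqueness needs no general theory of
    the continuity equation: the flow is linear with an explicit inverse, so the transported test
    functions are explicit. *)

Section real_spectral.
Import complex.
Variable R : rcfType.

(** The complexification is hermitian, so it has an eigenvalue of the form [f r]. Being an
    eigenvalue means being a root of the characteristic polynomial, and this descends along the
    embedding of [R]. *)
Lemma sym_eigenvector n (A : 'M[R]_n.+1) : A^T = A ->
  exists (r : R) (v : 'rV_n.+1), v != 0 /\ v *m A = r *: v.
Proof.
move=> symA; pose f := real_complex R; pose Ac := map_mx f A.
have hAc : Ac \is hermsymmx.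
  apply: realsym_hermsym.
    apply/is_hermitianmxP; rewrite expr0 scale1r map_mx_id// /Ac.
    by rewrite -[in LHS]symA; apply/matrixP => i j; rewrite !mxE.
  apply/mxOverP => i j; rewrite mxE; apply/CrealP.
  by rewrite /f /=; exact: conjc_real.
have /orthomx_spectralP AcE := hermitian_normalmx hAc.
have /mxOverP/(_ 0 0) := hermitian_spectral_diag_real hAc.
set P := spectralmx Ac in AcE; set d := spectral_diag Ac in AcE * => d_real.
have Pu : P \in unitmx by exact: spectral_unit.
have [r dr] : exists r : R, d 0 0 = f r.
  by exists (complex.Re (d 0 0)); rewrite /f RRe_real.
have : eigenvalue Ac (f r).
  apply/eigenvalueP; exists (row 0 P).
    rewrite -row_mul {1}AcE !mulmxA mulmxV// mul1mx.
    by rewrite row_mul row_diag_mx -scalemxAl -rowE dr.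
  apply/eqP => P0; have := row_mul 0 P (invmx P); rewrite mulmxV// P0 mul0mx.
  by move/rowP => /(_ 0); rewrite !mxE eqxx => /eqP; rewrite oner_eq0.
rewrite eigenvalue_root_char /Ac -map_char_poly fmorph_root -eigenvalue_root_char.
by move/eigenvalueP => [v vA v0]; exists r, v.
Qed.

End real_spectral.

Section real_spectral.
Variable R : rcfType.

Lemma scalar_mx11 (S : pzRingType) (A : 'M[S]_1) : A = (A 0 0)%:M.
Proof. by apply/matrixP => i j; rewrite !ord1 mxE eqxx mulr1n. Qed.

Lemma normsq_cV_ge0 n (w : 'cV[R]_n) : 0 <= (w^T *m w) 0 0.
Proof.
by rewrite mxE; apply: sumr_ge0 => i _; rewrite mxE -expr2 sqr_ge0.
Qed.

Lemma normsq_cV_eq0 n (w : 'cV[R]_n) : ((w^T *m w) 0 0 == 0) = (w == 0).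
Proof.
rewrite mxE psumr_eq0 => [|i _]; last by rewrite mxE -expr2 sqr_ge0.
apply/allP/eqP => [w0|-> i _ /=]; last by rewrite !mxE mul0r.
apply/colP => i; have := w0 i (mem_index_enum i).
by rewrite !mxE -expr2 sqrf_eq0 => /eqP.
Qed.

(** Two vectors of the same length are exchanged by the reflection in the hyperplane orthogonal to
    their difference [w]; when [w = 0] the identity serves. *)
Lemma householder n (u : 'cV[R]_n.+1) : (u^T *m u) 0 0 = 1 ->
  exists H : 'M[R]_n.+1, [/\ H^T = H, H *m H = 1%:M & H *m delta_mx 0 0 = u].
Proof.
move=> u1; pose w := u - delta_mx 0 0; pose c := (w^T *m w) 0 0.
have [w0|w0] := eqVneq w 0.
  exists 1%:M; rewrite trmx1 !mul1mx; split=> //.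
  by apply/esym/eqP; rewrite -subr_eq0 -/w w0.
have cE : w^T *m w = c%:M by rewrite -scalar_mx11.
have c0 : c != 0 by rewrite /c normsq_cV_eq0.
have we : w^T *m delta_mx 0 0 = (u 0 0 - 1)%:M.
  by rewrite -colE [LHS]scalar_mx11 !mxE !eqxx.
(* Since [w' e = u 0 0 - 1], this value of [c] gives [2 / c * (w' e) = -1], whence
   [H e = e + w = u]. *)
have c2 : c = 2 - 2 * u 0 0.
  have : w^T *m w = (2 - 2 * u 0 0)%:M.
    rewrite {2}/w mulmxBr we /w linearB/= mulmxBl [u^T *m u]scalar_mx11 u1.
    rewrite trmx_delta -rowE [X in _ - X - _]scalar_mx11 mxE.
    by rewrite -!raddfB/=; congr _%:M; ring.
  by rewrite cE => /matrixP/(_ 0 0); rewrite !mxE eqxx !mulr1n.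
exists (1%:M - (2 / c) *: (w *m w^T)); split.
- by rewrite linearB/= trmx1 linearZ/= trmx_mul trmxK.
- rewrite mulmxBl mul1mx mulmxBr mulmx1 -scalemxAl -scalemxAr.
  rewrite -[w *m w^T *m _]mulmxA [w^T *m (_ *m _)]mulmxA cE mul_scalar_mx.
  rewrite -scalemxAr scalerA -mulrA mulVf// mulr1.
  by rewrite scalerA -scalerBl -addrA -opprD -scalerDl (_ : 2 / c + _ = 0) ?scale0r ?subr0//; ring.
- rewrite mulmxBl mul1mx -scalemxAl -mulmxA we mul_mx_scalar scalerA.
  rewrite (_ : 2 / c * _ = -1) ?scaleN1r ?opprK.
    by rewrite /w addrC subrK.
  by apply: (mulIf c0); rewrite mulrAC divfK// c2; ring.
Qed.

(** A reflection moves a unit eigenvector to the first basis vector; by symmetry the conjugated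
    matrix then splits off a 1 by 1 block, and the induction applies to the other block. *)
Lemma sym_spectral n (A : 'M[R]_n) : A^T = A ->
  exists (Q : 'M[R]_n) (d : 'rV[R]_n),
    Q^T *m Q = 1%:M /\ A = Q *m diag_mx d *m Q^T.
Proof.
elim: n A => [|n IH] A symA.
  by exists 1%:M, 0; split; rewrite ?trmx1 ?mulmx1//; apply/matrixP => -[].
have [r [v [v0 vA]]] := sym_eigenvector symA.
pose s := Num.sqrt ((v^T^T *m v^T) 0 0).
have s2 : s * s = (v^T^T *m v^T) 0 0 by rewrite -expr2 sqr_sqrtr// normsq_cV_ge0.
have s0 : s != 0.
  have : s * s != 0 by rewrite s2 normsq_cV_eq0 trmx_eq0.
  by rewrite mulf_eq0 orbb.
pose u := s^-1 *: v^T.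
have [|H [symH HH He]] := @householder _ u.
  rewrite /u [(_ *: _)^T]linearZ/= -scalemxAl -scalemxAr mxE [X in _ * X]mxE -s2.
  by field.
have Au : A *m u = r *: u.
  by rewrite /u -scalemxAr -{1}symA -trmx_mul vA linearZ/= scalerA mulrC -scalerA.
have HuE : H *m u = delta_mx 0 0 by rewrite -He mulmxA HH mul1mx.
pose B := H *m A *m H; have symB : B^T = B.
  by rewrite /B !trmx_mul symH symA mulmxA.
have AE : A = H *m B *m H by rewrite /B -!mulmxA HH mulmx1 mulmxA HH mul1mx.
have B0 : col 0 B = r *: delta_mx 0 0.
  by rewrite colE /B -!mulmxA He Au -scalemxAr HuE.
clearbody B.
pose B' := drsubmx (B : 'M[R]_(1 + n)).
have BE : B = block_mx r%:M 0 0 B' :> 'M[R]_(1 + n).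
  rewrite -[LHS](@submxK _ 1 n 1 n); congr block_mx.
  - apply/matrixP => i j; rewrite !ord1 !mxE/=.
    move/colP: B0 => /(_ 0); rewrite !mxE !eqxx mulr1 mulr1n => <-.
    by congr (fun_of_matrix B _ _); apply/val_inj.
  - apply/matrixP => i j; rewrite !ord1 -symB !mxE/=.
    move/colP: B0 => /(_ (rshift 1 j)); rewrite !mxE/= mulr0 => <-.
    by congr (fun_of_matrix B _ _); apply/val_inj.
  - apply/matrixP => i j; rewrite !ord1 !mxE/=.
    move/colP: B0 => /(_ (rshift 1 i)); rewrite !mxE/= mulr0 => <-.
    by congr (fun_of_matrix B _ _); apply/val_inj.
have [|Q' [d' [Q'1 B'E]]] := IH B'.
  by apply/matrixP => i j; rewrite !mxE -[in RHS]symB mxE.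
exists (H *m (block_mx 1%:M 0 0 Q' : 'M[R]_(1 + n))), (row_mx r%:M d' : 'rV[R]_(1 + n)).
split.
  rewrite trmx_mul symH -mulmxA (mulmxA H) HH mul1mx.
  rewrite (@tr_block_mx _ 1 n 1 n) (@mulmx_block _ 1 n 1 n 1 n) !trmx0 trmx1.
  by rewrite !mulmx0 !mul0mx mulmx1 !addr0 add0r Q'1 -scalar_mx_block.
rewrite AE trmx_mul symH BE -!mulmxA; congr (H *m _); rewrite !mulmxA; congr (_ *m H).
rewrite (@tr_block_mx _ 1 n 1 n) (@diag_mx_row _ n 1) !(@mulmx_block _ 1 n 1 n 1 n) !trmx0 trmx1.
rewrite !(mulmx0, mul0mx, mulmx1, mul1mx, addr0, add0r) -B'E.
by rewrite [diag_mx _]scalar_mx11 !mxE eqxx !mulr1n.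
Qed.

End real_spectral.

(** * Positive definite matrices *)

Section posdef.
Variable R : realType.

Lemma posdefmx_sym n (P : 'M[R]_n) : posdefmx P -> P^T = P.
Proof. by case. Qed.

Lemma posdefmx_unit n (P : 'M[R]_n) : posdefmx P -> P \in unitmx.
Proof.
move=> [_ P0]; rewrite -row_free_unit -kermx_eq0; apply/eqP/row_matrixP => i.
rewrite row0; apply/eqP; apply: contraT => vn0.
have := P0 (row i (kermx P))^T; rewrite trmx_eq0 => /(_ vn0).
by rewrite trmxK (sub_kermxP (row_sub _ _)) mul0mx mxE ltxx.
Qed.

Lemma posdefmx_congr n (P K : 'M[R]_n) : posdefmx P -> K \in unitmx ->
  posdefmx (K *m P *m K^T).
Proof.
move=> [symP P0] Ku; split; first by rewrite !trmx_mul trmxK symP mulmxA.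
move=> x x0; rewrite !mulmxA -(trmxK K) -trmx_mul trmxK -mulmxA; apply: P0.
apply: contra x0 => /eqP Kx.
have -> : x = invmx K^T *m (K^T *m x) by rewrite mulKmx ?unitmx_tr.
by rewrite Kx mulmx0.
Qed.

Lemma posdefmx_diag n (d : 'rV[R]_n) : (forall i, 0 < d 0 i) <-> posdefmx (diag_mx d).
Proof.
split=> [d0|[_ d0] i].
  split=> [|x x0]; first by rewrite tr_diag_mx.
  have qE : (x^T *m diag_mx d *m x) 0 0 = \sum_i d 0 i * x i 0 ^+ 2.
    by rewrite mul_mx_diag mxE; apply: eq_bigr => i _; rewrite !mxE; ring.
  have dx i : 0 <= d 0 i * x i 0 ^+ 2 by rewrite mulr_ge0 ?sqr_ge0// ltW.
  rewrite lt_neqAle qE sumr_ge0// andbT eq_sym psumr_eq0//.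
  apply: contra x0 => /allP xi; apply/eqP/colP => i.
  have := xi i (mem_index_enum i); rewrite /= mulf_eq0 (gt_eqF (d0 i))/=.
  by rewrite sqrf_eq0 mxE => /eqP.
have := d0 (delta_mx i 0); rewrite trmx_delta -rowE -colE !mxE eqxx mulr1n; apply.
by apply/eqP => /matrixP/(_ i 0); rewrite !mxE !eqxx => /eqP; rewrite oner_eq0.
Qed.

Lemma posdefmx_spectral n (P : 'M[R]_n) : posdefmx P ->
  exists (Q : 'M[R]_n) (d : 'rV[R]_n),
    [/\ Q^T *m Q = 1%:M, P = Q *m diag_mx d *m Q^T & forall i, 0 < d 0 i].
Proof.
move=> Ppos; have [Q [d [QQ PE]]] := sym_spectral (posdefmx_sym Ppos).
exists Q, d; split=> //; apply/posdefmx_diag.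
have -> : diag_mx d = Q^T *m P *m Q^T^T.
  by rewrite PE trmxK !mulmxA QQ mul1mx -mulmxA QQ mulmx1.
by apply: posdefmx_congr => //; have [] := mulmx1_unit QQ.
Qed.

Lemma sqrtmxP n (P : 'M[R]_n) : posdefmx P ->
  posdefmx (sqrtmx P) /\ sqrtmx P *m sqrtmx P = P.
Proof.
move=> /posdefmx_spectral[Q [d [QQ PE d0]]].
rewrite /sqrtmx; case: xgetP => [S -> //|/(_ (Q *m diag_mx (map_mx Num.sqrt d) *m Q^T))].
case; split.
  apply: posdefmx_congr; last by have [] := mulmx1_unit QQ; rewrite unitmx_tr.
  by apply/posdefmx_diag => i; rewrite mxE sqrtr_gt0.
rewrite !mulmxA -[_ *m Q^T *m Q]mulmxA QQ mulmx1 PE; congr (_ *m _).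
rewrite -mulmxA mulmx_diag; congr (_ *m diag_mx _); apply/rowP => i; rewrite !mxE.
by rewrite -expr2 sqr_sqrtr// ltW.
Qed.

(** Independence of the diagonalization: [U = Q'^T Q] intertwines the two diagonal matrices, so
    [U i j] can be nonzero only when [d' i = d j]. Hence [U] also intertwines their images under
    [f]. *)
Lemma spectral_funE n (f : R -> R) (Q : 'M[R]_n) (d : 'rV[R]_n) :
  Q^T *m Q = 1%:M ->
  spectral_fun f (Q *m diag_mx d *m Q^T) = Q *m diag_mx (map_mx f d) *m Q^T.
Proof.
move=> QQ; rewrite /spectral_fun; case: xgetP; last first.
  by move=> /(_ (Q *m diag_mx (map_mx f d) *m Q^T)); case; exists Q, d.
move=> B -> [Q' [d' [QQ' eqA ->]]].
have [QQt QQt'] := (mulmx1C QQ, mulmx1C QQ').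
pose U := Q'^T *m Q.
have UE : diag_mx d' *m U = U *m diag_mx d.
  rewrite /U; transitivity (Q'^T *m (Q' *m diag_mx d' *m Q'^T) *m Q).
    by rewrite !mulmxA QQ' mul1mx.
  by rewrite -eqA !mulmxA -[_ *m Q^T *m Q]mulmxA QQ mulmx1.
have UfE : diag_mx (map_mx f d') *m U = U *m diag_mx (map_mx f d).
  move: (U) UE => V UE; apply/matrixP => i j; move/matrixP/(_ i j): UE.
  rewrite !mul_diag_mx !mul_mx_diag !mxE => e.
  have [->|u0] := eqVneq (V i j) 0; first by rewrite mul0r mulr0.
  by rewrite mulrC; congr (_ * f _); apply: (mulIf u0); rewrite e mulrC.
have -> : Q = Q' *m U by rewrite mulmxA QQt' mul1mx.
rewrite trmx_mul -!mulmxA; congr (_ *m _); rewrite !mulmxA -UfE -!mulmxA.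
have -> : U^T *m Q'^T = Q^T by rewrite trmx_mul trmxK -mulmxA QQt' mulmx1.
by rewrite QQt mulmx1.
Qed.

Lemma frobenius_spectral n (Q : 'M[R]_n) (d : 'rV[R]_n) : Q^T *m Q = 1%:M ->
  frobenius (Q *m diag_mx d *m Q^T) ^+ 2 = \sum_i d 0 i ^+ 2.
Proof.
move=> QQ; rewrite /frobenius sqr_sqrtr; last first.
  by apply: sumr_ge0 => i _; apply: sumr_ge0 => j _; exact: sqr_ge0.
set B := Q *m _ *m _; transitivity (\tr (B *m B^T)).
  by rewrite /mxtrace; apply: eq_bigr => i _; rewrite [RHS]mxE; apply: eq_bigr => j _; rewrite [B^T _ _]mxE.
rewrite /B !trmx_mul trmxK tr_diag_mx !mulmxA -[_ *m Q^T *m Q]mulmxA QQ mulmx1.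
rewrite mxtrace_mulC !mulmxA QQ mul1mx mulmx_diag mxtrace_diag.
by apply: eq_bigr => i _; rewrite mxE expr2.
Qed.

(** With [M = Q diag(d) Q'], the choice [K = S Q] and [l = ln d] diagonalizes [P0] and [P1]
    simultaneously by congruence, and the whole geodesic between them with the same [K]. *)
Lemma geodesic_diagonal n (P0 P1 : 'M[R]_n) : posdefmx P0 -> posdefmx P1 ->
  let S := sqrtmx P0 in
  let M := invmx S *m P1 *m invmx S in
  exists (K : 'M[R]_n) (l : 'rV[R]_n),
    [/\ K \in unitmx, P0 = K *m K^T,
        P1 = K *m diag_mx (map_mx expR l) *m K^T,
        forall t, S *m powmx M t *m S = K *m diag_mx (map_mx expR (t *: l)) *m K^T
      & 2^-1 *: (S *m logmx M *m invmx S) = K *m diag_mx (2^-1 *: l) *m invmx K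
        /\ frobenius (logmx M) ^+ 2 = \sum_i l 0 i ^+ 2].
Proof.
move=> P0p P1p S M; have [Sp SS] := sqrtmxP P0p; rewrite -/S in Sp SS.
have Su := posdefmx_unit Sp; have St := posdefmx_sym Sp.
have Mp : posdefmx M.
  rewrite /M; have -> : invmx S *m P1 *m invmx S = invmx S *m P1 *m (invmx S)^T.
    by rewrite trmx_inv St.
  by apply: posdefmx_congr; rewrite ?unitmx_inv.
have [Q [d [QQ ME d0]]] := posdefmx_spectral Mp.
have QQt := mulmx1C QQ; have [Qtu Qu] := mulmx1_unit QQ.
exists (S *m Q), (map_mx (@ln R) d).
have dE : map_mx expR (map_mx (@ln R) d) = d.
  by apply/rowP => i; rewrite !mxE lnK// posrE.
have KV : invmx (S *m Q) = Q^T *m invmx S.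
  have KK : S *m Q *m (Q^T *m invmx S) = 1%:M.
    by rewrite mulmxA -(mulmxA S) QQt mulmx1 mulmxV.
  have [Ku _] := mulmx1_unit KK.
  by rewrite -[LHS]mulmx1 -KK mulKmx.
split.
- by rewrite unitmx_mul Su Qu.
- by rewrite trmx_mul St mulmxA -(mulmxA S) QQt mulmx1 SS.
- rewrite dE trmx_mul St; transitivity (S *m M *m S); last by rewrite ME !mulmxA.
  by rewrite /M !mulmxA mulmxV// mul1mx mulmxKV.
- move=> t; rewrite ME /powmx spectral_funE// trmx_mul St !mulmxA.
  suff -> : map_mx (powR (R:=R) ^~ t) d = map_mx expR (t *: map_mx (@ln R) d) by [].
  (* [powR] is [expR (t * ln x)] except at base [0], which positivity of [d] excludes. *)
  by apply/rowP => i; rewrite !mxE /powR gt_eqF.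
- split; last by rewrite ME /logmx spectral_funE// frobenius_spectral.
  rewrite KV ME /logmx spectral_funE// !mulmxA linearZ/= -!scalemxAr -!scalemxAl.
  by [].
Qed.

End posdef.

(** * Borel and Lebesgue structure of column vectors *)

Section continuity_combinators.
Context (R : realType) (T : topologicalType).
Implicit Types f g : T -> R.

Lemma cts_cst (c : R) : continuous (fun _ : T => c).
Proof. by move=> x; exact: cvg_cst. Qed.

Lemma ctsD f g : continuous f -> continuous g -> continuous (fun x => f x + g x).
Proof. by move=> cf cg x; apply: cvgD; [exact: cf|exact: cg]. Qed.

Lemma ctsM f g : continuous f -> continuous g -> continuous (fun x => f x * g x).
Proof. by move=> cf cg x; apply: cvgM; [exact: cf|exact: cg]. Qed.

Lemma ctsN f : continuous f -> continuous (fun x => - f x).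
Proof. by move=> cf x; apply: cvgN; exact: cf. Qed.

Lemma ctsB f g : continuous f -> continuous g -> continuous (fun x => f x - g x).
Proof. by move=> cf cg; apply: ctsD => //; exact: ctsN. Qed.

Lemma cts_comp (h : R -> R) f : continuous h -> continuous f -> continuous (fun x => h (f x)).
Proof. by move=> ch cf x; apply: (@continuous_comp _ _ _ f h); [exact: cf|exact: ch]. Qed.

Lemma cts_sum (I : Type) (r : seq I) (P : pred I) (F : I -> T -> R) :
  (forall i, continuous (F i)) -> continuous (fun x => \sum_(i <- r | P i) F i x).
Proof.
move=> cF x; apply: cvg_big => [|i _]; first exact: add_continuous.
exact: cF.
Qed.

End continuity_combinators.

Section borel_functions.
Variable R : realType.

Lemma measurable_fun_openP d (T : measurableType d) (D : set T) (f : T -> R) :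
  measurable D ->
  (forall U : set R, open U -> measurable (D `&` f @^-1` U)) -> measurable_fun D f.
Proof.
move=> mD fU; apply: (measurability (@RGenOpens.G R)); first exact: RGenOpens.measurableE.
move=> _ [_ [a [b ->] <-]]; apply: fU; exact: interval_open.
Qed.

Lemma continuous_measurable_mx m n (f : 'M[R]_(m, n) -> R) :
  continuous f -> measurable_fun setT f.
Proof.
move=> cf; apply: measurable_fun_openP => // U oU; rewrite setTI.
by apply: measurable_open_mx; apply: open_comp => // x _; exact: cf.
Qed.

Lemma continuous_measurable_prod n (f : R * 'cV[R]_n -> R) :
  continuous f -> measurable_fun setT f.
Proof.
move=> cf; apply: measurable_fun_openP => // U oU; rewrite setTI.
by apply: measurable_open_prod; apply: open_comp => // x _; exact: cf.
Qed.

Lemma measurable_fun_mx_openP d (T : measurableType d) m n (D : set T) (f : T -> 'M[R]_(m, n)) :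
  (forall U : set 'M[R]_(m, n), open U -> measurable (D `&` f @^-1` U)) -> measurable_fun D f.
Proof.
move=> fU; apply: (measurability [set U : set 'M[R]_(m, n) | open U]) => //.
by move=> _ [U oU <-]; exact: fU.
Qed.

Lemma continuous_measurable_cV m n (f : 'cV[R]_n -> 'cV[R]_m) :
  continuous f -> measurable_fun setT f.
Proof.
move=> cf; apply: measurable_fun_mx_openP => U oU; rewrite setTI.
by apply: measurable_open_mx; apply: open_comp => // x _; exact: cf.
Qed.

Lemma cvg_mx_coord (T : Type) (F : set_system T) {FF : Filter F} m n
    (f : T -> 'M[R]_(m, n)) (l : 'M[R]_(m, n)) :
  (forall i j, f x i j @[x --> F] --> l i j) -> f @ F --> l.
Proof.
move=> fl; apply/cvg_ballP => e e0.
have H : \forall x \near F, forall i j, ball (l i j) e (f x i j).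
  by apply: filter_forall => i; apply: filter_forall => j; have /cvg_ballP/(_ _ e0) := fl i j.
by move: H; apply: filterS => x xl; split.
Qed.

Lemma continuous_mulmxl m n p (A : 'M[R]_(m, n)) :
  continuous (fun x : 'M[R]_(n, p) => A *m x).
Proof.
move=> x; apply: (@cvg_mx_coord _ _ (nbhs_filter x)) => i j.
rewrite (_ : (fun y => _) = (fun y : 'M[R]_(n, p) => \sum_k A i k * y k j)); last first.
  by apply/funext => y; rewrite mxE.
rewrite mxE; apply: cvg_big => [|k _]; first exact: add_continuous.
by apply: cvgMl_tmp; exact: coord_continuous.
Qed.

Lemma measurable_mulmxl m n (A : 'M[R]_(m, n)) :
  measurable_fun setT (fun x : 'cV[R]_n => A *m x).
Proof. by apply: continuous_measurable_cV; exact: continuous_mulmxl. Qed.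

Lemma measurable_coord n (i : 'I_n) : measurable_fun setT (fun x : 'cV[R]_n => x i 0).
Proof. by apply: continuous_measurable_mx => x; exact: coord_continuous. Qed.

End borel_functions.

Section lebesgue_cV_theory.
Variable R : realType.

Lemma lebesgue_cVS n (A : set 'cV[R]_n.+1) :
  lebesgue_cV A = ((@lebesgue_measure R) \x^ (@lebesgue_cV R n))%E (@cons_cV R n @^-1` A).
Proof. by []. Qed.

(** The balls are those of the sup norm, hence products of intervals. This is what sigma-finiteness
    rests on. *)
Lemma lebesgue_cV_ball n (r : R) : 0 < r ->
  (@lebesgue_cV R n (ball (0%R : 'cV[R]_n) r) < +oo)%E.
Proof.
move=> r0; elim: n => [|n IH].
  by rewrite /= diracE ltry.
rewrite lebesgue_cVS.
have -> : @cons_cV R n @^-1` (ball 0 r) = ball (0 : R) r `*` ball (0 : 'cV[R]_n) r.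
  apply/seteqP; split=> [[x y] [_ /= h]|[x y] [/= hx [_ hy]]].
    split; first by have := h (@lshift 1 n 0) 0; rewrite /cons_cV (@col_mxEu R 1 n 1) !mxE.
    split=> // i j; have := h (@rshift 1 n i) j.
    by rewrite /cons_cV (@col_mxEd R 1 n 1) !mxE.
  split=> // i j; rewrite -[i](@splitK 1 n); case: (fintype.split _) => k /=.
    by rewrite /cons_cV (@col_mxEu R 1 n 1) !mxE !ord1 eqxx mulr1n.
  by rewrite /cons_cV (@col_mxEd R 1 n 1) mxE; have := hy k j; rewrite mxE.
rewrite product_measure2E.
- by apply: lte_mul_pinfty => //; rewrite [X in X \is a fin_num](lebesgue_measure_ball _ (ltW r0)).
- by apply: open_measurable; exact: (@ball_open R R).
- by apply: measurable_open_mx; exact: ball_open.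
Qed.

Lemma lebesgue_cV_sigma_finite n : sigma_finite setT (@lebesgue_cV R n).
Proof.
exists (fun k => ball (0 : 'cV[R]_n) k.+1%:R).
  apply/esym/seteqP; split=> // x _.
  exists (Num.truncn `|x|) => //; rewrite -ball_normE /ball_ /= sub0r normrN.
  exact: truncnS_gt.
move=> k; split; first by apply: measurable_open_mx; exact: ball_open.
exact: lebesgue_cV_ball.
Qed.

(** A copy convertible to [lebesgue_cV], on which the sigma-finiteness required by Fubini is
    registered. *)
Definition leb n : set 'cV[R]_n -> \bar R := @lebesgue_cV R n.
HB.instance Definition _ n := Measure.copy (@leb n) (@lebesgue_cV R n).
HB.instance Definition _ n :=
  Measure_isSigmaFinite.Build _ _ _ (@leb n) (@lebesgue_cV_sigma_finite n).

(** [lebesgue_cV] is built from [\x^], while Fubini-Tonelli is about [\x]; the two products agree on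
    rectangles, hence everywhere by uniqueness. *)
Lemma integral_lebS n (f : 'cV[R]_n.+1 -> \bar R) :
  measurable_fun setT f -> (forall x, 0 <= f x)%E ->
  (\int[@leb n.+1]_x f x =
   \int[lebesgue_measure]_x \int[@leb n]_y f (cons_cV (x, y)))%E.
Proof.
move=> mf f0.
have mfc : measurable_fun setT (f \o @cons_cV R n).
  by apply: measurableT_comp => //; exact: measurable_cons_cV.
rewrite [RHS](_ : _ = \int[(@lebesgue_measure R) \x (@leb n)]_z (f \o @cons_cV R n) z)%E; last first.
  rewrite (@fubini_tonelli1 _ _ _ _ _ lebesgue_measure (@leb n) (f \o @cons_cV R n))//.
  by move=> z; exact: f0.
transitivity (\int[(@lebesgue_measure R) \x^ (@leb n)]_z (f \o @cons_cV R n) z)%E.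
  by rewrite [LHS]ge0_integral_pushforward//; exact: measurable_cons_cV.
apply: eq_measure_integral => //= A mA _; apply/esym.
apply: product_measure_unique => //= B C mB mC; rewrite product_measure2E//.
Qed.

Lemma integral_lebS' n (f : 'cV[R]_n.+1 -> \bar R) :
  measurable_fun setT f -> (forall x, 0 <= f x)%E ->
  (\int[@leb n.+1]_x f x =
   \int[@leb n]_y \int[lebesgue_measure]_x f (cons_cV (x, y)))%E.
Proof.
move=> mf f0; rewrite integral_lebS//.
have mfc : measurable_fun setT (f \o @cons_cV R n).
  by apply: measurableT_comp => //; exact: measurable_cons_cV.
by rewrite (@fubini_tonelli _ _ _ _ _ lebesgue_measure (@leb n) (f \o @cons_cV R n))// => z; exact: f0.
Qed.

(** By uniqueness of Lebesgue measure it suffices that [|a|] times its image under the affine map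
    has the right value on half-open intervals. For [a < 0] the preimage is half-open on the other
    side, which does not change its length. *)
Lemma lebesgue_affine (a b : R) (f : R -> \bar R) : a != 0 ->
  measurable_fun setT f -> (forall x, 0 <= f x)%E ->
  (\int[lebesgue_measure]_x f x =
   `|a|%:E * \int[lebesgue_measure]_x f (a * x + b)%R)%E.
Proof.
move=> a0 mf f0.
have ma : measurable_fun [set: R] (fun x : R => a * x + b).
  by apply: measurable_funD => //; apply: measurable_funM.
pose phi : measurableTypeR R -> measurableTypeR R := (fun x : R => a * x + b).
have mphi : measurable_fun setT phi by [].
pose nu := measure_function_pushforward__canonical__measure_function_Measure (@lebesgue_measure R) mphi.
pose nu' : {measure set (measurableTypeR R) -> \bar R} := mscale (NngNum (normr_ge0 a)) nu.
have nuE A : measurable A -> lebesgue_measure A = nu' A.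
  apply: lebesgue_measure_unique => _ [[u v] uv <-] /=.
  rewrite /nu' /mscale /= /pushforward lebesgue_measure_itv/= lte_fin.
  have [a_gt0|a_lt0|a_eq0] := ltrgt0P a; last by rewrite a_eq0 eqxx in a0.
    have -> : phi @^-1` `]u, v] = `](u - b) / a, (v - b) / a]%classic.
      apply/seteqP; split => x /=; rewrite !in_itv/= /phi ltr_pdivrMr// ler_pdivlMr//;
        by rewrite ltrBlDr lerBrDr mulrC.
    rewrite lebesgue_measure_itv/= lte_fin ltr_pM2r ?invr_gt0// ltrD2r.
    case: ifP => _; last by rewrite mule0.
    by rewrite -EFinB -EFinM; congr EFin; field; rewrite gt_eqF.
  have -> : phi @^-1` `]u, v] = `[(v - b) / a, (u - b) / a[%classic.
    apply/seteqP; split => x /=; rewrite !in_itv/= /phi ltr_ndivlMr// ler_ndivrMr//;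
      by rewrite ltrBlDr lerBrDr mulrC andbC.
  rewrite lebesgue_measure_itv/= lte_fin ltr_nM2r ?invr_lt0// ltrD2r.
  case: ifP => _; last by rewrite mule0.
  by rewrite -EFinB -EFinM; congr EFin; field; rewrite lt_eqF.
transitivity (\int[nu']_x f x)%E.
  by apply: eq_measure_integral => A mA _; exact: nuE.
rewrite [LHS]ge0_integral_mscale// /nu; congr (_ * _)%E.
by rewrite [LHS]ge0_integral_pushforward.
Qed.

End lebesgue_cV_theory.
Arguments leb {R} n.

(** * Linear changes of variables *)

Section change_of_variables.
Variable R : realType.
Implicit Types n : nat.
Local Notation mu := (@lebesgue_measure R).

Lemma cons_cVD n (x x' : R) (y y' : 'cV[R]_n) :
  cons_cV (x, y) + cons_cV (x', y') = cons_cV (x + x', y + y').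
Proof. by rewrite /cons_cV/= raddfD/= -(@add_col_mx R 1 n 1). Qed.

Lemma cons_cV_surj n (z : 'cV[R]_n.+1) : exists x y, z = cons_cV (x, y).
Proof.
exists ((usubmx (z : 'cV[R]_(1 + n))) 0 0), (dsubmx (z : 'cV[R]_(1 + n))).
rewrite /cons_cV/= -[LHS](@vsubmxK _ 1 n 1); congr (@col_mx _ 1 n 1 _ _).
exact: scalar_mx11.
Qed.

Lemma cons_cV0 n (x : R) (y : 'cV[R]_n) : cons_cV (x, y) 0 0 = x.
Proof.
have -> : 0 = lshift n (0 : 'I_1) :> 'I_n.+1 by exact/val_inj.
by rewrite /cons_cV (@col_mxEu R 1 n 1) mxE.
Qed.

Lemma cons_cV_lift n (x : R) (y : 'cV[R]_n) i : cons_cV (x, y) (lift 0 i) 0 = y i 0.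
Proof. by rewrite -rshift1 /cons_cV (@col_mxEd R 1 n 1). Qed.

Lemma mul_block_cons_cV n (a : R) (c : 'rV[R]_n) (b : 'cV[R]_n) (D : 'M[R]_n) x y :
  (block_mx a%:M c b D : 'M[R]_n.+1) *m cons_cV (x, y) =
  cons_cV (a * x + (c *m y) 0 0, x *: b + D *m y).
Proof.
rewrite /cons_cV/= (@mul_block_col _ 1 n 1 n 1); congr (@col_mx _ 1 n 1 _ _).
  by rewrite -scalar_mxM [X in _ + X]scalar_mx11 -raddfD.
by rewrite mul_mx_scalar.
Qed.

Lemma measurable_cons_cVr n (x : R) : measurable_fun setT (fun y : 'cV[R]_n => cons_cV (x, y)).
Proof. by apply: measurableT_comp; [exact: measurable_cons_cV|exact: pair1_measurable]. Qed.

Lemma measurable_cons_cVl n (y : 'cV[R]_n) : measurable_fun setT (fun x : R => cons_cV (x, y)).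
Proof. by apply: measurableT_comp; [exact: measurable_cons_cV|exact: pair2_measurable]. Qed.

Lemma measurable_translation n (d : 'cV[R]_n) : measurable_fun setT (fun x : 'cV[R]_n => x + d).
Proof.
apply: continuous_measurable_cV => x.
apply: (@cvg_mx_coord _ _ _ (nbhs_filter x)) => i j; rewrite mxE.
rewrite (_ : (fun y => _) = (fun y : 'cV[R]_n => y i j + d i j)); last first.
  by apply/funext => y; rewrite mxE.
by apply: cvgD; [exact: coord_continuous|exact: cvg_cst].
Qed.

Lemma measurable_lebF n (f : 'cV[R]_n.+1 -> \bar R) :
  measurable_fun setT f -> (forall x, 0 <= f x)%E ->
  measurable_fun setT (fun x : R => \int[leb n]_y f (cons_cV (x, y)))%E.
Proof.
move=> mf f0.
have mfc : measurable_fun setT (f \o @cons_cV R n).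
  by apply: measurableT_comp => //; exact: measurable_cons_cV.
exact: (@measurable_fun_fubini_tonelli_F _ _ _ _ R (leb n) (f \o @cons_cV R n) mfc (fun z => f0 _)).
Qed.

Lemma measurable_lebG n (f : 'cV[R]_n.+1 -> \bar R) :
  measurable_fun setT f -> (forall x, 0 <= f x)%E ->
  measurable_fun setT (fun y : 'cV[R]_n => \int[mu]_x f (cons_cV (x, y)))%E.
Proof.
move=> mf f0.
have mfc : measurable_fun setT (f \o @cons_cV R n).
  by apply: measurableT_comp => //; exact: measurable_cons_cV.
exact: (@measurable_fun_fubini_tonelli_G _ _ _ _ R mu (f \o @cons_cV R n) mfc (fun z => f0 _)).
Qed.

Lemma leb_translation n (c : 'cV[R]_n) (f : 'cV[R]_n -> \bar R) :
  measurable_fun setT f -> (forall x, 0 <= f x)%E ->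
  (\int[leb n]_x f x = \int[leb n]_x f (x + c)%R)%E.
Proof.
elim: n c f => [|n IH] c f mf f0.
  by apply: eq_integral => x _; congr f; apply/matrixP => -[].
have [c0 [c' ->]] := cons_cV_surj c.
rewrite integral_lebS//.
have mfD : measurable_fun setT (fun x : 'cV[R]_n.+1 => f (x + cons_cV (c0, c'))).
  by apply: (measurableT_comp mf); exact: measurable_translation.
rewrite (integral_lebS mfD (fun x => f0 _)).
transitivity (\int[mu]_x \int[leb n]_y f (cons_cV ((1 * x + c0)%R, y)))%E.
  rewrite [LHS](lebesgue_affine c0 (oner_neq0 R))//.
  - by rewrite normr1 mul1e.
  - exact: measurable_lebF.
  - by move=> x; apply: integral_ge0 => y _; exact: f0.
apply: eq_integral => x _; rewrite (IH c')//.
  by apply: eq_integral => y _; rewrite cons_cVD mul1r.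
by apply: measurableT_comp => //; exact: measurable_cons_cVr.
Qed.

(** The change of variables formula as a property of the matrix, so that it propagates through
    products and hence through an LU factorization. *)
Definition chvar n (X : 'M[R]_n) : Prop := forall f : 'cV[R]_n -> \bar R,
  measurable_fun setT f -> (forall x, 0 <= f x)%E ->
  (\int[leb n]_x f x = `|\det X|%:E * \int[leb n]_x f (X *m x)%R)%E.

Lemma chvar1 n : chvar (1%:M : 'M[R]_n).
Proof.
by move=> f mf f0; rewrite det1 normr1 mul1e; apply: eq_integral => x _; rewrite mul1mx.
Qed.

Lemma chvarM n (X Y : 'M[R]_n) : chvar X -> chvar Y -> chvar (X *m Y).
Proof.
move=> hX hY f mf f0; rewrite hX// det_mulmx normrM EFinM -muleA; congr (_ * _)%E.
rewrite hY//; last by apply: measurableT_comp => //; exact: measurable_mulmxl.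
by congr (_ * _)%E; apply: eq_integral => x _; rewrite mulmxA.
Qed.

(** The first coordinate is integrated innermost: for fixed [y] it undergoes the affine map of slope
    [a] and shift [c y]. *)
Lemma chvar_ublock n (a : R) (c : 'rV[R]_n) (D : 'M[R]_n) : a != 0 -> chvar D ->
  chvar (block_mx a%:M c 0 D : 'M[R]_n.+1).
Proof.
move=> a0 hD f mf f0.
have mfX : measurable_fun setT (fun x => f ((block_mx a%:M c 0 D : 'M[R]_n.+1) *m x)).
  by apply: (measurableT_comp mf); exact: measurable_mulmxl.
rewrite (@det_ublock _ 1 n) det_scalar1 normrM EFinM -muleA.
rewrite integral_lebS'// hD; last 2 first.
- exact: measurable_lebG.
- by move=> y; apply: integral_ge0 => x _; exact: f0.
rewrite muleCA; congr (_ * _)%E.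
rewrite (integral_lebS' mfX (fun x => f0 _)).
rewrite -ge0_integralZl//; last 2 first.
- exact: (measurable_lebG mfX).
- by move=> y _; apply: integral_ge0 => x _; exact: f0.
apply: eq_integral => y _.
rewrite (lebesgue_affine ((c *m y) 0 0) a0)//; last first.
  by apply: measurableT_comp => //; exact: measurable_cons_cVl.
by congr (_ * _)%E; apply: eq_integral => x _; rewrite mul_block_cons_cV scaler0 add0r.
Qed.

(** Here the last coordinates are integrated innermost: for fixed [x] they undergo [D] followed by
    the translation by [x b]. *)
Lemma chvar_lblock n (a : R) (b : 'cV[R]_n) (D : 'M[R]_n) : a != 0 -> chvar D ->
  chvar (block_mx a%:M 0 b D : 'M[R]_n.+1).
Proof.
move=> a0 hD f mf f0.
have mfX : measurable_fun setT (fun x => f ((block_mx a%:M 0 b D : 'M[R]_n.+1) *m x)).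
  by apply: (measurableT_comp mf); exact: measurable_mulmxl.
rewrite (@det_lblock _ 1 n) det_scalar1 normrM EFinM -muleA.
rewrite integral_lebS// (lebesgue_affine 0 a0); last 2 first.
- exact: measurable_lebF.
- by move=> x; apply: integral_ge0 => y _; exact: f0.
congr (_ * _)%E.
rewrite (integral_lebS mfX (fun x => f0 _)).
rewrite -ge0_integralZl//; last 2 first.
- exact: (measurable_lebF mfX).
- by move=> y _; apply: integral_ge0 => x _; exact: f0.
apply: eq_integral => x _; rewrite addr0.
have mx : measurable_fun setT (fun y : 'cV[R]_n => f (cons_cV (a * x, y))).
  by apply: measurableT_comp => //; exact: measurable_cons_cVr.
rewrite (leb_translation (x *: b))// hD//; last first.
  by apply: (measurableT_comp mx); exact: measurable_translation.
by congr (_ * _)%E; apply: eq_integral => y _; rewrite mul_block_cons_cV mul0mx mxE addr0 addrC.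
Qed.

(** A matrix with nonzero corner is a product of a lower and an upper block triangular matrix, the
    latter containing the Schur complement, to which the induction applies. A zero corner is
    repaired by adding another row to the first one. *)
Lemma chvar_unit n (X : 'M[R]_n) : X \in unitmx -> chvar X.
Proof.
elim: n X => [|n IH] X Xu.
  have -> : X = 1%:M by apply/matrixP => -[].
  exact: chvar1.
have pivot (Y : 'M[R]_n.+1) : Y \in unitmx -> Y 0 0 != 0 -> chvar Y.
  move=> Yu a0; pose a := Y 0 0.
  pose b := dlsubmx (Y : 'M[R]_(1 + n)); pose c := ursubmx (Y : 'M[R]_(1 + n)).
  pose D := drsubmx (Y : 'M[R]_(1 + n)); pose S := D - a^-1 *: (b *m c).
  have YE : Y = block_mx a%:M c b D :> 'M[R]_(1 + n).
    rewrite -[LHS](@submxK _ 1 n 1 n); congr block_mx.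
    rewrite [LHS]scalar_mx11; congr (_%:M); rewrite !mxE; congr (fun_of_matrix Y _ _); exact/val_inj.
  have YLU : Y = (block_mx 1%:M 0 (a^-1 *: b) 1%:M : 'M[R]_n.+1) *m
                 (block_mx a%:M c 0 S : 'M[R]_n.+1).
    rewrite YE (@mulmx_block _ 1 n 1 n 1 n) !(mul1mx, mul0mx, addr0, mulmx0).
    by rewrite mul_mx_scalar scalerA mulfV// scale1r -scalemxAl /S addrC subrK.
  rewrite YLU; apply: chvarM.
    by apply: chvar_lblock; [exact: oner_neq0|exact: chvar1].
  apply: chvar_ublock => //; apply: IH.
  move: Yu; rewrite YLU unitmx_mul => /andP[_].
  by rewrite !unitmxE (@det_ublock _ 1 n) unitrM => /andP[].
have [X0|] := eqVneq (X 0 0) 0; last exact: pivot.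
have [i Xi] : exists i : 'I_n, X (lift 0 i) 0 != 0.
  apply/existsP; apply: contraT; rewrite negb_exists => /forallP Xi.
  have : col 0 X = 0.
    apply/colP => k; rewrite !mxE; case: (unliftP 0 k) => [i ->|->//].
    by have := Xi i; rewrite negbK => /eqP.
  rewrite colE => /(congr1 (mulmx (invmx X))); rewrite mulKmx// mulmx0.
  by move/matrixP/(_ 0 0); rewrite !mxE !eqxx => /eqP; rewrite oner_eq0.
(* Left multiplication by [E s] adds [s] times row [lift 0 i] to the first row. *)
pose E (s : R) : 'M[R]_n.+1 := @block_mx R 1 n 1 n 1%:M (s *: delta_mx 0 i) 0 1%:M.
have EE : E (-1) *m E 1 = 1%:M.
  rewrite /E (@mulmx_block _ 1 n 1 n 1 n) !mul1mx !mulmx1 !mul0mx mulmx0 !addr0 add0r.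
  by rewrite -scalerDl subrr scale0r -scalar_mx_block.
have [E'u Eu] := mulmx1_unit EE.
rewrite -[X]mul1mx -EE -mulmxA; apply: chvarM.
  by apply: chvar_ublock; [exact: oner_neq0|exact: chvar1].
apply: pivot; first by rewrite unitmx_mul Eu.
have [x [y Xxy]] := cons_cV_surj (col 0 X).
have x0 : x = 0 by rewrite -X0 -(cons_cV0 x y) -Xxy mxE.
have yi : y i 0 = X (lift 0 i) 0 by rewrite -(cons_cV_lift x y) -Xxy mxE.
have -> : (E 1 *m X) 0 0 = (col 0 (E 1 *m X)) 0 0 by rewrite [RHS]mxE.
rewrite colE -mulmxA -colE Xxy mul_block_cons_cV cons_cV0 x0 mulr0 add0r scale1r -rowE mxE yi.
exact: Xi.
Qed.

End change_of_variables.

(** * Measures with a density *)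

Section density_of_measure.
Local Open Scope ereal_scope.
Context d (T : measurableType d) (R : realType) (mu : {measure set T -> \bar R}).
Variable p : T -> R.

(** The two proofs are arguments of the set function, so that its measure structure can be recovered
    from the term itself. *)
Definition dens of measurable_fun [set: T] p & (forall x, (0 <= p x)%R) :=
  fun A : set T => \int[mu]_(x in A) (p x)%:E.

Hypotheses (mp : measurable_fun [set: T] p) (p0 : forall x, (0 <= p x)%R).
Local Notation nu := (dens mp p0).

Let nu0 : nu set0 = 0. Proof. by rewrite /dens integral_set0. Qed.

Let nu_ge0 A : 0 <= nu A.
Proof. by apply: integral_ge0 => x _; rewrite lee_fin. Qed.

Let nu_sigma_additive : semi_sigma_additive nu.
Proof.
move=> A mA tA mUA; rewrite /dens ge0_integral_bigcup//.
- by apply: is_cvg_ereal_nneg_natsum_cond => n _ _; exact: nu_ge0.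
- by apply/measurable_EFinP; exact: measurable_funTS.
- by move=> x _; rewrite lee_fin.
Qed.

HB.instance Definition _ := isMeasure.Build _ _ _ nu nu0 nu_ge0 nu_sigma_additive.

Import HBNNSimple.

(** True for indicators by definition of the measure, then for simple functions by linearity, and in
    general by monotone convergence on both sides. *)
Lemma ge0_integral_dens (f : T -> \bar R) :
  measurable_fun setT f -> (forall x, 0 <= f x) ->
  \int[nu]_x f x = \int[mu]_x (f x * (p x)%:E).
Proof.
move=> mf f0; have mpE : measurable_fun setT (EFin \o p) by exact/measurable_EFinP.
pose f_ := nnsfun_approx measurableT mf.
transitivity (limn (fun n => \int[nu]_x (f_ n x)%:E)).
  rewrite -monotone_convergence//.
  - by apply: eq_integral => y _; apply/esym/cvg_lim => //; exact: cvg_nnsfun_approx.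
  - by move=> n; exact/measurable_EFinP.
  - by move=> n y _; rewrite lee_fin.
  - by move=> y _ m n mn; rewrite lee_fin; exact/lefP/nd_nnsfun_approx.
transitivity (limn (fun n => \int[mu]_x ((f_ n x)%:E * (p x)%:E))); last first.
  rewrite -monotone_convergence//.
  - apply: eq_integral => y _; apply/cvg_lim => //.
    by apply: cvgeZr => //; exact: cvg_nnsfun_approx.
  - by move=> n; apply: emeasurable_funM => //; exact/measurable_EFinP.
  - by move=> n y _; rewrite mule_ge0// lee_fin.
  - move=> y _ m n mn; apply: lee_wpmul2r; rewrite lee_fin//.
    exact/lefP/nd_nnsfun_approx.
congr (limn _); apply/funext => n.
under [LHS]eq_integral do rewrite fimfunE -fsumEFin//.
rewrite ge0_integral_fsum//; last 2 first.
- by move=> y; exact/measurable_EFinP/measurable_funM.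
- by move=> y x _; rewrite nnfun_muleindic_ge0.
transitivity (\sum_(k \in range (f_ n))
    \int[mu]_x ((k * \1_(f_ n @^-1` [set k]) x)%:E * (p x)%:E)).
  apply: eq_fsbigr => r _.
  rewrite integralZl_indic_nnsfun//= integral_indic// setIT.
  (* The sum ranges over values [r] of a nonnegative function, but the terms are treated for every
     real [r]; negative levels have empty preimage. *)
  have [r0|r0] := ltP r 0%R.
    rewrite preimage_nnfun0//= nu0 mule0.
    by rewrite [RHS]integral0_eq// => x _; rewrite indic0 mulr0 mul0e.
  under [RHS]eq_integral do rewrite EFinM -muleA.
  rewrite ge0_integralZl//.
  - congr (_ * _); transitivity (\int[mu]_(x in f_ n @^-1` [set r]) (p x)%:E); first by [].
    rewrite integral_mkcond; apply: eq_integral => x _.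
    by rewrite patchE indicE; case: ifPn => _; rewrite ?mul1e ?mul0e.
  - by apply: emeasurable_funM => //; exact/measurable_EFinP/measurable_indic.
  - by move=> x _; rewrite mule_ge0// lee_fin// indicE.
rewrite -ge0_integral_fsum//.
- apply: eq_integral => x _; rewrite (fimfunE (f_ n) x) -fsumEFin// ge0_mule_fsuml//.
  by move=> r; exact: nnfun_muleindic_ge0.
- by move=> r; apply: emeasurable_funM => //; exact/measurable_EFinP/measurable_funM.
- by move=> r x _; apply: mule_ge0; [rewrite EFinM; exact: nnfun_muleindic_ge0|rewrite lee_fin].
Qed.

Lemma integral_dens (f : T -> R) : measurable_fun setT f ->
  \int[nu]_x (f x)%:E = \int[mu]_x (f x * p x)%:E.
Proof.
move=> mf; have mfE : measurable_fun setT (EFin \o f) by exact/measurable_EFinP.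
rewrite [LHS]integralE [RHS]integralE !ge0_integral_dens//.
- congr (_ - _); apply: eq_integral => x _.
    by rewrite !funeposE -!EFin_max -EFinM maxr_pMl// mul0r.
  by rewrite !funenegE -!EFinN -!EFin_max -EFinM maxr_pMl// mul0r mulNr.
- exact: measurable_funeneg.
- exact: measurable_funepos.
Qed.

End density_of_measure.

Lemma integral_transfer d1 d2 (T1 : measurableType d1) (T2 : measurableType d2) (R : realType)
    (m1 : {measure set T1 -> \bar R}) (m2 : {measure set T2 -> \bar R}) (phi : T1 -> T2) :
  (forall f : T2 -> \bar R, measurable_fun setT f -> (forall x, 0 <= f x)%E ->
    (\int[m2]_x f x = \int[m1]_x f (phi x))%E) ->
  forall g : T2 -> \bar R, measurable_fun setT g ->
  (\int[m2]_x g x = \int[m1]_x g (phi x))%E.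
Proof.
move=> E g mg; rewrite -[RHS]/(\int[m1]_x (g \o phi) x)%E [LHS]integralE [RHS]integralE.
rewrite (funepos_comp g phi) (funeneg_comp g phi).
rewrite (E _ (measurable_funepos mg) (funepos_ge0 g)).
by rewrite (E _ (measurable_funeneg mg) (funeneg_ge0 g)).
Qed.

(** * Gaussian densities *)

Section gaussian.
Variable R : realType.
Implicit Types n : nat.
Local Notation mu := (@lebesgue_measure R).
Local Notation gauss n := (@gaussian_pdf R n 1%:M).

Lemma continuous_quadratic n (W : 'M[R]_n) : continuous (fun x : 'cV[R]_n => (x^T *m W *m x) 0 0).
Proof.
have -> : (fun x : 'cV[R]_n => (x^T *m W *m x) 0 0) =
          (fun x => \sum_i (\sum_j x j 0 * W j i) * x i 0).
  apply/funext => x; rewrite mxE; apply: eq_bigr => i _; rewrite mxE.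
  by congr (_ * _); apply: eq_bigr => j _; rewrite mxE.
apply: cts_sum => i; apply: ctsM; last exact: coord_continuous.
apply: cts_sum => j; apply: ctsM; last exact: cts_cst.
exact: coord_continuous.
Qed.

Lemma continuous_gaussian_pdf n (P : 'M[R]_n) : continuous (gaussian_pdf P).
Proof.
apply: ctsM; first exact: cts_cst.
apply: cts_comp; first exact: continuous_expR.
apply: ctsM; last exact: cts_cst.
by apply: ctsN; exact: continuous_quadratic.
Qed.

Lemma measurable_gaussian_pdf n (P : 'M[R]_n) : measurable_fun setT (gaussian_pdf P).
Proof. by apply: continuous_measurable_mx; exact: continuous_gaussian_pdf. Qed.

Lemma gaussian_pdf_ge0 n (P : 'M[R]_n) x : 0 <= gaussian_pdf P x.
Proof. by rewrite mulr_ge0 ?expR_ge0// invr_ge0 sqrtr_ge0. Qed.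

Lemma gauss_cons n (x : R) (y : 'cV[R]_n) :
  gauss n.+1 (cons_cV (x, y)) = normal_pdf 0 1 x * gauss n y.
Proof.
rewrite normal_pdfE ?oner_neq0// /gaussian_pdf /normal_peak /normal_fun !invmx1 !mulmx1 !det1 !mulr1.
rewrite exprS sqrtrM ?mulr_ge0 ?pi_ge0// invfM -!mulrA; congr (_ * _).
  by rewrite !mul1r mulr_natl.
rewrite [RHS]mulrCA; congr (_ * _); rewrite -expRD; congr expR.
rewrite /cons_cV/= (@tr_col_mx _ 1 n 1) (@mul_row_col _ 1 1 n 1) tr_scalar_mx -scalar_mxM !mxE eqxx mulr1n.
by rewrite subr0 expr1n; field.
Qed.

Lemma integral_gauss n : (\int[leb n]_x (gauss n x)%:E = 1)%E.
Proof.
elim: n => [|n IH].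
  rewrite [LHS]integral_dirac//; last first.
    by apply/measurable_EFinP; exact: measurable_gaussian_pdf.
  rewrite diracE in_setT mul1e /gaussian_pdf expr0 det1 mulr1 sqrtr1 invr1 mul1r.
  by rewrite mulmx0 mxE oppr0 mul0r expR0.
rewrite integral_lebS; last 2 first.
- by apply/measurable_EFinP; exact: measurable_gaussian_pdf.
- by move=> x; rewrite lee_fin gaussian_pdf_ge0.
rewrite -[RHS](integral_normal_pdf (0 : R) 1); apply: eq_integral => x _.
under eq_integral do rewrite gauss_cons EFinM.
rewrite ge0_integralZl// ?IH ?mule1//.
- by apply/measurable_EFinP; exact: measurable_gaussian_pdf.
- by move=> y _; rewrite lee_fin gaussian_pdf_ge0.
- by rewrite lee_fin normal_pdf_ge0.
Qed.

(** The Jacobian from [chvar_unit] cancels the square root of [\det (K *m K^T)] in the normalizing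
    constant. *)
Lemma gaussian_pdf_mul n (K : 'M[R]_n) z : K \in unitmx ->
  gaussian_pdf (K *m K^T) (K *m z) * `|\det K| = gauss n z.
Proof.
move=> Ku; rewrite /gaussian_pdf invmx1 mulmx1 det1 mulr1 det_mulmx det_tr -expr2.
rewrite sqrtrM ?exprn_ge0 ?mulr_ge0 ?pi_ge0// sqrtr_sqr invfM.
have -> : (K *m z)^T *m invmx (K *m K^T) *m (K *m z) = z^T *m z.
  have KKu : K *m K^T \in unitmx by rewrite unitmx_mul Ku unitmx_tr.
  have -> : invmx (K *m K^T) = invmx K^T *m invmx K.
    by rewrite -[RHS](mulmxK KKu) !mulmxA mulmxKV// mulVmx ?unitmx_tr// mul1mx.
  by rewrite trmx_mul !mulmxA mulmxK ?unitmx_tr// mulmxKV.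
have dK : `|\det K| != 0 by rewrite normr_eq0 -unitfE -unitmxE.
by field; rewrite dK sqrtr_eq0 -ltNge exprn_gt0// mulr_gt0// pi_gt0.
Qed.

Lemma integral_gaussian_pdf n (K : 'M[R]_n) (f : 'cV[R]_n -> \bar R) : K \in unitmx ->
  measurable_fun setT f -> (forall x, 0 <= f x)%E ->
  (\int[leb n]_x (f x * (gaussian_pdf (K *m K^T) x)%:E) =
   \int[leb n]_z (f (K *m z) * (gauss n z)%:E))%E.
Proof.
move=> Ku mf f0; have mg := measurable_gaussian_pdf.
rewrite (chvar_unit Ku); last 2 first.
- by apply: emeasurable_funM => //; apply/measurable_EFinP; exact: mg.
- by move=> x; rewrite mule_ge0// lee_fin gaussian_pdf_ge0.
have mfK : measurable_fun setT (fun x => f (K *m x)).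
  by apply: (measurableT_comp mf); exact: measurable_mulmxl.
rewrite -ge0_integralZl//.
- apply: eq_integral => z _; rewrite -(gaussian_pdf_mul z Ku) muleCA; congr (_ * _)%E.
  by rewrite -EFinM mulrC.
- apply: emeasurable_funM => //; apply/measurable_EFinP.
  by apply: (measurableT_comp (mg _ _)); exact: measurable_mulmxl.
- by move=> x _; rewrite mule_ge0// lee_fin gaussian_pdf_ge0.
Qed.

Lemma is_density_gaussian n (K : 'M[R]_n) : K \in unitmx -> is_density (gaussian_pdf (K *m K^T)).
Proof.
move=> Ku; split; [exact: measurable_gaussian_pdf|exact: gaussian_pdf_ge0|].
transitivity (\int[leb n]_x (cst 1%E x * (gaussian_pdf (K *m K^T) x)%:E))%E.
  by apply: eq_integral => x _; rewrite mul1e.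
rewrite integral_gaussian_pdf// -[RHS](integral_gauss n).
by apply: eq_integral => x _; rewrite mul1e.
Qed.

(** The standard Gaussian measure. Every Gaussian density below is handled as its image under a
    linear map, so that the time dependence sits in the integrand and not in the measure. *)
Definition gamma n := dens (leb n) (@measurable_gaussian_pdf n 1%:M) (@gaussian_pdf_ge0 n 1%:M).
Arguments gamma n : clear implicits.
HB.instance Definition _ n := Measure.on (gamma n).

Lemma gammaT n : gamma n setT = 1%E.
Proof. exact: integral_gauss. Qed.

HB.instance Definition _ n := Measure_isProbability.Build _ _ _ (gamma n) (gammaT n).

Lemma expect_gaussian n (K : 'M[R]_n) (g : 'cV[R]_n -> R) : K \in unitmx ->
  measurable_fun setT g ->
  expect (gaussian_pdf (K *m K^T)) g = (\int[gamma n]_z (g (K *m z))%:E)%E.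
Proof.
move=> Ku mg.
have mgK : measurable_fun setT (fun x => g (K *m x)).
  by apply: (measurableT_comp mg); exact: measurable_mulmxl.
have mgE : measurable_fun setT (EFin \o g) by exact/measurable_EFinP.
have mgKE : measurable_fun setT (EFin \o (fun x => g (K *m x))) by exact/measurable_EFinP.
rewrite /expect.
rewrite -[LHS](integral_dens (leb n) (measurable_gaussian_pdf (K *m K^T)) (@gaussian_pdf_ge0 n (K *m K^T)) mg).
have E (f : 'cV[R]_n -> \bar R) : measurable_fun setT f -> (forall x, 0 <= f x)%E ->
    (\int[dens (leb n) (measurable_gaussian_pdf (K *m K^T)) (@gaussian_pdf_ge0 n (K *m K^T))]_x f x =
     \int[gamma n]_z f (K *m z))%E.
  move=> mf f0; transitivity (\int[leb n]_x (f x * (gaussian_pdf (K *m K^T) x)%:E))%E.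
    exact: ge0_integral_dens.
  rewrite integral_gaussian_pdf//; apply/esym.
  apply: (ge0_integral_dens (leb n) (measurable_gaussian_pdf 1%:M) (@gaussian_pdf_ge0 n 1%:M) (f := fun z => f (K *m z))).
    by apply: (measurableT_comp mf); exact: measurable_mulmxl.
  by move=> x; exact: f0.
exact: (integral_transfer E).
Qed.

(** A primitive for the variance: the normal density satisfies [phi' = - x phi]. *)
Lemma is_derive_normal_pdf (x : R) : is_derive x 1 (fun y : R => - y * normal_pdf 0 1 y)
  (x ^+ 2 * normal_pdf 0 1 x - normal_pdf 0 1 x).
Proof.
rewrite normal_pdfE ?oner_neq0// /normal_fun.
set c := normal_peak 1.
have d1 : is_derive x 1 (fun y : R => - (y - 0) ^+ 2 / (1 ^+ 2 *+ 2)) (- x).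
  by apply: is_derive_eq; rewrite /GRing.scale /= expr1n; field.
have d2 : is_derive x 1 (fun y : R => expR (- (y - 0) ^+ 2 / (1 ^+ 2 *+ 2)))
    (- x * expR (- (x - 0) ^+ 2 / (1 ^+ 2 *+ 2))).
  by apply: is_derive_eq; rewrite /GRing.scale /= mulrC.
by apply: is_derive_eq; rewrite /GRing.scale /=; ring.
Qed.

Lemma normal_second_moment_itv (N : R) : 0 < N ->
  (\int[mu]_(x in `[(- N)%R, N]) (x ^+ 2 * normal_pdf 0 1 x)%:E =
   \int[mu]_(x in `[(- N)%R, N]) (normal_pdf 0 1 x)%:E - (2 * N * normal_pdf 0 1 N)%R%:E)%E.
Proof.
move=> N0; have NN : - N < N by rewrite gtrN.
have cn : continuous (@normal_pdf R 0 1) by apply: continuous_normal_pdf; exact: oner_neq0.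
have csq : continuous (fun x : R => x ^+ 2) by exact: exprn_continuous.
pose f (x : R) := x ^+ 2 * normal_pdf 0 1 x - normal_pdf 0 1 x.
have cf : continuous f by apply: ctsB => //; exact: ctsM.
have dF (x : R) : derivable (fun y : R => - y * normal_pdf 0 1 y) x 1 by have [] := is_derive_normal_pdf x.
have FTC := @continuous_FTC2 R f (fun y : R => - y * normal_pdf 0 1 y) (- N) N NN.
have : (\int[mu]_(x in `[(- N)%R, N]) (f x)%:E = (- N * normal_pdf 0 1 N)%:E - (- - N * normal_pdf 0 1 (- N))%:E)%E.
  apply: FTC.
  - by apply: continuous_subspaceT.
  - have cF : continuous (fun y : R => - y * normal_pdf 0 1 y).
      by apply: ctsM => //; apply: ctsN => x; exact: cvg_id.
    split=> //.
    + by apply: cvg_at_right_filter; exact: cF.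
    + by apply: cvg_at_left_filter; exact: cF.
  - by move=> x _; rewrite derive1E; have [_ ->] := is_derive_normal_pdf x.
have int (g : R -> R) : continuous g -> mu.-integrable `[(- N), N] (EFin \o g).
  move=> cg; apply: continuous_compact_integrable; first exact: segment_compact.
  by apply: continuous_subspaceT.
rewrite /f; under eq_integral do rewrite EFinB.
rewrite integralB//; last 2 first.
- by apply: (int (fun x => x ^+ 2 * normal_pdf 0 1 x)); exact: ctsM.
- exact: int.
have fin : (\int[mu]_(x in `[(- N)%R, N]) (normal_pdf 0 1 x)%:E)%E \is a fin_num.
  by apply: integrable_fin_num (int _ cn); exact: measurable_itv.
move: fin; case E1 : (\int[mu]_(x in `[(- N)%R, N]) (normal_pdf 0 1 x)%:E)%E => [r| |]// _.
have : normal_pdf 0 1 (- N) = normal_pdf 0 1 N :> R.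
  by rewrite normal_pdfE ?oner_neq0// /normal_fun !subr0 sqrrN.
move=> ->; move: (\int[mu]_(x in _) _)%E => [s| |]//=; rewrite -?EFinB => -[] E2.
by congr EFin; move: E2 => /eqP; rewrite subr_eq => /eqP ->; ring.
Qed.

(** Integration by parts on [[-N, N]] leaves the mass of the interval minus a boundary term
    [2 N phi(N)], which tends to [0]. *)
Lemma normal_second_moment : (\int[mu]_x (x ^+ 2 * normal_pdf 0 1 x)%:E = 1)%E.
Proof.
have S (f : R -> R) : measurable_fun setT f -> (forall x, 0 <= f x) ->
   ((\int[mu]_(x in `[(- (n.+1%:R))%R, n.+1%:R%R]) (f x)%:E) @[n --> \oo] --> \int[mu]_x (f x)%:E)%E.
  move=> mf f0.
  have -> : [set: R] = \bigcup_(n : nat) `[- (n.+1%:R : R), n.+1%:R]%classic.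
    apply/esym/seteqP; split=> // x _; exists (Num.truncn `|x|) => //=.
    rewrite in_itv/= -ler_norml ltW//; exact: truncnS_gt.
  apply: ge0_nondecreasing_set_cvg_integral => //.
  - apply/nondecreasing_seqP => n; apply/subsetPset => x /=; rewrite !in_itv/= => /andP[a b].
    have : n.+1%:R <= n.+2%:R :> R by rewrite ler_nat.
    by move=> h; rewrite (le_trans _ a) ?lerN2// (le_trans b).
  - by move=> i; apply/measurable_EFinP; exact: measurable_funTS.
  - by move=> i x _; rewrite lee_fin.
have mn : measurable_fun setT (@normal_pdf R 0 1) by exact: measurable_normal_pdf.
have mx : measurable_fun setT (fun x : R => x ^+ 2 * normal_pdf 0 1 x).
  by apply: measurable_funM => //; exact: measurable_funX.
have c1 := S _ mx (fun x => mulr_ge0 (sqr_ge0 x) (normal_pdf_ge0 0 1 x)).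
have c2 := S _ mn (normal_pdf_ge0 0 1).
rewrite integral_normal_pdf in c2.
have c3 : (fun n : nat => (2 * n.+1%:R * @normal_pdf R 0 1 n.+1%:R)%:E) @ \oo --> 0%E.
  apply: cvg_EFin; first by near=> n.
  apply: (@squeeze_cvgr _ _ _ _ (cst 0) (fun n : nat => 4 * normal_peak 1 * n.+1%:R^-1)); last 2 first.
  - exact: cvg_cst.
  - rewrite -[X in _ --> X](mulr0 (4 * normal_peak 1)); apply: cvgMl_tmp; exact: cvg_harmonic.
  near=> n; rewrite mulr_ge0 ?normal_pdf_ge0//= normal_pdfE ?oner_neq0// /normal_fun subr0.
  set N := n.+1%:R; have N0 : 0 < N :> R by rewrite ltr0n.
  (* From [1 + y <= expR y] at [y = N ^+ 2 / 2]. It makes the boundary term at most a constant over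
     [N], with constant [2 * 2] times the peak. *)
  have e1 : expR (- N ^+ 2 / (1 ^+ 2 *+ 2)) <= 2 / N ^+ 2.
    have := expR_ge1Dx (N ^+ 2 / 2); rewrite expr1n mulNr expRN => h.
    rewrite -[leRHS]invf_div lef_pV2 ?posrE ?expR_gt0 ?divr_gt0 ?exprn_gt0//.
    by rewrite (le_trans _ h)// lerDr.
  have c0 : 0 <= normal_peak (1 : R) by exact: normal_peak_ge0.
  apply: (@le_trans _ _ (2 * N * (normal_peak 1 * (2 / N ^+ 2)))).
    by rewrite ler_pM2l ?mulr_gt0// ler_wpM2l.
  by rewrite le_eqVlt; apply/orP; left; apply/eqP; field; rewrite gt_eqF.
apply: (cvg_unique _ c1) => //.
have := cvgeB _ c2 c3; rewrite sube0 => /(_ _ isT); apply: cvg_trans.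
by apply: near_eq_cvg; near=> n; rewrite normal_second_moment_itv.
Unshelve. all: by end_near.
Qed.

Lemma gamma_sqr0 n : (\int[gamma n.+1]_z (z 0 0 ^+ 2)%:E = 1)%E.
Proof.
have m0 : measurable_fun setT (fun z : 'cV[R]_n.+1 => z 0 0 ^+ 2).
  by apply: measurable_funX; exact: measurable_coord.
rewrite integral_dens// integral_lebS; last 2 first.
- by apply/measurable_EFinP; apply: measurable_funM => //; exact: measurable_gaussian_pdf.
- by move=> x; rewrite lee_fin mulr_ge0 ?sqr_ge0// gaussian_pdf_ge0.
rewrite -[RHS]normal_second_moment; apply: eq_integral => x _.
under eq_integral do rewrite gauss_cons cons_cV0 mulrA EFinM.
rewrite ge0_integralZl// ?integral_gauss ?mule1//.
- by apply/measurable_EFinP; exact: measurable_gaussian_pdf.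
- by move=> y _; rewrite lee_fin gaussian_pdf_ge0.
- by rewrite lee_fin mulr_ge0 ?sqr_ge0// normal_pdf_ge0.
Qed.

(** The Gaussian density of covariance [Q *m Q^T = 1%:M] is the standard one, so [expect_gaussian]
    with [K = Q] is the invariance under [Q]. *)
Lemma gamma_orthogonal n (Q : 'M[R]_n) (g : 'cV[R]_n -> R) : Q *m Q^T = 1%:M ->
  measurable_fun setT g ->
  (\int[gamma n]_z (g z)%:E = \int[gamma n]_z (g (Q *m z))%:E)%E.
Proof.
move=> QQ mg; have [Qu _] := mulmx1_unit QQ.
by rewrite -expect_gaussian// QQ /expect integral_dens.
Qed.

(** A transposition matrix is orthogonal, so every coordinate has the variance of the first. *)
Lemma gamma_sqr n (i : 'I_n) : (\int[gamma n]_z (z i 0 ^+ 2)%:E = 1)%E.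
Proof.
case: n i => [[]//|n i].
rewrite (@gamma_orthogonal _ (tperm_mx 0 i)); last 2 first.
- by rewrite tr_perm_mx tpermV -perm_mxM tperm2 perm_mx1.
- by apply: measurable_funX; exact: measurable_coord.
rewrite -[RHS](gamma_sqr0 n); apply: eq_integral => z _.
by rewrite -row_permE mxE tpermR.
Qed.

Lemma integrable_gamma_sqr n (i : 'I_n) : (gamma n).-integrable setT (fun z => (z i 0 ^+ 2)%:E).
Proof.
apply/integrableP; split.
  by apply/measurable_EFinP/measurable_funX; exact: measurable_coord.
under eq_integral do rewrite /= ger0_norm ?sqr_ge0//.
by rewrite gamma_sqr ltry.
Qed.

Lemma integrable_gamma_mul n (i j : 'I_n) :
  (gamma n).-integrable setT (fun z => (z i 0 * z j 0)%:E).
Proof.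
apply: (le_integrable measurableT _ _ (integrableD measurableT (integrable_gamma_sqr i) (integrable_gamma_sqr j))).
- by apply/measurable_EFinP/measurable_funM; exact: measurable_coord.
- move=> z _; rewrite -EFinD /= lee_fin [leRHS]ger0_norm ?addr_ge0 ?sqr_ge0// normrM.
  rewrite -[X in _ <= X + _]real_normK ?num_real// -[X in _ <= _ + X]real_normK ?num_real//.
  by have := sqr_ge0 (`|z i 0| - `|z j 0|); nra.
Qed.

(** For [i != j], flipping the sign of coordinate [i] preserves the measure and negates the
    integrand, so the finite integral equals its opposite. *)
Lemma gamma_mul n (i j : 'I_n) :
  (\int[gamma n]_z (z i 0 * z j 0)%:E = (i == j)%:R%:E)%E.
Proof.
have [->|ij] := eqVneq i j.
  by rewrite -[RHS](gamma_sqr j); apply: eq_integral => z _; rewrite expr2.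
pose D : 'M[R]_n := diag_mx (\row_k if k == i then -1 else 1).
have E : (\int[gamma n]_z (z i 0 * z j 0)%:E = - \int[gamma n]_z (z i 0 * z j 0)%:E)%E.
  rewrite {1}(@gamma_orthogonal _ D); last 2 first.
  - rewrite tr_diag_mx mulmx_diag -[RHS]/(1%:M) -diag_const_mx; congr diag_mx.
    by apply/rowP => k; rewrite !mxE; case: ifP => _; rewrite ?mulrNN mulr1.
  - by apply: measurable_funM; exact: measurable_coord.
  rewrite -integralN; last exact: integrable_add_def (integrable_gamma_mul i j).
  apply: eq_integral => z _; rewrite !mul_diag_mx !mxE eqxx (eq_sym j) (negbTE ij).
  by rewrite -EFinN; congr EFin; ring.
have := integrable_fin_num measurableT (integrable_gamma_mul i j).
move: E; case: integral => // r [] /eqP.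
by rewrite -addr_eq0 -mulr2n mulrn_eq0/= => /eqP ->.
Qed.

End gaussian.
Arguments gamma {R} n.

(** * Absolutely continuous functions on the unit interval *)

Section absolutely_continuous.
Variable R : realType.
Local Notation mu := (@lebesgue_measure R).
Implicit Types (g h x y c : R -> R) (s t u : R).

Definition int01 g := mu.-integrable `[0, 1] (EFin \o g).

Lemma measurable01 : measurable (`[0, 1]%classic : set (measurableTypeR R)).
Proof. exact: measurable_itv. Qed.

Definition acint g s t : R := \int[mu]_(u in `[s, t]) g u.

Lemma int01S g s t : 0 <= s -> t <= 1 -> int01 g -> mu.-integrable `[s, t] (EFin \o g).
Proof.
move=> s0 t1 ig; apply: integrableS ig => //; apply: subset_itvScc => //.
Qed.

Lemma acint_chasles g s t u : int01 g -> 0 <= s -> s <= t -> t <= u -> u <= 1 ->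
  acint g s t + acint g t u = acint g s u.
Proof.
move=> ig s0 st tu u1; rewrite /acint.
have su : mu.-integrable `[s, u] (EFin \o g) by exact: int01S.
have := @Rintegral_itvB R g (BLeft s) (BRight u) t su.
rewrite !bnd_simp => /(_ st tu)/eqP; rewrite subr_eq addrC => /eqP ->.
congr (_ + _); apply/esym; apply: Rintegral_itv_obnd_cbnd.
by apply: integrableS su => //; apply: subset_itv; rewrite bnd_simp.
Qed.

Lemma acint_ge0 g s t : (forall u, 0 <= g u) -> 0 <= acint g s t.
Proof. by move=> g0; apply: Rintegral_ge0 => u _. Qed.

Lemma acintxx g s : acint g s s = 0.
Proof. by rewrite /acint set_itv1 Rintegral_set1. Qed.

Lemma int01_norm g : int01 g -> int01 (fun u => `|g u|).
Proof. by move=> ig; apply: (integrable_norm ig). Qed.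

Lemma int01D g h : int01 g -> int01 h -> int01 (fun u => g u + h u).
Proof.
move=> ig ih; have := integrableD measurable01 ig ih.
by apply: eq_integrable => // u _; rewrite /= EFinD.
Qed.

Lemma int01Z (k : R) g : int01 g -> int01 (fun u => k * g u).
Proof.
move=> ig; have := @integrableZl _ _ _ mu _ measurable01 k _ ig.
by apply: eq_integrable => // u _; rewrite /= EFinM.
Qed.

Lemma acintD g h s t : 0 <= s -> t <= 1 -> int01 g -> int01 h ->
  acint (fun u => g u + h u) s t = acint g s t + acint h s t.
Proof. by move=> s0 t1 ig ih; rewrite /acint RintegralD//; exact: int01S. Qed.

Lemma acintZ (k : R) g s t : 0 <= s -> t <= 1 -> int01 g ->
  acint (fun u => k * g u) s t = k * acint g s t.
Proof. by move=> s0 t1 ig; rewrite /acint RintegralZl//; exact: int01S. Qed.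

Lemma le_norm_acint g s t : 0 <= s -> t <= 1 -> int01 g ->
  `|acint g s t| <= acint (fun u => `|g u|) s t.
Proof. by move=> s0 t1 ig; apply: le_normr_Rintegral => //; exact: int01S. Qed.

Lemma le_acint g h s t : 0 <= s -> t <= 1 -> int01 g -> int01 h ->
  (forall u, s <= u <= t -> g u <= h u) -> acint g s t <= acint h s t.
Proof.
move=> s0 t1 ig ih gh; apply: le_Rintegral; [exact: measurable_itv|exact: int01S|exact: int01S|].
by move=> u /=; rewrite in_itv/=; exact: gh.
Qed.

Lemma eq_acint g h s t : (forall u, s <= u <= t -> g u = h u) -> acint g s t = acint h s t.
Proof. by move=> gh; apply: eq_Rintegral => u; rewrite inE/= in_itv/=; exact: gh. Qed.

Lemma eq_int01 g h : (forall u, 0 <= u <= 1 -> g u = h u) -> int01 g -> int01 h.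
Proof.
by move=> gh; apply: eq_integrable => // u; rewrite inE/= in_itv/= => /gh ->.
Qed.

Definition cts01 c := {within `[0, 1], continuous c}.

Lemma cts01P c : cts01 c <->
  forall t : R, 0 <= t <= 1 -> c u @[u --> within `[0, 1]%classic (nbhs t)] --> c t.
Proof.
split=> [/subspace_continuousP cc t t01|cc].
  by apply: cc; rewrite /= in_itv.
by apply/subspace_continuousP => t; rewrite /= in_itv/=; exact: cc.
Qed.

Lemma cts01_unif c : cts01 c -> forall e : R, 0 < e -> exists2 d : R, 0 < d &
  forall s t : R, 0 <= s <= 1 -> 0 <= t <= 1 -> `|s - t| < d -> `|c s - c t| < e.
Proof.
move=> cc e e0.
have /compact_near_coveringP K := @segment_compact R 0 1.
pose P (d s : R) := 0 <= s <= 1 -> forall t, 0 <= t <= 1 -> `|s - t| < d -> `|c s - c t| < e.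
have H : \forall d \near (0:R)^'+, `[0, 1]%classic `<=` P d.
  apply: K => x; rewrite /= in_itv/= => x01.
  have cx := (cts01P c).1 cc x x01.
  have e20 : 0 < e / 2 by rewrite divr_gt0.
  have /cvgrPdist_lt/(_ _ e20) := cx; rewrite near_withinE => /nbhs_ballP[r /= r0 hr].
  have hrc : forall y : R, 0 <= y <= 1 -> `|x - y| < r -> `|c x - c y| < e / 2.
    by move=> y y01 xy; apply: hr => //=; rewrite in_itv.
  (* Halving the radius: two points at distance less than [r / 2], one of which lies within [r / 2]
     of [x], are both in the ball of radius [r] where the estimate at [x] holds. *)
  have r20 : 0 < r / 2 by rewrite divr_gt0.
  exists (ball x (r / 2), [set d | d < r / 2]).
    split => /=; first exact: nbhsx_ballx.
    exact: nbhs_right_lt.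
  move=> [s d] [/= xs dr] s01 t t01 st.
  have xs2 : `|x - s| < r / 2 by exact: xs.
  have h1 : `|c x - c s| < e / 2 by apply: hrc => //; apply: (lt_trans xs2); lra.
  have h2 : `|c x - c t| < e / 2.
    apply: hrc => //; have -> : x - t = (x - s) + (s - t) by ring.
    by apply: (le_lt_trans (ler_normD _ _)); lra.
  have -> : c s - c t = - (c x - c s) + (c x - c t) by ring.
  by apply: (le_lt_trans (ler_normD _ _)); rewrite normrN; lra.
near (0:R)^'+ => d; exists d => // s t s01 t01.
have : `[0, 1]%classic `<=` P d by near: d.
by move=> /(_ s); apply; rewrite ?in_itv.
Unshelve. all: by end_near.
Qed.

Lemma cts01_bounded c : cts01 c -> exists2 M, 0 < M & forall u, 0 <= u <= 1 -> `|c u| <= M.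
Proof.
move=> cc; have cK : compact (c @` `[0, 1]).
  by apply: continuous_compact => //; exact: segment_compact.
have [M [_ hM]] := compact_bounded cK.
exists (`|M| + 1); first by rewrite ltr_wpDl.
move=> u u01; apply: (hM (`|M| + 1)); first by rewrite (le_lt_trans (ler_norm _))// ltrDl.
by exists u => //=; rewrite in_itv.
Qed.

Lemma int01M c g : cts01 c -> int01 g -> int01 (fun u => c u * g u).
Proof.
move=> cc ig; apply: (integrableMr measurable01 _ _ ig).
  exact: subspace_continuous_measurable_fun.
have [M M0 hM] := cts01_bounded cc.
exists M; split; first by rewrite realE ltW.
by move=> r Mr u /=; rewrite in_itv/= => u01; rewrite (le_trans (hM u u01))// ltW.
Qed.

(** Absolute continuity on [[0, 1]] together with its derivative, encoded by the fundamental theorem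
    of calculus; differentiability almost everywhere never enters. *)
Definition ac x g := int01 g /\
  forall s t, 0 <= s -> s <= t -> t <= 1 -> x t - x s = acint g s t.

Lemma ac_cts01 x g : ac x g -> cts01 x.
Proof.
move=> [ig xg].
have := @parameterized_integral_continuous R 0 1 g ler01 ig.
rewrite /cts01 => F; have G := within_continuousD (f := fun=> x 0) _ F.
have {G} : {within `[0, 1], continuous (fun t => x 0 + parameterized_integral mu 0 t g)}.
  by apply: G => t; exact: cvg_cst.
apply: subspace_eq_continuous => t; rewrite inE/= in_itv/= => /andP[t0 t1].
change (x 0 + acint g 0 t = x t); by rewrite -(xg 0 t)// addrC subrK.
Qed.

(** The short-range bound telescopes over a fine subdivision to [e] times the integral of [g] over
    the whole interval, and [e] is arbitrary. *)
Lemma small_increments_const h g : (forall u, 0 <= g u) -> int01 g ->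
  (forall e, 0 < e -> exists2 d, 0 < d & forall s t, 0 <= s -> s <= t -> t <= 1 ->
     t - s < d -> `|h t - h s| <= e * acint g s t) ->
  forall s t, 0 <= s -> s <= t -> t <= 1 -> h t = h s.
Proof.
move=> g0 ig hh s t s0 st t1.
apply/eqP; rewrite -subr_eq0 -normr_le0; apply/ler_addgt0Pl => e e0; rewrite addr0.
have Gst := acint_ge0 s t g0.
(* The added [1] keeps the divisor positive when [g] has no mass on the interval. *)
pose G := acint g s t + 1.
have G0 : 0 < G by rewrite ltr_wpDl.
have [d d0 hd] := hh (e / G) (divr_gt0 e0 G0).
pose N := (Num.truncn ((t - s) / d)).+1.
have N0 : 0 < N%:R :> R by rewrite ltr0n.
pose p (k : nat) := s + k%:R * ((t - s) / N%:R).
have pS k : p k.+1 = p k + (t - s) / N%:R by rewrite /p -natr1; ring.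
have step0 : 0 <= (t - s) / N%:R by rewrite divr_ge0 ?subr_ge0// ltW.
have pN : p N = t by rewrite /p; field; rewrite gt_eqF.
have ps k : s <= p k by rewrite lerDl mulr_ge0.
have pt k : (k <= N)%N -> p k <= t.
  move=> kN; rewrite -pN /p lerD2l ler_wpM2r// ler_nat//.
have stepd : (t - s) / N%:R < d.
  by rewrite ltr_pdivrMr// mulrC -ltr_pdivrMr//; exact: truncnS_gt.
have H k : (k <= N)%N -> `|h (p k) - h s| <= e / G * acint g s (p k).
  elim: k => [_|k IH kN].
    by rewrite /p mul0r addr0 subrr normr0 acintxx mulr0.
  have pk : p k <= p k.+1 by rewrite pS lerDl.
  have pk1 : p k.+1 <= 1 by rewrite (le_trans (pt _ kN)).
  have -> : h (p k.+1) - h s = (h (p k.+1) - h (p k)) + (h (p k) - h s) by ring.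
  rewrite -(@acint_chasles g s (p k) (p k.+1))// mulrDr addrC.
  apply: (le_trans (ler_normD _ _)); apply: lerD; first exact/IH/ltnW.
  apply: hd => //; first exact: le_trans (ps k).
  by rewrite pS addrC addKr.
have := H N (leqnn _); rewrite pN => /le_trans; apply.
by rewrite mulrAC ler_pdivrMr// ler_pM2l// lerDl.
Qed.

(** The common source of the product and chain rules: an increment formula with coefficients
    evaluated at intermediate times is enough, because continuous coefficients are uniformly
    continuous on [[0, 1]]. *)
Lemma ac_mean_value (f x y g h c1 c2 : R -> R) : ac x g -> ac y h -> cts01 c1 -> cts01 c2 ->
  (forall s t, 0 <= s -> s <= t -> t <= 1 -> exists u v, [/\ s <= u <= t, s <= v <= t &
     f t - f s = c1 u * (x t - x s) + c2 v * (y t - y s)]) ->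
  ac f (fun u => c1 u * g u + c2 u * h u).
Proof.
move=> [ig xg] [ih yh] cc1 cc2 mv.
have i1 := int01M cc1 ig; have i2 := int01M cc2 ih.
have i12 := int01D i1 i2; split => // s t s0 st t1.
(* On a short interval the coefficients vary by less than [e], so the increments of [F] are at most
   [e] times the integral of [|g| + |h|], and [F] is constant by [small_increments_const]. *)
pose F := fun u => f u - acint (fun w => c1 w * g w + c2 w * h w) 0 u.
suff /(_ s t s0 st t1) : forall s t, 0 <= s -> s <= t -> t <= 1 -> F t = F s.
  rewrite /F -(acint_chasles i12 (lexx 0) s0 st t1) => E.
  by apply/eqP; rewrite subr_eq; apply/eqP; move: E => /eqP; rewrite subr_eq => /eqP ->; ring.
move=> {s t s0 st t1}.
apply: (@small_increments_const _ (fun u => `|g u| + `|h u|)).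
- by move=> u; rewrite addr_ge0.
- by apply: int01D; exact: int01_norm.
move=> e e0.
have [d1 d10 h1] := cts01_unif cc1 e0; have [d2 d20 h2] := cts01_unif cc2 e0.
exists (Num.min d1 d2); first by rewrite lt_min d10.
move=> s t s0 st t1; rewrite lt_min => /andP[td1 td2].
have [u [v [su sv E]]] := mv s t s0 st t1.
have -> : F t - F s = acint (fun w => (c1 u * g w + c2 v * h w) - (c1 w * g w + c2 w * h w)) s t.
  rewrite /F -(acint_chasles i12 (lexx 0) s0 st t1).
  transitivity (f t - f s - acint (fun w => c1 w * g w + c2 w * h w) s t); first by ring.
  rewrite E xg// yh// -!acintZ// -acintD//; [|exact: int01Z|exact: int01Z].
  rewrite -mulN1r -acintZ// -acintD//; last 2 first.
  - by apply: int01D; exact: int01Z.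
  - exact: int01Z.
  by apply: eq_acint => w _; rewrite mulN1r.
have iZ : int01 (fun w => (c1 u * g w + c2 v * h w) - (c1 w * g w + c2 w * h w)).
  apply: int01D; first by apply: int01D; exact: int01Z.
  by apply: eq_int01 (int01Z (-1) i12) => w _; rewrite mulN1r.
apply: (le_trans (le_norm_acint s0 t1 iZ)).
rewrite -acintZ//; last by apply: int01D; exact: int01_norm.
apply: le_acint => //; first exact: int01_norm.
  by apply: int01Z; apply: int01D; exact: int01_norm.
move=> w /andP[sw wt].
have in01 r : s <= r <= t -> 0 <= r <= 1.
  by move=> /andP[sr rt]; rewrite (le_trans s0 sr) (le_trans rt t1).
have close r d : s <= r <= t -> t - s < d -> `|r - w| < d.
  move=> /andP[sr rt]; apply: le_lt_trans; rewrite ler_norml; apply/andP; split; lra.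
have -> : (c1 u * g w + c2 v * h w) - (c1 w * g w + c2 w * h w) =
   (c1 u - c1 w) * g w + (c2 v - c2 w) * h w by ring.
rewrite mulrDr; apply: (le_trans (ler_normD _ _)); rewrite !normrM; apply: lerD.
  apply: ler_wpM2r => //; apply/ltW/h1; rewrite ?in01 ?sw//; exact: close.
apply: ler_wpM2r => //; apply/ltW/h2; rewrite ?in01 ?sw//; exact: close.
Qed.

Lemma ac_cst (k : R) : ac (fun=> k) (fun=> 0).
Proof.
split; first exact: integrable0.
by move=> s t *; rewrite subrr /acint /Rintegral integral0_eq.
Qed.

Lemma cts01_cst (k : R) : cts01 (fun=> k).
Proof. by move=> t; exact: cvg_cst. Qed.

Lemma ac_ext x y g h : (forall u, 0 <= u <= 1 -> x u = y u) ->
  (forall u, 0 <= u <= 1 -> g u = h u) -> ac x g -> ac y h.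
Proof.
move=> xy gh [ig xg]; split; first exact: eq_int01 ig.
move=> s t s0 st t1; rewrite -!xy ?s0 ?t1 ?(le_trans s0) ?(le_trans st)// xg//.
by apply: eq_acint => u /andP[su ut]; apply: gh; rewrite (le_trans s0 su) (le_trans ut t1).
Qed.

Lemma acD x y g h : ac x g -> ac y h -> ac (fun t => x t + y t) (fun t => g t + h t).
Proof.
move=> [ig xg] [ih yh]; split; first exact: int01D.
by move=> s t s0 st t1; rewrite acintD// -xg// -yh//; ring.
Qed.

Lemma acZ (k : R) x g : ac x g -> ac (fun t => k * x t) (fun t => k * g t).
Proof.
move=> [ig xg]; split; first exact: int01Z.
by move=> s t s0 st t1; rewrite acintZ// -xg// mulrBr.
Qed.

(** The increment of the product is [y s * (x t - x s) + x t * (y t - y s)], so the intermediate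
    times are the end points. *)
Lemma acM x y g h : ac x g -> ac y h ->
  ac (fun t => x t * y t) (fun t => y t * g t + x t * h t).
Proof.
move=> xg yh; apply: ac_mean_value xg yh (ac_cts01 yh) (ac_cts01 xg) _.
move=> s t s0 st t1; exists s, t; rewrite lexx st lexx; split => //; ring.
Qed.

(** The mean value theorem for [f] gives an intermediate value between [x s] and [x t], and the
    intermediate value theorem turns it into an intermediate time. *)
Lemma ac_comp (f f' : R -> R) x g : ac x g -> (forall u, 0 <= u <= 1 -> 0 < x u) ->
  (forall r : R, 0 < r -> is_derive r 1 f (f' r)) ->
  (forall r : R, 0 < r -> {for r, continuous f'}) ->
  ac (fun t => f (x t)) (fun t => f' (x t) * g t).
Proof.
move=> xg x0 df cf'; have cx := ac_cts01 xg.
have cf'x : cts01 (fun t => f' (x t)).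
  apply/cts01P => t t01; have xt := (cts01P x).1 cx t t01.
  exact: (continuous_cvg _ (cf' _ (x0 _ t01)) xt).
suff : ac (fun t => f (x t)) (fun t => f' (x t) * g t + 0 * 0).
  by apply: ac_ext => // u _; rewrite mulr0 addr0.
refine (@ac_mean_value (fun t => f (x t)) x (fun=> 0) g (fun=> 0) (fun t => f' (x t)) (fun=> 0) xg (ac_cst 0) cf'x (@cts01_cst 0) _).
move=> s t s0 st t1.
have in01 r : s <= r <= t -> 0 <= r <= 1.
  by move=> /andP[sr rt]; rewrite (le_trans s0 sr) (le_trans rt t1).
have xs0 : 0 < x s by apply/x0/in01; rewrite lexx st.
have xt0 : 0 < x t by apply/x0/in01; rewrite lexx st.
have cst_ : {within `[s, t], continuous x}.
  apply: continuous_subspaceW cx => r /=; rewrite !in_itv/=; exact: in01.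
have [v [/andP[v1 v2] Ev]] : exists v, Num.min (x s) (x t) <= v <= Num.max (x s) (x t) /\
    f (x t) - f (x s) = f' v * (x t - x s).
  have mvt a b : 0 < a -> a < b -> exists v, a <= v <= b /\ f b - f a = f' v * (b - a).
    move=> a0 ab.
    have [r||v vab ->] := @MVT _ f f' _ _ ab.
    - by rewrite in_itv/= => /andP[ar _]; apply: df; exact: lt_trans ar.
    - apply: derivable_within_continuous => r; rewrite in_itv/= => /andP[ar _].
      by have [] := df r (lt_le_trans a0 ar).
    - by exists v; split=> //; move: vab; rewrite in_itv/= => /andP[/ltW -> /ltW ->].
  have [xst|xts|->] := ltgtP (x s) (x t).
  - have [v [vab E]] := mvt _ _ xs0 xst; by exists v.
  - have [v [vab E]] := mvt _ _ xt0 xts; exists v; rewrite vab -opprB E; split=> //; ring.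
  - exists (x t); rewrite lexx; split => //.
    by rewrite !subrr mulr0.
have [u ust Eu] := IVT st cst_ (introT andP (conj v1 v2)).
exists u, s; rewrite lexx st; move: ust; rewrite in_itv/= => ust; split => //.
by rewrite Eu Ev mul0r addr0.
Qed.

Lemma ac_ln x g : ac x g -> (forall u, 0 <= u <= 1 -> 0 < x u) ->
  ac (fun t => ln (x t)) (fun t => (x t)^-1 * g t).
Proof.
move=> xg x0; apply: (@ac_comp (@ln R) (fun r => r^-1)) => //.
by move=> r r0; apply: inv_continuous; rewrite gt_eqF.
Qed.

Lemma acV x g : ac x g -> (forall u, 0 <= u <= 1 -> 0 < x u) ->
  ac (fun t => (x t)^-1) (fun t => - (x t) ^- 2 * g t).
Proof.
move=> xg x0; apply: (@ac_comp (fun r => r^-1) (fun r => - r ^- 2)) => //.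
- move=> r r0; have rn : r != 0 by rewrite gt_eqF.
  apply: is_derive_eq; first exact: is_deriveV.
  by rewrite /GRing.scale/= mulr1.
- move=> r r0; apply: cvgN; apply: cvgV; first by rewrite expf_neq0// gt_eqF.
  exact: exprn_continuous.
Qed.

End absolutely_continuous.

(** * Normalization of a path of covariances *)

Section calibration.
Variable R : realType.
Local Notation ac := (@ac R).
Local Notation int01 := (@int01 R).
Local Notation acint := (@acint R).

Definition schur k (P : 'M[R]_(1 + k)) : 'M[R]_k :=
  drsubmx P - (P 0 0)^-1 *: (dlsubmx P *m ursubmx P).

(* If P and B are the moments E[yy'] and E[yw'] of two vectors y, w, this is the
   moment E[y2 w2'] of their residuals y2, w2 after regression on the
   first coordinate of y. *)
Definition schur_mixed k (P B : 'M[R]_(1 + k)) : 'M[R]_k :=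
  drsubmx B - (P 0 0)^-1 *: (dlsubmx P *m ursubmx B) - (P 0 0)^-1 *: (dlsubmx B *m ursubmx P)
  + ((P 0 0)^-1 ^+ 2 * B 0 0) *: (dlsubmx P *m ursubmx P).

Lemma block_mx_dec k (P : 'M[R]_(1 + k)) :
  P = block_mx (P 0 0)%:M (ursubmx P) (dlsubmx P) (drsubmx P).
Proof.
rewrite -{1}[P]submxK; congr block_mx; rewrite [LHS]scalar_mx11; congr _%:M.
by rewrite !mxE; congr (fun_of_matrix P _ _); exact/val_inj.
Qed.

Lemma sym_block k (P : 'M[R]_(1 + k)) : P^T = P -> ursubmx P = (dlsubmx P)^T.
Proof. by move=> sP; rewrite trmx_dlsub sP. Qed.

Lemma posdefmx00 k (P : 'M[R]_(1 + k)) : posdefmx P -> 0 < P 0 0.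
Proof.
move=> [_ /(_ (delta_mx 0 0))]; rewrite trmx_delta -rowE -colE !mxE; apply.
by apply/eqP => /matrixP/(_ 0 0); rewrite !mxE !eqxx => /eqP; rewrite oner_eq0.
Qed.

(** One Gaussian elimination step: multiplying on the left clears the first column below the
    pivot. *)
Definition elim_mx k (P : 'M[R]_(1 + k)) : 'M[R]_(1 + k) :=
  block_mx 1%:M 0 (- (P 0 0)^-1 *: dlsubmx P) 1%:M.

Lemma elim_mixed k (P B : 'M[R]_(1 + k)) : P^T = P ->
  elim_mx P *m B *m (elim_mx P)^T =
  block_mx (B 0 0)%:M (ursubmx B - ((P 0 0)^-1 * B 0 0) *: ursubmx P)
     (dlsubmx B - ((P 0 0)^-1 * B 0 0) *: dlsubmx P) (schur_mixed P B).
Proof.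
move=> sP; rewrite {1}[B]block_mx_dec /elim_mx tr_block_mx !trmx1 trmx0.
rewrite !mulmx_block !(mul1mx, mulmx1, mul0mx, mulmx0, addr0, add0r).
rewrite linearZ/= -sym_block// -!scalemxAl -!scalemxAr !mul_mx_scalar !mul_scalar_mx.
congr block_mx.
- by rewrite addrC scaleNr scalerA.
- by rewrite addrC scaleNr scalerA.
- rewrite /schur_mixed mulmxDl -!scalemxAl.
  move: (dlsubmx P *m ursubmx P) (dlsubmx B *m ursubmx P) (dlsubmx P *m ursubmx B) (drsubmx B).
  by move=> X Y Z D; apply/matrixP => i j; rewrite !mxE; ring.
Qed.

Lemma schur_mixed_self k (P : 'M[R]_(1 + k)) : P 0 0 != 0 -> schur_mixed P P = schur P.
Proof.
move=> a0; rewrite /schur_mixed /schur expr2 -mulrA mulVf// mulr1.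
move: (dlsubmx P *m ursubmx P) (drsubmx P) => X D.
by apply/matrixP => i j; rewrite !mxE; ring.
Qed.

Lemma elim_schur k (P : 'M[R]_(1 + k)) : posdefmx P ->
  elim_mx P *m P *m (elim_mx P)^T = block_mx (P 0 0)%:M 0 0 (schur P).
Proof.
move=> Pp; have a0 : P 0 0 != 0 by rewrite gt_eqF// posdefmx00.
rewrite elim_mixed//; last exact: posdefmx_sym.
by rewrite mulVf// !scale1r !subrr schur_mixed_self.
Qed.

Lemma elim_mx_unit k (P : 'M[R]_(1 + k)) : elim_mx P \in unitmx.
Proof. by rewrite unitmxE /elim_mx det_lblock !det1 mulr1 unitr1. Qed.

Lemma posdefmx_schur k (P : 'M[R]_(1 + k)) : posdefmx P -> posdefmx (schur P).
Proof.
move=> Pp; have := posdefmx_congr Pp (elim_mx_unit P); rewrite elim_schur// => -[sB pB].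
split.
  by move: sB; rewrite tr_block_mx => /eq_block_mx[_ _ _ ->].
move=> x x0; have := pB (col_mx 0 x); rewrite col_mx_eq0 eqxx/= => /(_ x0).
rewrite tr_col_mx trmx0 mul_row_block mul_row_col !(mul0mx, mulmx0, add0r).
by [].
Qed.

(** With [B] arbitrary the off-diagonal blocks do not vanish, but only the diagonal is used: it
    consists of the logarithmic derivative of the pivot, up to a factor [2], and of the same
    expression for the Schur complement. *)
Lemma schur_mixed_diag k (P B : 'M[R]_(1 + k)) (V : 'M[R]_k) : posdefmx P ->
  let W := (block_mx (Num.sqrt (P 0 0))^-1%:M 0 0 V : 'M[R]_(1 + k)) *m elim_mx P in
  W *m B *m W^T = block_mx ((P 0 0)^-1 * B 0 0)%:M
    ((Num.sqrt (P 0 0))^-1 *: (ursubmx B - ((P 0 0)^-1 * B 0 0) *: ursubmx P) *m V^T)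
    (((Num.sqrt (P 0 0))^-1 *: V) *m (dlsubmx B - ((P 0 0)^-1 * B 0 0) *: dlsubmx P))
    (V *m schur_mixed P B *m V^T).
Proof.
move=> Pp W; have P00 := posdefmx00 Pp.
rewrite /W trmx_mul !mulmxA -(mulmxA _ (elim_mx P)) -(mulmxA _ _ (elim_mx P)^T).
rewrite elim_mixed; last exact: posdefmx_sym.
rewrite tr_block_mx !trmx0 tr_scalar_mx !mulmx_block !(mul0mx, mulmx0, addr0, add0r).
rewrite -!scalar_mxM !mul_scalar_mx !mul_mx_scalar.
congr block_mx; last by rewrite -scalemxAl.
by rewrite mulrAC -invfM -expr2 sqr_sqrtr// ltW.
Qed.

(* V t is the inverse Cholesky factor of P t. The i-th diagonal entry of
   [2 V B V^T] is the derivative of the logarithm of the i-th pivot of P, and the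
   pivots of P 1 are the [expR (l 0 i)]. *)
Lemma calibration k (P B : R -> 'M[R]_k) (l : 'rV[R]_k) :
  (forall t, 0 <= t <= 1 -> posdefmx (P t)) ->
  (forall i j, ac (fun t => P t i j) (fun t => B t i j + B t j i)) ->
  P 0 = 1%:M -> P 1 = diag_mx (map_mx expR l) ->
  exists V : R -> 'M[R]_k,
  [/\ forall t, 0 <= t <= 1 -> V t *m P t *m (V t)^T = 1%:M,
      int01 (fun t => \sum_i l 0 i * (2 * (V t *m B t *m (V t)^T) i i)),
      acint (fun t => \sum_i l 0 i * (2 * (V t *m B t *m (V t)^T) i i)) 0 1 = \sum_i l 0 i ^+ 2
    & forall t (i j : 'I_k), 0 <= t <= 1 -> i = 0%N :> nat ->
        V t i j = (i == j)%:R / Num.sqrt (P t i i)].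
Proof.
elim: k P B l => [|k IH] P B l Pp acP P0 P1.
  exists (fun=> 0); split.
  - by move=> t _; apply/matrixP => -[].
  - by have := (@ac_cst R 0).1; apply: eq_int01 => t _; rewrite big_ord0.
  - rewrite (eq_acint (h := fun=> 0)) => [|t _]; last by rewrite big_ord0.
    by rewrite -((@ac_cst R 0).2 0 1)// subrr big_ord0.
  - by move=> t [].
pose P' (t : R) : 'M[R]_(1 + k) := P t.
pose P2 t := schur (P' t); pose B2 t := schur_mixed (P' t) (B t : 'M[R]_(1 + k)).
pose a t := P t 0 0.
have a0 t : 0 <= t <= 1 -> 0 < a t by move=> t01; exact: posdefmx00 (Pp t t01).
have acV := acV (acP 0 0) a0.
have [||||V [V1 V2 V3 V4]] := IH P2 B2 (rsubmx (l : 'rV[R]_(1 + k))).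
- by move=> t t01; exact: posdefmx_schur (Pp t t01).
(* The entries of the Schur complement are [P i j - P i 0 * P 0 j / P 0 0]; the product and inverse
   rules give a derivative that is [schur_mixed] plus its transpose. *)
- move=> i j.
  have ci := acP (rshift 1 i) (0 : 'I_k.+1); have cj := acP (0 : 'I_k.+1) (rshift 1 j).
  have cij := acP (rshift 1 i) (rshift 1 j).
  have H := acD cij (acZ (-1) (acM acV (acM ci cj))).
  apply: ac_ext H => t t01.
    rewrite /P2 /schur !mxE big_ord1 !mxE -/(a t).
    have l0 : lshift k 0 = 0 :> 'I_(1 + k) by exact/val_inj.
    by rewrite /P' !l0; ring.
  have a_neq0 : a t != 0 by rewrite gt_eqF// a0.
  have sP i1 j1 : P t i1 j1 = P t j1 i1 by rewrite -[in LHS](posdefmx_sym (Pp t t01)) mxE.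
  have l0 : lshift k 0 = 0 :> 'I_(1 + k) by exact/val_inj.
  rewrite /B2 /schur_mixed !mxE !big_ord1 !mxE /P' !l0 -/(a t).
  by rewrite !(sP 0); field.
- rewrite /P2 /P' /schur P0; apply/matrixP => i j; rewrite !mxE big_ord1 !mxE/=.
  by rewrite !mulr0 subr0; congr (_%:R); apply/eqP/eqP => [[]|->]; exact/val_inj.
- rewrite /P2 /P' /schur P1; apply/matrixP => i j; rewrite !mxE big_ord1 !mxE/=.
  rewrite !mulr0n mulr0 mulr0 subr0.
  by rewrite (inj_eq (@rshift_inj 1 k)).
pose W t := (block_mx (Num.sqrt (a t))^-1%:M 0 0 (V t) : 'M[R]_(1 + k)) *m elim_mx (P' t).
(* The first pivot goes from [1] to [expR (l 0 0)], so its logarithmic derivative integrates to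
   [l 0 0]. *)
have acl := ac_ln (acP 0 0) a0.
have sE t : 0 <= t <= 1 -> \sum_i l 0 i * (2 * (W t *m B t *m (W t)^T) i i) =
   l 0 0 * ((a t)^-1 * (B t 0 0 + B t 0 0)) +
   \sum_i (rsubmx (l : 'rV[R]_(1 + k))) 0 i * (2 * (V t *m B2 t *m (V t)^T) i i).
  move=> t01; rewrite (@schur_mixed_diag _ (P' t) (B t) (V t) (Pp t t01)).
  rewrite (@big_split_ord _ _ _ 1 k) big_ord1/=; congr (_ + _).
    by rewrite block_mxEul mxE eqxx mulr1n (_ : lshift k 0 = 0); [rewrite -/(a t); ring|exact/val_inj].
  by apply: eq_bigr => i _; rewrite (@block_mxEdr _ 1 k 1 k) [rsubmx _ _ _]mxE.
exists W; split.
- move=> t t01; rewrite (@schur_mixed_diag _ (P' t) (P t) (V t) (Pp t t01)).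
  have a_neq0 : P' t 0 0 != 0 by rewrite gt_eqF// a0.
  rewrite [X in X%:M](_ : _ = 1); last exact: mulVf.
  rewrite [X in _ - X *: _](_ : _ = 1); last exact: mulVf.
  rewrite [X in _ *m (_ - X *: _)](_ : _ = 1); last exact: mulVf.
  rewrite !scale1r !subrr scaler0 mul0mx mulmx0 schur_mixed_self// V1//.
  by rewrite -(@scalar_mx_block R 1 k).
- apply: (eq_int01 (g := fun t => l 0 0 * ((a t)^-1 * (B t 0 0 + B t 0 0)) +
     \sum_i (rsubmx (l : 'rV[R]_(1 + k))) 0 i * (2 * (V t *m B2 t *m (V t)^T) i i))).
    by move=> t t01; rewrite sE.
  by apply: int01D => //; apply: int01Z; case: acl.
- rewrite (eq_acint (h := fun t => l 0 0 * ((a t)^-1 * (B t 0 0 + B t 0 0)) +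
     \sum_i (rsubmx (l : 'rV[R]_(1 + k))) 0 i * (2 * (V t *m B2 t *m (V t)^T) i i))); last exact: sE.
  have [il al] := acl.
  rewrite acintD//; last exact: int01Z.
  rewrite acintZ// V3 -(al 0 1)// /a P0 P1 !mxE eqxx !mulr1n expRK ln1 subr0.
  rewrite (@big_split_ord _ _ _ 1 k) big_ord1/=; congr (_ + _).
    by rewrite (_ : lshift k 0 = 0) ?expr2//; exact/val_inj.
  by apply: eq_bigr => i _; rewrite mxE.
(* The elimination matrix has first row [(1, 0)], so only the scaling of the pivot appears in the
   first row of [W t]. *)
- move=> t i j t01 i0.
  have {i0} -> : i = lshift k 0 :> 'I_(1 + k) by exact/val_inj.
  rewrite /W /elim_mx mulmx_block !(mulmx1, mulmx0, mul0mx, addr0, add0r).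
  rewrite -[j](@splitK 1 k); case: (fintype.split (j : 'I_(1 + k))) => j'/=.
    rewrite (@block_mxEul _ 1 k 1 k) !ord1 mxE !eqxx mulr1n mul1r /a.
    by congr (Num.sqrt (fun_of_matrix (P t) _ _))^-1; exact/val_inj.
  by rewrite (@block_mxEur _ 1 k 1 k) mxE mul0r.
Qed.

Lemma perm_conjE k (s : 'S_k) (A : 'M[R]_k) i j :
  (perm_mx s *m A *m (perm_mx s)^T) i j = A (s i) (s j).
Proof.
by rewrite tr_perm_mx -row_permE -col_permE !mxE.
Qed.

(* Starting the elimination at i0 makes row i0 of V t a multiple of the i0-th
   unit vector, so that the equality case can be read coordinate by coordinate. *)
Lemma calibration_at k (i0 : 'I_k) (P B : R -> 'M[R]_k) (l : 'rV[R]_k) :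
  (forall t, 0 <= t <= 1 -> posdefmx (P t)) ->
  (forall i j, ac (fun t => P t i j) (fun t => B t i j + B t j i)) ->
  P 0 = 1%:M -> P 1 = diag_mx (map_mx expR l) ->
  exists V : R -> 'M[R]_k,
  [/\ forall t, 0 <= t <= 1 -> V t *m P t *m (V t)^T = 1%:M,
      int01 (fun t => \sum_i l 0 i * (2 * (V t *m B t *m (V t)^T) i i)),
      acint (fun t => \sum_i l 0 i * (2 * (V t *m B t *m (V t)^T) i i)) 0 1 = \sum_i l 0 i ^+ 2
    & forall t (j : 'I_k), 0 <= t <= 1 ->
        V t i0 j = (i0 == j)%:R / Num.sqrt (P t i0 i0)].
Proof.
case: k i0 P B l => [[]//|k] i0 P B l Pp acP P0 P1.
(* The calibration is applied to the paths conjugated by the transposition of [0] and [i0]; its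
   matrix [U] is symmetric and involutive, so conjugating back is the same operation. *)
pose s := tperm 0 i0; pose U : 'M[R]_k.+1 := perm_mx s.
have sE : (s^-1)%g = s by exact: tpermV.
have UT : U^T = U by rewrite /U tr_perm_mx sE.
have UU : U *m U = 1%:M by rewrite /U -perm_mxM tperm2 perm_mx1.
have Uu : U \in unitmx by have [] := mulmx1_unit UU.
have cE (A : 'M[R]_k.+1) i j : (U *m A *m U) i j = A (s i) (s j).
  by rewrite -[X in (_ *m X) _ _]UT perm_conjE.
have ss i : s (s i) = i by exact: tpermK.
have [||||V [V1 V2 V3 V4]] := @calibration k.+1 (fun t => U *m P t *m U)
   (fun t => U *m B t *m U) (col_perm s l).
- by move=> t t01; rewrite -[X in _ *m X]UT; apply: posdefmx_congr => //; exact: Pp.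
- by move=> i j; apply: ac_ext (acP (s i) (s j)) => t _; rewrite !cE.
- by rewrite P0 mulmx1.
- apply/matrixP => i j; rewrite P1 cE !mxE (inj_eq perm_inj).
  by [].
have VBV t (A : 'M[R]_k.+1) : (U *m V t *m U) *m A *m (U *m V t *m U)^T =
    U *m (V t *m (U *m A *m U) *m (V t)^T) *m U.
  by rewrite !trmx_mul UT !mulmxA.
have tE t : \sum_i l 0 i * (2 * ((U *m V t *m U) *m B t *m (U *m V t *m U)^T) i i) =
    \sum_i (col_perm s l) 0 i * (2 * (V t *m (U *m B t *m U) *m (V t)^T) i i).
  rewrite (reindex_inj (@perm_inj _ s)); apply: eq_bigr => i _.
  by rewrite VBV cE !ss [col_perm _ _ _ _]mxE.
exists (fun t => U *m V t *m U); split.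
- by move=> t t01; rewrite VBV V1// mulmx1.
- by apply: eq_int01 V2 => t _; rewrite tE.
- rewrite (eq_acint (fun t _ => tE t)) V3 [RHS](reindex_inj (@perm_inj _ s)).
  by apply: eq_bigr => i _; rewrite mxE.
- move=> t j t01; rewrite cE tpermR V4// cE tpermL; congr (_%:R / _).
  by rewrite -[in RHS](inj_eq (@perm_inj _ s)) tpermR.
Qed.

End calibration.

(** * Smooth functions *)

Section smooth_functions.
Variable R : realType.

Section normed_module.
Variable V : normedModType R.
Implicit Types (f g : V -> R) (x v : V).

Definition smooth f := forall k, classC k f.

Lemma smooth_continuous f : smooth f -> continuous f.
Proof. by move=> /(_ 0%N). Qed.

Lemma smooth_derivable f x v : smooth f -> derivable f x v.
Proof. by move=> /(_ 1%N)/(_ v)[]. Qed.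

Lemma smooth_derive f v : smooth f -> smooth ('D_v f).
Proof. by move=> sf k; have /(_ v)[] := sf k.+1. Qed.

(** The induction on the order of differentiation is done once here; afterwards it suffices to
    exhibit a class of continuous functions stable under directional derivatives. *)
Lemma smooth_coind (C : (V -> R) -> Prop) :
  (forall f, C f -> continuous f /\
     forall v, exists2 g, C g & forall x, is_derive x v f (g x)) ->
  forall f, C f -> smooth f.
Proof.
move=> HC f + k; elim: k f => [|k IH] f Cf; first by case: (HC f Cf).
move=> v; have [_ /(_ v)[g Cg dg]] := HC f Cf.
split; first by move=> x; have [] := dg x.
have -> : 'D_v f = g by apply/funext => x; have [_ ->] := dg x.
exact: IH.
Qed.

Lemma is_derive_line f x v (d : R) :
  is_derive x v f d <-> is_derive (0 : R) 1 (fun h : R => f (h *: v + x)) d.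
Proof.
have E : 'D_v f x = 'D_1 (fun h : R => f (h *: v + x)) 0.
  rewrite /derive; set g1 := fun h => h^-1 *: _; set g2 := fun h => h^-1 *: _.
  suff -> : g1 = g2 by [].
  by rewrite funeqE /g1 /g2 => h /=; rewrite addr0 scale0r add0r [_%:A]mulr1.
split=> -[df <-]; first by split; [exact: (proj1 (derivable1P f x v) df)|rewrite E].
by split; [exact: (proj2 (derivable1P f x v) df)|rewrite E].
Qed.

Lemma is_derive_comp_line (h h' : R -> R) f x v (d : R) :
  is_derive (f x) 1 h (h' (f x)) -> is_derive x v f d ->
  is_derive x v (fun y => h (f y)) (h' (f x) * d).
Proof.
move=> dh /is_derive_line df; apply/is_derive_line.
have := @is_derive1_comp R h (fun k : R => f (k *: v + x)) 0 (h' (f x)) d.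
by rewrite /= scale0r add0r => /(_ dh df).
Qed.

(** Differentiating a product, a composite or an inverse yields sums and products of functions of
    all these kinds, so the class fed to [smooth_coind] has to be stable under all the operations
    simultaneously. *)
Inductive sm : (V -> R) -> Prop :=
| sm_smooth f : smooth f -> sm f
| sm_D f g : sm f -> sm g -> sm (fun x => f x + g x)
| sm_M f g : sm f -> sm g -> sm (fun x => f x * g x)
| sm_comp (h : R -> R) f : (forall k, classC k h) -> sm f -> sm (fun x => h (f x))
| sm_V f : (forall x, f x != 0) -> sm f -> sm (fun x => (f x)^-1).

Lemma smooth_cst (c : R) : smooth (fun=> c).
Proof.
apply: (@smooth_coind (fun f => exists c : R, f = fun=> c)); last by exists c.
move=> _ [r ->]; split; first exact: cts_cst.
by move=> v; exists (fun=> 0); [exists 0|move=> x; exact: is_derive_cst].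
Qed.

Lemma smooth_linear (l : V -> R) : continuous l ->
  (forall (k : R) x v, l (k *: v + x) = k * l v + l x) -> smooth l.
Proof.
move=> cl ll; apply: (@smooth_coind (fun f => f = l \/ exists c : R, f = fun=> c)); last by left.
move=> _ [->|[c ->]]; last first.
  split; first exact: cts_cst.
  by move=> v; exists (fun=> 0); [right; exists 0|move=> x; exact: is_derive_cst].
split=> // v; exists (fun=> l v); first by right; exists (l v).
move=> x; apply/is_derive_line.
rewrite (_ : (fun h => _) = (fun h : R => h * l v + l x)); last by apply/funext => h; rewrite ll.
by apply: is_derive_eq; rewrite /GRing.scale/=; ring.
Qed.

Lemma sm_is_smooth f : sm f -> smooth f.
Proof.
apply: smooth_coind => {}f; elim.
- move=> {}f sf; split; first exact: smooth_continuous.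
  move=> v; exists ('D_v f); first by apply: sm_smooth; exact: smooth_derive.
  by move=> x; apply: derivableP; exact: smooth_derivable.
- move=> {}f g _ [cf df] _ [cg dg]; split; first exact: ctsD.
  move=> v; have [f' sf' df'] := df v; have [g' sg' dg'] := dg v.
  exists (fun x => f' x + g' x); first exact: sm_D.
  by move=> x; apply: is_deriveD.
- move=> {}f g sf [cf df] sg [cg dg]; split; first exact: ctsM.
  move=> v; have [f' sf' df'] := df v; have [g' sg' dg'] := dg v.
  exists (fun x => f x * g' x + g x * f' x); first by apply: sm_D; exact: sm_M.
  by move=> x; apply: is_deriveM.
- move=> h {}f sh sf [cf df]; have ch : continuous h := sh 0%N.
  split; first exact: cts_comp.
  move=> v; have [f' sf' df'] := df v.
  exists (fun x => ('D_1 h) (f x) * f' x).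
    by apply: sm_M => //; apply: (@sm_comp ('D_1 h) f) => // k; have /(_ 1)[] := sh k.+1.
  move=> x; apply: (@is_derive_comp_line h ('D_1 h) f) => //.
  by apply: derivableP; have /(_ 1)[] := sh 1%N.
- move=> {}f f0 sf [cf df]; split.
    by move=> x; apply: cvgV; [exact: f0|exact: cf].
  move=> v; have [f' sf' df'] := df v.
  exists (fun x => (-1 * ((f x)^-1 * (f x)^-1)) * f' x).
    apply: sm_M => //; apply: sm_M; first by apply: sm_smooth; exact: smooth_cst.
    by apply: sm_M; exact: sm_V.
  move=> x; apply: (@is_derive_comp_line (fun r => r^-1) (fun r => -1 * (r^-1 * r^-1))) => //.
  apply: is_derive_eq; first exact: is_deriveV.
  by rewrite /GRing.scale/= mulr1 mulN1r -expr2 exprVn.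
Qed.

End normed_module.

Lemma smooth_id : smooth (fun x : R => x).
Proof. by apply: smooth_linear => [x|//]; exact: cvg_id. Qed.

Lemma is_derive_dir (f : R -> R) (x v d : R) : is_derive x 1 f d -> is_derive x v f (v * d).
Proof.
move=> df; apply/is_derive_line.
have dl : is_derive (0 : R) 1 (fun h : R => h *: v + x) v.
  by apply: is_derive_eq; rewrite /GRing.scale/=; ring.
have df' : is_derive (0 *: v + x) 1 f d by rewrite scale0r add0r.
by have := @is_derive1_comp R f (fun h : R => h *: v + x) 0 d v df' dl; rewrite mulrC.
Qed.

Lemma smooth_exp : smooth (@expR R).
Proof.
apply: (@smooth_coind _ (fun f => exists c, f = fun x : R => c * expR x)); last first.
  by exists 1; apply/funext => x; rewrite mul1r.
move=> _ [c ->]; split.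
  by apply: ctsM; [exact: cts_cst|exact: continuous_expR].
move=> v; exists (fun x => v * c * expR x); first by exists (v * c).
by move=> x; rewrite -mulrA; apply: is_derive_dir.
Qed.

(** The classical [expR (- x^-1)] extended by [0], with a polynomial factor in [x^-1] because this
    whole family is closed under differentiation. *)
Definition flat (p : {poly R}) (x : R) : R := if 0 < x then p.[x^-1] * expR (- x^-1) else 0.

(** With [y = x^-1 >= 1], the polynomial is at most of order [y ^+ size p], while the exponential
    series bounds [expR (- y)] by a constant over a power of [y] larger by two. The square in the
    bound is what makes the derivative at [0] vanish. *)
Lemma flat_bound p : exists2 C, 0 <= C & forall x, x <= 1 -> `|flat p x| <= C * x ^+ 2.
Proof.
pose N := size p; pose M := \sum_(i < size p) `|p`_i|.
have M0 : 0 <= M by apply: sumr_ge0.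
exists (M * N.+2`!%:R); first by rewrite mulr_ge0.
move=> x x1; rewrite /flat; case: ltP => x0; last first.
  by rewrite normr0; apply: mulr_ge0; [exact: mulr_ge0|exact: sqr_ge0].
pose y := x^-1; have y0 : 0 < y by rewrite invr_gt0.
have y1 : 1 <= y by rewrite invf_ge1.
rewrite -/y normrM (ger0_norm (expR_ge0 _)).
have py : `|p.[y]| <= M * y ^+ N.
  rewrite horner_coef; apply: (le_trans (ler_norm_sum _ _ _)).
  rewrite mulr_suml; apply: ler_sum => i _; rewrite normrM ler_wpM2l//.
  have yi : 0 <= y ^+ i by rewrite exprn_ge0// ltW.
  by rewrite (ger0_norm yi) ler_weXn2l// ltnW.
have ey : expR (- y) <= N.+2`!%:R / y ^+ N.+2.
  have f0 : 0 < N.+2`!%:R :> R by rewrite ltr0n fact_gt0.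
  have yN0 : 0 < y ^+ N.+2 by rewrite exprn_gt0.
  rewrite expRN -[leRHS]invf_div lef_pV2 ?posrE ?expR_gt0 ?divr_gt0//.
  by apply: le_trans (expR_ge1Dxn N.+1 (ltW y0)); rewrite lerDr.
apply: (@le_trans _ _ ((M * y ^+ N) * (N.+2`!%:R / y ^+ N.+2))).
  by apply: ler_pM => //; exact: expR_ge0.
have -> : x = y^-1 by rewrite invrK.
rewrite le_eqVlt; apply/orP; left; apply/eqP.
by rewrite !exprS; field; rewrite gt_eqF// expf_neq0// gt_eqF.
Qed.

Lemma is_derive_flat p (x : R) : is_derive x 1 (flat p) (flat ('X^2 * (p - p^`())) x).
Proof.
have [x0|x0|->] := ltgtP x 0.
- have -> : flat ('X^2 * (p - p^`())) x = 0 by rewrite /flat ltNge ltW.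
  apply: (@near_eq_is_derive R R R (cst 0)).
  near=> y; rewrite /flat ltNge ltW//; near: y; exact: lt_nbhsl.
- rewrite /flat x0.
  apply: (@near_eq_is_derive R R R (fun y => p.[y^-1] * expR (- y^-1))).
    near=> y; rewrite ifT//; near: y; exact: lt_nbhsr.
  have dV : is_derive x 1 (fun y : R => y^-1) (- x ^- 2).
    apply: is_derive_eq; first by apply: is_deriveV; rewrite gt_eqF.
    by rewrite /GRing.scale/= mulr1.
  have dp : is_derive x 1 (fun y : R => p.[y^-1]) ((p^`()).[x^-1] * - x ^- 2).
    exact: (@is_derive_comp_line R (horner p) (horner p^`()) (fun y : R => y^-1)).
  have de : is_derive x 1 (fun y : R => expR (- y^-1)) (expR (- x^-1) * x ^- 2).
    apply: (@is_derive_comp_line R expR expR (fun y : R => - y^-1)).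
    by apply: is_derive_eq; rewrite opprK.
  apply: is_derive_eq.
  rewrite hornerM hornerXn hornerD hornerN /GRing.scale/= exprVn.
  by ring.
- have -> : flat ('X^2 * (p - p^`())) 0 = 0 by rewrite /flat ltxx.
  have [C C0 fb] := flat_bound p.
  have f0 : flat p 0 = 0 by rewrite /flat ltxx.
  suff cv : (fun h => h^-1 *: ((flat p \o shift 0) (h *: 1) - flat p 0)) @ (0 : R)^' --> (0 : R).
    split; first by apply/cvg_ex; exists 0.
    by apply/cvg_lim.
  apply/cvgr0Pnorm_lt => e e0.
  have Ce : 0 < e / (C + 1) by rewrite divr_gt0// ltr_wpDl.
  near=> h.
  have hn0 : h != 0 by near: h; exact: nbhs_dnbhs_neq.
  have h1 : `|h| < 1 by near: h; exact: dnbhs0_lt.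
  have he : `|h| < e / (C + 1) by near: h; exact: dnbhs0_lt.
  rewrite /= f0 subr0 addr0 [_%:A]mulr1 normrM normfV.
  have h0 : 0 < `|h| by rewrite normr_gt0.
  rewrite mulrC ltr_pdivrMr//.
  apply: (le_lt_trans (fb _ _)); first by rewrite ltW// (le_lt_trans (ler_norm _)).
  rewrite -real_normK ?num_real// expr2 mulrA ltr_pM2r//.
  move: he; rewrite ltr_pdivlMr ?ltr_wpDl// mulrC => he; apply: le_lt_trans he.
  by rewrite ler_wpM2r// lerDl.
Unshelve. all: by end_near.
Qed.

Lemma smooth_flat p : smooth (flat p).
Proof.
apply: (@smooth_coind _ (fun f => exists q, f = flat q)); last by exists p.
move=> _ [q ->]; split.
  move=> x; apply/differentiable_continuous/derivable1_diffP.
  by have [] := is_derive_flat q x.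
move=> v; exists (flat (v *: ('X^2 * (q - q^`())))); first by eexists.
move=> x; have := is_derive_dir v (is_derive_flat q x).
rewrite (_ : v * _ = flat (v *: ('X^2 * (q - q^`()))) x)//.
by rewrite /flat; case: ifP => _; rewrite ?mulr0// hornerZ mulrA.
Qed.

Definition bump0 : R -> R := flat 1.

Lemma bump0E x : bump0 x = if 0 < x then expR (- x^-1) else 0.
Proof. by rewrite /bump0 /flat hornerE mul1r. Qed.

Lemma bump0_ge0 x : 0 <= bump0 x.
Proof. by rewrite bump0E; case: ifP => _ //; exact: expR_ge0. Qed.

Lemma bump0D_gt0 x : 0 < bump0 x + bump0 (1 - x).
Proof.
have [x0|x0] := ltP 0 x.
  by rewrite ltr_wpDr ?bump0_ge0// bump0E x0 expR_gt0.
by rewrite ltr_wpDl ?bump0_ge0// bump0E ifT ?expR_gt0// subr_gt0 (le_lt_trans x0).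
Qed.

Definition step x : R := bump0 x / (bump0 x + bump0 (1 - x)).

Lemma smooth_step : smooth step.
Proof.
have s0 : sm (fun x : R => x) by apply: sm_smooth; exact: smooth_id.
have sb : sm (fun x : R => bump0 x) by apply: (@sm_comp _ bump0) s0; exact: smooth_flat.
apply: sm_is_smooth; apply: sm_M => //; apply: sm_V => [x|].
  by rewrite gt_eqF// bump0D_gt0.
have s1 : sm (fun x : R => 1 - x).
  rewrite (_ : (fun x => 1 - x) = (fun x : R => 1 + (-1) * x)); last first.
    by apply/funext => x; rewrite mulN1r.
  apply: sm_D; first by apply: sm_smooth; exact: smooth_cst.
  by apply: sm_M => //; apply: sm_smooth; exact: smooth_cst.
by apply: sm_D => //; exact: (sm_comp (@smooth_flat 1) s1).
Qed.

Lemma step_le0 x : x <= 0 -> step x = 0.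
Proof. by move=> x0; rewrite /step bump0E ltNge x0 mul0r. Qed.

Lemma step_ge1 x : 1 <= x -> step x = 1.
Proof.
move=> x1; rewrite /step [bump0 (1 - x)]bump0E subr_gt0 ltNge x1 addr0 divff//.
by rewrite bump0E (lt_le_trans ltr01 x1) gt_eqF ?expR_gt0.
Qed.

Lemma step_itv x : 0 <= step x <= 1.
Proof.
have h := bump0D_gt0 x.
rewrite divr_ge0 ?bump0_ge0 ?(ltW h)//= ler_pdivrMr// mul1r lerDl; exact: bump0_ge0.
Qed.

End smooth_functions.

(** * Chain rules *)

Section chain_rule.
Context (R : realType) (V : normedModType R).
Implicit Types (f : V -> R) (F : R -> V) (c : R -> R) (x e : V) (t : R).

Lemma mean_value_line f x e (s : R) : (forall y, derivable f y e) ->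
  exists2 r : R, `|r| <= `|s| & f (s *: e + x) - f x = s * 'D_e f (r *: e + x).
Proof.
move=> df; pose g (r : R) := f (r *: e + x).
have dg (r : R) : is_derive r 1 g ('D_e f (r *: e + x)).
  have /is_derive_line H := derivableP (df (r *: e + x)).
  have ds : is_derive r 1 (fun h : R => h - r) 1.
    by apply: is_derive_eq; rewrite subr0.
  have H' : is_derive (r - r) 1 (fun h : R => f (h *: e + (r *: e + x))) ('D_e f (r *: e + x)).
    by rewrite subrr.
  have := @is_derive1_comp R _ (fun h : R => h - r) r _ _ H' ds.
  rewrite mulr1 (_ : _ \o _ = g)//; apply/funext => h /=.
  by rewrite /g addrA -scalerDl subrK.
have cg : continuous g.
  by move=> r; apply/differentiable_continuous/derivable1_diffP; have [] := dg r.
have g0 : g 0 = f x by rewrite /g scale0r add0r.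
have mvt (a b : R) : a < b -> exists2 r, a < r < b & g b - g a = 'D_e f (r *: e + x) * (b - a).
  move=> ab; have [|r rab E] := @MVT R g (fun r => 'D_e f (r *: e + x)) _ _ ab.
  - exact: continuous_subspaceT.
  - by exists r => //; move: rab; rewrite in_itv.
rewrite -g0; have [s0|s0|->] := ltgtP s 0.
- have [r /andP[sr r0] E] := mvt _ _ s0; exists r.
    by rewrite !ltr0_norm// lerN2 ltW.
  by rewrite -opprB E; ring.
- have [r /andP[sr r0] E] := mvt _ _ s0; exists r; first by rewrite !gtr0_norm// ltW.
  by rewrite E; ring.
- by exists 0 => //; rewrite scale0r add0r g0 subrr mul0r.
Qed.

(** Because [c] vanishes at [t], the product rule only asks for continuity of the other factor
    there. *)
Lemma is_derive_mul_vanishing c (k : R -> R) t (d : R) : c t = 0 -> is_derive t 1 c d ->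
  {for t, continuous k} -> is_derive t 1 (fun h => c h * k h) (d * k t).
Proof.
move=> c0 [dc dcE] ck.
suff H : (fun h => h^-1 *: (((fun h => c h * k h) \o shift t) (h *: (1:R)) - c t * k t)) @ (0 : R)^' --> d * k t.
  by split; [apply/cvg_ex; exists (d * k t)|apply/cvg_lim].
rewrite (_ : (fun h => _) =
   (fun h => (h^-1 *: ((c \o shift t) (h *: (1:R)) - c t)) * k (h + t))); last first.
  by apply/funext => h /=; rewrite c0 mul0r !subr0 [_%:A]mulr1 -scalerAl.
apply: cvgM; first by rewrite -dcE.
apply: (@cvg_comp _ _ _ (fun h : R => h + t) k _ (nbhs t)); last exact: ck.
apply/cvgrPdist_lt => eps e0; near=> h.
by rewrite opprD addrCA subrr addr0 normrN; near: h; exact: dnbhs0_lt.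
Unshelve. all: by end_near.
Qed.

(** A chain rule without total differentiability. The difference [f (c h *: e + F h) - f (F h)] is
    [c h * k h], where the quotient [k], completed by the derivative where [c] vanishes, is
    continuous at [t] by the mean value theorem along [e] and the continuity of ['D_e f]. *)
Lemma is_derive_add_direction f F c e t (a d : R) :
  (forall y, derivable f y e) -> {for F t, continuous ('D_e f)} ->
  {for t, continuous F} -> is_derive t 1 (fun h => f (F h)) a ->
  c t = 0 -> is_derive t 1 c d ->
  is_derive t 1 (fun h => f (c h *: e + F h)) (d * 'D_e f (F t) + a).
Proof.
move=> df cDf cF dfF c0 dc.
pose k h := if c h == 0 then 'D_e f (F t) else (f (c h *: e + F h) - f (F h)) / c h.
have kE h : f (c h *: e + F h) = c h * k h + f (F h).
  rewrite /k; case: eqP => [->|/eqP ch]; first by rewrite scale0r add0r mul0r add0r.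
  by rewrite mulrC divfK// subrK.
have kt : k t = 'D_e f (F t) by rewrite /k c0 eqxx.
have ck : {for t, continuous k}.
  have cc : {for t, continuous c}.
    by apply/differentiable_continuous/derivable1_diffP; have [] := dc.
  rewrite /prop_for /continuous_at kt; apply/cvgrPdist_lt => eps eps0.
  have /cvgrPdist_lt/(_ _ eps0) := cDf; move=> /nbhs_ballP[r /= r0 hr].
  have r20 : 0 < r / 2 by rewrite divr_gt0.
  have re : 0 < r / 2 / (`|e| + 1) by rewrite divr_gt0// ltr_wpDl.
  have /cvgrPdist_lt/(_ _ r20) hF := cF.
  have /cvgrPdist_lt/(_ _ re) hc := cc.
  near=> h.
  rewrite {1}/k; case: eqP => [_|/eqP ch]; first by rewrite subrr normr0.
  have [s sc ->] := mean_value_line (F h) (c h) df.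
  rewrite mulrAC divff// mul1r; apply: hr; rewrite -ball_normE /ball_ /=.
  have -> : F t - (s *: e + F h) = (F t - F h) - s *: e by rewrite opprD addrCA addrC.
  apply: (le_lt_trans (ler_normB _ _)); rewrite normrZ.
  have h1 : `|F t - F h| < r / 2 by near: h.
  have h2 : `|c t - c h| < r / 2 / (`|e| + 1) by near: h.
  rewrite c0 sub0r normrN in h2.
  have h3 : `|s| * `|e| <= r / 2.
    apply: (@le_trans _ _ (r / 2 / (`|e| + 1) * (`|e| + 1))); last first.
      by rewrite divfK// gt_eqF// ltr_wpDl.
    apply: ler_pM => //; last by rewrite lerDl.
    exact: (le_trans sc (ltW h2)).
  lra.
rewrite (_ : (fun h => _) = (fun h => c h * k h + f (F h))); last exact/funext.
rewrite -kt; apply: is_deriveD; exact: is_derive_mul_vanishing.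
Unshelve. all: by end_near.
Qed.

(** The directions are added one by one; continuity of each partial derivative replaces
    differentiability of [f]. *)
Lemma is_derive_curve f m (e : 'I_m -> V) (c : 'I_m -> R -> R) (d : 'I_m -> R) t x :
  (forall i y, derivable f y (e i)) -> (forall i, continuous ('D_(e i) f)) ->
  (forall i, c i t = 0) -> (forall i, is_derive t 1 (c i) (d i)) ->
  is_derive t 1 (fun h => f (\sum_i c i h *: e i + x)) (\sum_i d i * 'D_(e i) f x).
Proof.
move=> df cf; elim: m e c d df cf => [|m IH] e c d df cf c0 dc.
  rewrite big_ord0 (_ : (fun h => _) = cst (f x)); first exact: is_derive_cst.
  by apply/funext => h; rewrite big_ord0 add0r.
rewrite big_ord_recl.
pose F h := \sum_i c (lift ord0 i) h *: e (lift ord0 i) + x.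
have Ft : F t = x by rewrite /F big1 ?add0r// => i _; rewrite c0 scale0r.
rewrite (_ : (fun h => _) = (fun h => f (c ord0 h *: e ord0 + F h))); last first.
  by apply/funext => h; rewrite /F addrA big_ord_recl.
have -> : 'D_(e ord0) f x = 'D_(e ord0) f (F t) by rewrite Ft.
have cc i : {for t, continuous (c i)}.
  by apply/differentiable_continuous/derivable1_diffP; have [] := dc i.
apply: is_derive_add_direction => //; last exact: IH.
- exact: cf.
- apply: cvgD; last exact: cvg_cst.
  apply: cvg_big => [|i _]; first exact: add_continuous.
  by apply: cvgZr_tmp; exact: cc.
Qed.

Lemma derive_sum_direction f m (e : 'I_m -> V) (d : 'I_m -> R) x :
  (forall i y, derivable f y (e i)) -> (forall i, continuous ('D_(e i) f)) ->
  'D_(\sum_i d i *: e i) f x = \sum_i d i * 'D_(e i) f x.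
Proof.
move=> df cf.
suff H : is_derive (0:R) 1 (fun h : R => f (h *: (\sum_i d i *: e i) + x))
     (\sum_i d i * 'D_(e i) f x).
  by have [_ ->] := proj2 (is_derive_line _ _ _ _) H.
have := @is_derive_curve f m e (fun i h => d i * h) d 0 x df cf.
rewrite (_ : (fun h => _) = (fun h : R => f (h *: (\sum_i d i *: e i) + x))); last first.
  by apply/funext => h; rewrite scaler_sumr; congr (f (_ + _)); apply: eq_bigr => i _; rewrite scalerA mulrC.
apply=> i; first by rewrite mulr0.
by apply: is_derive_eq; rewrite /GRing.scale/=; ring.
Qed.

End chain_rule.

(** * Calculus of test functions of time and space *)

Section test_function_calculus.
Context (R : realType) (n : nat).
Implicit Types (f : R * 'cV[R]_n -> R) (z : R * 'cV[R]_n) (y v : 'cV[R]_n).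

Let e_ (i : 'I_n) : R * 'cV[R]_n := (0, delta_mx i 0).

Lemma pair_sum (v : 'cV[R]_n) : (0, v) = \sum_i v i 0 *: e_ i :> R * 'cV[R]_n.
Proof.
have fstE : (\sum_i v i 0 *: e_ i).1 = \sum_i (v i 0 *: e_ i).1.
  exact: (big_morph fst (fun _ _ => erefl _) (erefl _)).
have sndE : (\sum_i v i 0 *: e_ i).2 = \sum_i (v i 0 *: e_ i).2.
  exact: (big_morph snd (fun _ _ => erefl _) (erefl _)).
rewrite [RHS]surjective_pairing fstE sndE big1 => [|i _]; last by rewrite [LHS]mulr0.
congr pair; rewrite [LHS]matrix_sum_delta; apply: eq_bigr => i _.
by rewrite big_ord1.
Qed.

Lemma derive_cV f z v : smooth f ->
  'D_(0, v) f z = \sum_i v i 0 * 'D_(0, delta_mx i 0) f z.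
Proof.
move=> sf; rewrite pair_sum derive_sum_direction//.
- by move=> i y; exact: smooth_derivable.
- by move=> i; apply: smooth_continuous; exact: smooth_derive.
Qed.

(** The material derivative along a space-time curve. The curve is written in the basis made of the
    time direction, carried by the index [ord0], and the space directions. *)
Lemma is_derive_along f (Y : R -> 'cV[R]_n) (t : R) (Y' : 'cV[R]_n) : smooth f ->
  (forall i, is_derive t 1 (fun s => Y s i 0) (Y' i 0)) ->
  is_derive t 1 (fun s => f (s, Y s)) ('D_(1, 0) f (t, Y t) + 'D_(0, Y') f (t, Y t)).
Proof.
move=> sf dY.
pose e (i : 'I_n.+1) : R * 'cV[R]_n := if unlift ord0 i is Some j then e_ j else (1, 0).
pose c (i : 'I_n.+1) (h : R) := if unlift ord0 i is Some j then Y h j 0 - Y t j 0 else h - t.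
pose d (i : 'I_n.+1) := if unlift ord0 i is Some j then Y' j 0 else 1.
have H := @is_derive_curve R _ f n.+1 e c d t (t, Y t).
have -> : 'D_(1, 0) f (t, Y t) + 'D_(0, Y') f (t, Y t) = \sum_i d i * 'D_(e i) f (t, Y t).
  rewrite big_ord_recl /d /e unlift_none mul1r (derive_cV (t, Y t) Y' sf); congr (_ + _).
  by apply: eq_bigr => i _; rewrite liftK.
have -> : (fun s => f (s, Y s)) = (fun h => f (\sum_i c i h *: e i + (t, Y t))).
  apply/funext => h; congr f.
  rewrite big_ord_recl /c /e unlift_none.
  under eq_bigr do rewrite liftK.
  have := pair_sum (Y h - Y t).
  under [in RHS]eq_bigr do rewrite !mxE.
  move=> <-; apply/eqP; rewrite -pair_eqE; apply/andP; split; apply/eqP => /=.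
    by rewrite addr0 [_%:A]mulr1 subrK.
  by rewrite scaler0 add0r subrK.
apply: H.
- by move=> i y; exact: smooth_derivable.
- by move=> i; apply: smooth_continuous; exact: smooth_derive.
- by move=> i; rewrite /c; case: unlift => [j|]; rewrite subrr.
- move=> i; rewrite /c /d; case: unlift => [j|]; last first.
    by apply: is_derive_eq; rewrite subr0.
  have dYj := dY j.
  by apply: is_derive_eq; rewrite subr0.
Qed.

Lemma derive_outside (V : normedModType R) (f : V -> R) (z v : V) :
  ~ closure [set z | f z != 0] z -> 'D_v f z = 0.
Proof.
move=> nz; have nz0 : \forall w \near z, f w = 0.
  have : nbhs z (~` closure [set z | f z != 0]).
    by apply: open_nbhs_nbhs; split=> //; apply: closed_openC; exact: closed_closure.
  apply: filterS => w nw; apply/eqP; apply: contrapT => /negP fw; apply: nw.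
  exact: subset_closure.
have H := @near_eq_is_derive R V R (cst 0) f z v 0.
have [] := H _ (is_derive_cst _ _ _); last by [].
by apply: filterS nz0 => w ->.
Qed.

Lemma vanish_outside (T : topologicalType) (f : T -> R) (z : T) :
  ~ closure [set z | f z != 0] z -> f z = 0.
Proof.
by move=> nz; apply/eqP; apply: contrapT => /negP fw; apply: nz; exact: subset_closure.
Qed.

Lemma bounded_compact_support (T : topologicalType) (f : T -> R) (K : set T) :
  continuous f -> compact K -> (forall x, ~ K x -> f x = 0) ->
  exists2 M, 0 <= M & forall x, `|f x| <= M.
Proof.
move=> cf cK f0.
have cfK : compact (f @` K).
  by apply: continuous_compact => //; exact: continuous_subspaceT.
have [M [_ hM]] := compact_bounded cfK.
exists (`|M| + 1); first by rewrite addr_ge0.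
move=> z; have [Kz|nKz] := pselect (K z); last by rewrite f0// normr0 addr_ge0.
by apply: (hM (`|M| + 1)); [rewrite (le_lt_trans (ler_norm _))// ltrDl|exists z].
Qed.

End test_function_calculus.

(** * Real integrable functions *)

Section real_integrable_functions.
Context d (T : measurableType d) (R : realType) (mu : {measure set T -> \bar R}).
Implicit Types f g : T -> R.

Definition itgb f := mu.-integrable setT (EFin \o f).

Lemma itgb_measurable f : itgb f -> measurable_fun setT f.
Proof. by move=> /integrableP[/measurable_EFinP]. Qed.

Lemma itgb0 : itgb (fun=> 0).
Proof. exact: integrable0. Qed.

Lemma itgbD f g : itgb f -> itgb g -> itgb (fun x => f x + g x).
Proof.
move=> fi gi; have := integrableD measurableT fi gi.
by apply: eq_integrable => // x _; rewrite /= EFinD.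
Qed.

Lemma itgbZ (k : R) f : itgb f -> itgb (fun x => k * f x).
Proof.
move=> fi; have := @integrableZl _ _ _ mu _ measurableT k _ fi.
by apply: eq_integrable => // x _; rewrite /= EFinM.
Qed.

Lemma itgb_sum (I : Type) (r : seq I) (F : I -> T -> R) :
  (forall i, itgb (F i)) -> itgb (fun x => \sum_(i <- r) F i x).
Proof.
move=> Fi; elim: r => [|i r IH].
  by rewrite (_ : (fun x => _) = fun=> 0); [exact: itgb0|apply/funext => x; rewrite big_nil].
rewrite (_ : (fun x => _) = (fun x => F i x + \sum_(i <- r) F i x)); first exact: itgbD.
by apply/funext => x; rewrite big_cons.
Qed.

Lemma itgb_le f g : measurable_fun setT f -> (forall x, `|f x| <= g x) -> itgb g -> itgb f.
Proof.
move=> mf fg; apply: le_integrable => //; first exact/measurable_EFinP.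
by move=> x _; rewrite /= lee_fin (le_trans (fg x))// ler_norm.
Qed.

Lemma itgb_ge0 f : measurable_fun setT f -> (forall x, 0 <= f x) ->
  (\int[mu]_x (f x)%:E < +oo)%E -> itgb f.
Proof.
move=> mf f0 fi; apply/integrableP; split; first exact/measurable_EFinP.
apply: le_lt_trans fi; rewrite le_eqVlt; apply/orP; left; apply/eqP.
by apply: eq_integral => x _ /=; rewrite ger0_norm.
Qed.

Lemma itgb_integral f : itgb f -> (\int[mu]_x (f x)%:E)%E = (\int[mu]_x f x)%:E.
Proof. by move=> fi; rewrite fineK//; exact: integrable_fin_num. Qed.

Lemma RintD f g : itgb f -> itgb g ->
  \int[mu]_x (f x + g x) = \int[mu]_x f x + \int[mu]_x g x :> R.
Proof. by move=> fi gi; rewrite RintegralD. Qed.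

Lemma RintZ (k : R) f : itgb f -> \int[mu]_x (k * f x) = k * \int[mu]_x f x :> R.
Proof. by move=> fi; rewrite RintegralZl. Qed.

Lemma Rint_sum (I : Type) (r : seq I) (F : I -> T -> R) : (forall i, itgb (F i)) ->
  \int[mu]_x (\sum_(i <- r) F i x) = \sum_(i <- r) \int[mu]_x F i x :> R.
Proof.
move=> Fi; elim: r => [|i r IH].
  rewrite big_nil /Rintegral integral0_eq// => x _; by rewrite big_nil.
rewrite big_cons -IH -RintD//; last exact: itgb_sum.
by apply: eq_Rintegral => x _; rewrite big_cons.
Qed.

Lemma le_Rint f g : itgb f -> itgb g -> (forall x, f x <= g x) ->
  \int[mu]_x f x <= \int[mu]_x g x :> R.
Proof. by move=> fi gi fg; apply: le_Rintegral. Qed.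

Lemma Rint_ge0 f : (forall x, 0 <= f x) -> 0 <= \int[mu]_x f x :> R.
Proof. by move=> f0; apply: Rintegral_ge0. Qed.

Lemma norm_Rint f g : itgb f -> itgb g -> (forall x, `|f x| <= g x) ->
  `|\int[mu]_x f x| <= \int[mu]_x g x :> R.
Proof.
move=> fi gi fg; apply: (le_trans (le_normr_Rintegral _ _)) => //.
by apply: le_Rint => //; exact: integrable_norm.
Qed.

End real_integrable_functions.

Section bounded_functions.
Context d (T : measurableType d) (R : realType) (P : probability T R).

Lemma itgb_bounded (f : T -> R) (M : R) : measurable_fun setT f ->
  (forall x, `|f x| <= M) -> itgb P f.
Proof.
move=> mf fM; apply: (itgb_le mf fM).
exact: finite_measure_integrable_cst.
Qed.

Lemma Rint_cst (k : R) : \int[P]_x k = k :> R.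
Proof.
rewrite /Rintegral (_ : (\int[P]__ k%:E)%E = \int[P]_x cst k%:E x)%E//.
rewrite integral_cst// [X in (_ * X)%E](_ : _ = 1%E) ?mule1//.
exact: probability_setT.
Qed.

End bounded_functions.

(** * Second moments of Gaussian densities *)

Section gaussian_moments.
Context (R : realType) (n : nat).
Local Notation G := (gamma n : {measure set 'cV[R]_n -> \bar R}).

Lemma quadraticE (W : 'M[R]_n) (z : 'cV[R]_n) :
  (z^T *m W *m z) 0 0 = \sum_i \sum_j W i j * (z i 0 * z j 0).
Proof.
rewrite mxE exchange_big; apply: eq_bigr => j _; rewrite mxE mulr_suml.
by apply: eq_bigr => i _; rewrite mxE; ring.
Qed.

Lemma itgb_gamma_mul i j : itgb G (fun z => z i 0 * z j 0).
Proof. exact: integrable_gamma_mul. Qed.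

Lemma itgb_gamma_quadratic W : itgb G (fun z => (z^T *m W *m z) 0 0).
Proof.
have -> : (fun z : 'cV[R]_n => (z^T *m W *m z) 0 0) = (fun z => \sum_i \sum_j W i j * (z i 0 * z j 0)).
  by apply/funext => z; exact: quadraticE.
apply: itgb_sum => i; apply: itgb_sum => j; apply: itgbZ; exact: itgb_gamma_mul.
Qed.

Lemma gamma_quadratic W : (\int[G]_z ((z^T *m W *m z) 0 0)%:E = (\tr W)%:E)%E.
Proof.
rewrite itgb_integral; last exact: itgb_gamma_quadratic.
congr EFin; under eq_Rintegral do rewrite quadraticE.
rewrite Rint_sum; last first.
  by move=> i; apply: itgb_sum => j; apply: itgbZ; exact: itgb_gamma_mul.
apply: eq_bigr => i _; rewrite Rint_sum; last by move=> j; apply: itgbZ; exact: itgb_gamma_mul.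
rewrite (bigD1 i)//= big1 ?addr0 => [|j ji].
  by rewrite RintZ; [rewrite /Rintegral gamma_mul eqxx mulr1|exact: itgb_gamma_mul].
rewrite RintZ; last exact: itgb_gamma_mul.
by rewrite /Rintegral gamma_mul eq_sym (negbTE ji) mulr0.
Qed.

Lemma expect_gaussian_quadratic (L W : 'M[R]_n) : L \in unitmx ->
  expect (gaussian_pdf (L *m L^T)) (fun x => (x^T *m W *m x) 0 0) = (\tr (L^T *m W *m L))%:E.
Proof.
move=> Lu; rewrite expect_gaussian//; last first.
  by apply: continuous_measurable_mx; exact: continuous_quadratic.
rewrite -gamma_quadratic; apply: eq_integral => z _.
by rewrite trmx_mul !mulmxA.
Qed.

Lemma second_moment_gaussian (L : 'M[R]_n) : L \in unitmx ->
  second_moment (gaussian_pdf (L *m L^T)) = L *m L^T.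
Proof.
move=> Lu; apply/matrixP => i j; rewrite mxE.
(* As the quadratic form of [delta_mx i j], each entry becomes a trace. *)
have -> : (fun x : 'cV[R]_n => x i 0 * x j 0) = (fun x => (x^T *m delta_mx i j *m x) 0 0).
  apply/funext => x; rewrite quadraticE (bigD1 i)//= (bigD1 j)//= !big1 ?addr0.
  - by rewrite mxE !eqxx mul1r.
  - by move=> k ki; rewrite big1// => l _; rewrite mxE (negbTE ki) mul0r.
  - by move=> k kj; rewrite mxE (negbTE kj) andbF mul0r.
have St : (L *m L^T)^T = L *m L^T by rewrite trmx_mul trmxK.
rewrite expect_gaussian_quadratic//= mxtrace_mulC mulmxA mxtrace_mulC -[in RHS]St [RHS]mxE.
move: (L *m L^T) => S; rewrite /mxtrace (bigD1 i)//= big1 ?addr0 => [|k ki].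
  rewrite mxE (bigD1 j)//= big1 ?addr0 => [|k kj]; first by rewrite mxE !eqxx mul1r.
  by rewrite mxE (negbTE kj) andbF mul0r.
by rewrite mxE big1// => l _; rewrite mxE (negbTE ki) mul0r.
Qed.

End gaussian_moments.

(** * The Gaussian path *)

Lemma invmx_mul_trmx (R : realType) n (L : 'M[R]_n) : L \in unitmx ->
  invmx (L *m L^T) = invmx L^T *m invmx L.
Proof.
move=> Lu; have LTu : L^T \in unitmx by rewrite unitmx_tr.
have LLu : L *m L^T \in unitmx by rewrite unitmx_mul Lu.
by rewrite -[RHS](mulmxK LLu) !mulmxA mulmxKV// mulVmx// mul1mx.
Qed.

Section gaussian_path.
Context (R : realType) (n : nat) (K : 'M[R]_n) (l : 'rV[R]_n).
Local Notation mu := (@lebesgue_measure R).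
Local Notation G := (gamma n : {measure set 'cV[R]_n -> \bar R}).

Definition flow (t : R) : 'M[R]_n := K *m diag_mx (\row_i expR (t * (l 0 i / 2))).
Definition drift : 'M[R]_n := K *m diag_mx (2^-1 *: l) *m invmx K.

Lemma flow_cov t : flow t *m (flow t)^T = K *m diag_mx (map_mx expR (t *: l)) *m K^T.
Proof.
rewrite /flow trmx_mul tr_diag_mx -!mulmxA; congr (_ *m _); rewrite !mulmxA; congr (_ *m _).
rewrite mulmx_diag; congr diag_mx; apply/rowP => i.
by rewrite !mxE -expRD; congr expR; field.
Qed.

Lemma flow_coord t (z : 'cV[R]_n) i :
  (flow t *m z) i 0 = \sum_j K i j * (expR (t * (l 0 j / 2)) * z j 0).
Proof.
by rewrite /flow -mulmxA mxE; apply: eq_bigr => j _; rewrite mul_diag_mx !mxE.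
Qed.

Lemma flow_continuous : continuous (fun w : R * 'cV[R]_n => (w.1, flow w.1 *m w.2)).
Proof.
move=> w; apply: (@cvg_pair _ _ _ (nbhs w) (nbhs w.1) (nbhs (flow w.1 *m w.2))); first exact: cvg_fst.
apply: (@cvg_mx_coord _ _ _ (nbhs_filter w)) => i j; rewrite ord1.
have c : continuous (fun w : R * 'cV[R]_n => \sum_j K i j * (expR (w.1 * (l 0 j / 2)) * w.2 j 0)).
  apply: cts_sum => k; apply: ctsM; first exact: cts_cst.
  apply: ctsM.
    apply: cts_comp; first exact: continuous_expR.
    by apply: ctsM; [move=> y; exact: cvg_fst|exact: cts_cst].
  move=> y; apply: (@cvg_comp _ _ _ snd (fun x : 'cV[R]_n => x k 0)); first exact: cvg_snd.
  exact: coord_continuous.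
rewrite flow_coord; apply: cvg_trans (c w).
by apply: near_eq_cvg; near=> y; rewrite flow_coord.
Unshelve. all: by end_near.
Qed.

Lemma flow_comp_continuous (g : R * 'cV[R]_n -> R) : continuous g ->
  continuous (fun w : R * 'cV[R]_n => g (w.1, flow w.1 *m w.2)).
Proof.
move=> cg w; apply: (@continuous_comp _ _ _ (fun w : R * 'cV[R]_n => (w.1, flow w.1 *m w.2)) g).
  exact: flow_continuous.
exact: cg.
Qed.

Lemma continuous_fst_section (g : R * 'cV[R]_n -> R) z : continuous g ->
  continuous (fun t : R => g (t, z)).
Proof.
move=> cg t; apply: (@continuous_comp _ _ _ (fun t : R => (t, z)) g); last exact: cg.
by apply: (@cvg_pair _ _ _ (nbhs t) (nbhs t) (nbhs z)); [exact: cvg_id|exact: cvg_cst].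
Qed.

Hypothesis Ku : K \in unitmx.

Lemma flow_unit t : flow t \in unitmx.
Proof.
rewrite unitmx_mul Ku unitmxE det_diag unitfE/= gt_eqF//.
by apply: prodr_gt0 => i _; rewrite mxE expR_gt0.
Qed.

Lemma drift_flow t : drift *m flow t =
  K *m diag_mx (\row_i (l 0 i / 2 * expR (t * (l 0 i / 2)))).
Proof.
rewrite /drift /flow -!mulmxA; congr (_ *m _); rewrite mulKmx// mulmx_diag; congr diag_mx.
by apply/rowP => i; rewrite !mxE [2^-1 * _]mulrC.
Qed.

Lemma is_derive_flow (t : R) (z : 'cV[R]_n) (i : 'I_n) :
  is_derive t 1 (fun s => (flow s *m z) i 0) ((drift *m (flow t *m z)) i 0).
Proof.
have -> : (fun s => (flow s *m z) i 0) = \sum_(j < n) (fun s => K i j * (expR (s * (l 0 j / 2)) * z j 0)).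
  by apply/funext => s; rewrite flow_coord fct_sumE.
have -> : (drift *m (flow t *m z)) i 0 =
    \sum_(j < n) K i j * (l 0 j / 2 * expR (t * (l 0 j / 2)) * z j 0).
  rewrite mulmxA drift_flow -mulmxA mxE; apply: eq_bigr => j _.
  by rewrite mul_diag_mx !mxE.
apply: is_derive_sum => j.
have d1 : is_derive t 1 (fun s : R => s * (l 0 j / 2)) (l 0 j / 2).
  by apply: is_derive_eq; rewrite /GRing.scale/=; ring.
have d2 : is_derive t 1 (fun s : R => expR (s * (l 0 j / 2))) (expR (t * (l 0 j / 2)) * (l 0 j / 2)).
  exact: (@is_derive_comp_line R R expR expR (fun s : R => s * (l 0 j / 2))).
by apply: is_derive_eq; rewrite /GRing.scale/=; ring.
Qed.

Definition gpath t := gaussian_pdf (flow t *m (flow t)^T).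

Lemma expect_gpath t (g : 'cV[R]_n -> R) : measurable_fun setT g ->
  expect (gpath t) g = (\int[G]_z (g (flow t *m z))%:E)%E.
Proof. by move=> mg; rewrite /gpath expect_gaussian// flow_unit. Qed.

Lemma gpath_density t : is_density (gpath t).
Proof. by apply: is_density_gaussian; exact: flow_unit. Qed.

Lemma gpath_sqnorm2 t : (expect (gpath t) (@sqnorm2 R n) < +oo)%E.
Proof.
have -> : @sqnorm2 R n = (fun x => (x^T *m 1%:M *m x) 0 0).
  by apply/funext => x; rewrite mulmx1.
by rewrite /gpath expect_gaussian_quadratic ?ltry// flow_unit.
Qed.

(** Under the fixed measure [gamma n] only the integrand moves with time, so dominated convergence
    with the constant bound [M] gives continuity. *)
Lemma gpath_narrow : narrowly_continuous gpath.
Proof.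
move=> f cf [M fM]; have mf := continuous_measurable_mx cf.
have Eq : (fun t => fine (expect (gpath t) f)) = (fun t => \int[G]_z f (flow t *m z)).
  by apply/funext => t; rewrite expect_gpath.
rewrite Eq.
pose h (t : R) (z : 'cV[R]_n) := f (flow t *m z).
have ch z : continuous (h ^~ z).
  apply: (@continuous_fst_section (fun w => f (flow w.1 *m w.2)) z).
  apply: (@flow_comp_continuous (fun w => f w.2)).
  by move=> w; apply: (@continuous_comp _ _ _ snd f); [exact: cvg_snd|exact: cf].
have mh t : measurable_fun setT (h t).
  by apply: (measurableT_comp mf); exact: measurable_mulmxl.
(* The open time interval []-1, 2[] is a neighbourhood of [[0, 1]]; the path is defined and
   continuous there as well. *)
have := @continuity_under_integral R _ _ G h setT measurableT (-1) 2 _ _ (cst M) _ _.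
rewrite /= => H; apply/continuous_in_subspaceT => t /set_mem; rewrite /= in_itv/= => /andP[t0 t1].
apply: H.
- by move=> x _; exact: (itgb_bounded (gamma n) (mh x) (fun z => fM _)).
- by apply: aeW => z _ x _; exact: ch.
- exact: finite_measure_integrable_cst.
- by move=> x _; apply: aeW => z _; exact: fM.
- by rewrite inE/= in_itv/=; lra.
Qed.

Lemma gpath_energy t (W : 'M[R]_n) :
  expect (gpath t) (fun x => sqnormW W (drift *m x)) =
    (\tr ((drift *m flow t)^T *m W *m (drift *m flow t)))%:E.
Proof.
have -> : (fun x => sqnormW W (drift *m x)) = (fun x => (x^T *m (drift^T *m W *m drift) *m x) 0 0).
  by apply/funext => x; rewrite /sqnormW trmx_mul !mulmxA.
rewrite /gpath expect_gaussian_quadratic ?flow_unit//.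
by move: (flow t) drift => X A; rewrite trmx_mul !mulmxA.
Qed.

(** The drift acts on the flow by [drift *m flow t = flow t *m D] with [D] diagonal, and
    [X^T *m invmx (X *m X^T) *m X] is the identity, so the time dependence cancels and the trace of
    [D^T *m D] remains. *)
Lemma gpath_cost_rate t :
  expect (gpath t) (fun x => sqnormW (invmx (second_moment (gpath t))) (drift *m x)) =
    (\sum_i (l 0 i / 2) ^+ 2)%:E.
Proof.
rewrite gpath_energy second_moment_gaussian ?flow_unit//; congr EFin.
set D := diag_mx (2^-1 *: l).
have AX : drift *m flow t = flow t *m D.
  rewrite drift_flow /flow /D -mulmxA mulmx_diag; congr (_ *m diag_mx _).
  by apply/rowP => i; rewrite !mxE mulrC [X in _ * X]mulrC.
have gen (X : 'M[R]_n) : X \in unitmx ->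
    \tr ((X *m D)^T *m invmx (X *m X^T) *m (X *m D)) = \tr (D^T *m D).
  move=> Xu; rewrite invmx_mul_trmx// trmx_mul !mulmxA mulmxK ?unitmx_tr//.
  by rewrite mulmxKV.
rewrite AX gen ?flow_unit// /D tr_diag_mx mulmx_diag mxtrace_diag.
by apply: eq_bigr => i _; rewrite !mxE; ring.
Qed.

(** Pulled back to [gamma n], the integrand is the time derivative of [phi (t, flow t *m z)].
    Exchanging the integrals, each trajectory contributes the difference of the values at times [1]
    and [0], both outside the support of [phi]. *)
Lemma gpath_continuity_equation : continuity_equation gpath (fun=> mulmx drift).
Proof.
move=> phi [sphi cphi supp].
pose S := closure [set w | phi w != 0].
pose g (w : R * 'cV[R]_n) := 'D_(1, 0) phi w + 'D_(0, drift *m w.2) phi w.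
have gE w : g w = 'D_(1, 0) phi w + \sum_i (drift *m w.2) i 0 * 'D_(0, delta_mx i 0) phi w.
  by rewrite /g derive_cV.
have cg : continuous g.
  have -> : g = fun w => 'D_(1, 0) phi w +
      \sum_i (\sum_j drift i j * w.2 j 0) * 'D_(0, delta_mx i 0) phi w.
    by apply/funext => w; rewrite gE; congr (_ + _); apply: eq_bigr => i _; rewrite mxE.
  apply: ctsD; first by apply: smooth_continuous; exact: smooth_derive.
  apply: cts_sum => i; apply: ctsM; last by apply: smooth_continuous; exact: smooth_derive.
  apply: cts_sum => j; apply: ctsM; first exact: cts_cst.
  move=> w; apply: (@continuous_comp _ _ _ snd (fun x : 'cV[R]_n => x j 0)); first exact: cvg_snd.
  exact: coord_continuous.
(* The velocity is unbounded, but [g] is continuous and vanishes outside the compact support of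
   [phi]; its boundedness justifies Fubini. *)
have [M M0 gM] : exists2 M, 0 <= M & forall w, `|g w| <= M.
  apply: (bounded_compact_support cg cphi) => w nw.
  by rewrite /g !derive_outside// addr0.
pose psi (w : R * 'cV[R]_n) := g (w.1, flow w.1 *m w.2).
have cpsi : continuous psi by exact: flow_comp_continuous.
have mpsi : measurable_fun setT psi by exact: continuous_measurable_prod.
have mpsi2 t : measurable_fun setT (fun z => psi (t, z)).
  exact: (measurableT_comp mpsi (measurable_pair1 t)).
(* The indicator of [[0, 1]] moves the restriction in time into the integrand, so that Fubini is
   applied to full spaces. *)
pose f (w : measurableTypeR R * 'cV[R]_n) : \bar R := (\1_(`[0, 1] : set R) w.1 * psi w)%:E.
have mf : measurable_fun setT f.
  apply/measurable_EFinP; apply: measurable_funM; last exact: mpsi.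
  have m1 : measurable_fun setT (\1_(`[0, 1]%classic : set (measurableTypeR R)) : measurableTypeR R -> R).
    by apply: measurable_indic; exact: measurable_itv.
  exact: (measurableT_comp m1 measurable_fst).
have fM w : (`|f w| <= (\1_(`[0, 1] : set R) w.1 * M)%:E)%E.
  rewrite /f /= lee_fin normrM ger0_norm ?indicE//.
  by apply: ler_wpM2l; [exact: ler0n|exact: gM].
have intf : (mu \x gamma n)%E.-integrable setT f.
  apply/(integrable12ltyP mu (gamma n) mf).
  apply: (@le_lt_trans _ _ (\int[mu]_t (M%:E * (\1_(`[0, 1] : set R) t)%:E))%E).
    apply: ge0_le_integral => //.
    - by move=> t _; apply: integral_ge0.
    - have mfa : measurable_fun setT (abse \o f) by exact: measurableT_comp.
      apply: (measurable_fun_fubini_tonelli_F (m2 := gamma n) (abse \o f)) => [|w]; first [exact: mfa|exact: abse_ge0].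
    - by apply: emeasurable_funM => //; apply/measurable_EFinP; apply: measurable_indic; exact: measurable_itv.
    - move=> t _; rewrite -[leRHS]mule1 -(gammaT R n) -integral_cst//.
      apply: ge0_le_integral => //.
      + apply: measurableT_comp => //; exact: (measurableT_comp mf (measurable_pair1 t)).
      + by move=> z _; apply: (le_trans (fM (t, z))); rewrite /= mulrC EFinM.
  rewrite ge0_integralZl//.
  - rewrite [X in (_ * X < _)%E](_ : _ = 1%E) ?mule1 ?ltry//.
    rewrite (integral_indic mu measurableT (measurable_itv `[0, 1])) setIT.
    transitivity (lebesgue_measure (`[0, 1]%classic : set R)); first by [].
    by rewrite lebesgue_measure_itv/= lte_fin ltr01 sube0.
  - by apply/measurable_EFinP; apply: measurable_indic; exact: measurable_itv.
have inner (t : R) : \int[leb n]_x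
      (('D_(1, 0) phi (t, x) + 'D_(0, drift *m x) phi (t, x)) * gpath t x) =
    \int[G]_z psi (t, z).
  transitivity (fine (expect (gpath t) (fun x => g (t, x)))); first by [].
  rewrite expect_gpath//.
  apply: continuous_measurable_mx => x; apply: (@continuous_comp _ _ _ (fun x => (t, x)) g); last exact: cg.
  by apply: (@cvg_pair _ _ _ (nbhs x) (nbhs t) (nbhs x)); [exact: cvg_cst|exact: cvg_id].
have FTC z : (\int[mu]_(t in `[0%R, 1%R]) (psi (t, z))%:E = 0)%E.
  pose F (s : R) := phi (s, flow s *m z).
  have dF (s : R) : is_derive s 1 F (psi (s, z)).
    exact: (is_derive_along sphi (is_derive_flow s z)).
  have cF : continuous F.
    by move=> s; apply/differentiable_continuous/derivable1_diffP; have [] := dF s.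
  have F0 s : ~ (`]0, 1[%classic : set R) s -> F s = 0.
    by move=> ns; apply: (@vanish_outside _ _ phi) => c; have [h _] := supp _ c; exact: ns h.
  rewrite (@continuous_FTC2 R (fun t => psi (t, z)) F 0 1 ltr01).
  - by rewrite !F0 ?subee//= in_itv/= ltxx ?andbF.
  - by apply: continuous_subspaceT; exact: continuous_fst_section.
  - split=> //.
    + by apply: cvg_at_right_filter; exact: cF.
    + by apply: cvg_at_left_filter; exact: cF.
  - by move=> x _; rewrite derive1E; have [_ ->] := dF x.
transitivity (fine (\int[mu]_t \int[G]_z f (t, z)))%E; last first.
  rewrite [X in fine X](_ : _ = \int[G]_z \int[mu]_t f (t, z))%E.
    rewrite integral0_eq// => z _.
    rewrite -(FTC z) [RHS]integral_mkcond; apply: eq_integral => t _.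
    by rewrite /f patchE indicE; case: ifPn => _; rewrite ?mul1r ?mul0r.
  rewrite [LHS](integral12_prod_meas1 intf).
  by rewrite -(integral21_prod_meas1 intf).
rewrite /Rintegral; congr fine; rewrite [LHS]integral_mkcond; apply: eq_integral => t _.
rewrite patchE; case: ifPn => tI; last first.
  by rewrite integral0_eq// => z _; rewrite /f indicE (negbTE tI) mul0r.
transitivity (\int[G]_z psi (t, z))%:E; first by rewrite -inner.
rewrite -itgb_integral.
  by apply: eq_integral => z _; rewrite /f indicE tI mul1r.
exact: (itgb_bounded (gamma n) (mpsi2 t) (fun z => gM _)).
Qed.

Lemma gpath_finite_energy :
  (\int[mu]_(t in `[0%R, 1%R]) expect (gpath t) (fun x => sqnorm2 (drift *m x)) < +oo)%E.
Proof.
pose c (t : R) := \sum_i \sum_k (K k i * (l 0 i / 2 * expR (t * (l 0 i / 2)))) ^+ 2.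
have cc : continuous c.
  apply: cts_sum => i; apply: cts_sum => k.
  apply: (@cts_comp _ _ (fun x => x ^+ 2)); first exact: exprn_continuous.
  apply: ctsM; first exact: cts_cst.
  apply: ctsM; first exact: cts_cst.
  apply: cts_comp; first exact: continuous_expR.
  by apply: ctsM; [move=> y; exact: cvg_id|exact: cts_cst].
have E t : expect (gpath t) (fun x => sqnorm2 (drift *m x)) = (c t)%:E.
  transitivity (expect (gpath t) (fun x => sqnormW 1%:M (drift *m x))).
    by congr expect; apply/funext => x; rewrite /sqnormW mulmx1.
  rewrite gpath_energy mulmx1 drift_flow; congr EFin; apply: eq_bigr => i _.
  rewrite mxE; apply: eq_bigr => k _.
  by rewrite [X in X * _]mxE mul_mx_diag !mxE expr2.
under eq_integral do rewrite E.
have : mu.-integrable `[0, 1] (EFin \o c).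
  apply: continuous_compact_integrable; first exact: segment_compact.
  exact: continuous_subspaceT.
move=> ic; have : (\int[mu]_(t in `[0%R, 1%R]) (EFin \o c) t)%E \is a fin_num.
  by apply: integrable_fin_num ic; exact: measurable_itv.
by move=> /fin_numPlt/andP[].
Qed.

Lemma gpath_admissible : admissible (gaussian_pdf (K *m K^T))
  (gaussian_pdf (K *m diag_mx (map_mx expR l) *m K^T)) gpath (fun=> mulmx drift).
Proof.
split.
- split; [by move=> t _; exact: gpath_density|by move=> t _; exact: gpath_sqnorm2|].
  exact: gpath_narrow.
- apply: measurable_funTS.
  exact: (measurableT_comp (measurable_mulmxl drift) measurable_snd).
- exact: gpath_finite_energy.
- exact: gpath_continuity_equation.
- split; apply: aeW => x; rewrite /gpath flow_cov.
    rewrite scale0r (_ : map_mx expR 0 = const_mx 1) ?diag_const_mx ?mulmx1//.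
    by apply/rowP => i; rewrite !mxE expR0.
  by rewrite scale1r.
Qed.

Lemma gpath_cost : cost gpath (fun=> mulmx drift) = (\sum_i l 0 i ^+ 2)%:E.
Proof.
rewrite /cost; under eq_integral do rewrite gpath_cost_rate.
rewrite (_ : (\int[mu]_(t in `[0%R, 1%R]) _)%E = \int[mu]_(t in `[0%R, 1%R]) cst (\sum_i (l 0 i / 2) ^+ 2)%:E t)%E//.
rewrite integral_cst; last exact: measurable_itv.
rewrite [X in (_ * (_ * X))%E](_ : _ = 1%E); last first.
  transitivity (lebesgue_measure (`[0, 1]%classic : set R)); first by [].
  by rewrite lebesgue_measure_itv/= lte_fin ltr01 sube0.
by rewrite mule1 -EFinM mulr_sumr; congr EFin; apply: eq_bigr => i _; field.
Qed.

End gaussian_path.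

(** * Laws of densities *)

Lemma Rint_dct d (T : measurableType d) (R : realType) (mu : {measure set T -> \bar R})
    (D : set T) (f_ : nat -> T -> R) (f g : T -> R) : measurable D ->
  (forall k, measurable_fun D (f_ k)) -> (forall x, D x -> f_ k x @[k --> \oo] --> f x) ->
  mu.-integrable D (EFin \o g) -> (forall k x, D x -> `|f_ k x| <= g x) ->
  mu.-integrable D (EFin \o f) /\
  (\int[mu]_(x in D) f_ k x : R) @[k --> \oo] --> (\int[mu]_(x in D) f x : R).
Proof.
move=> mD mf ff ig fg.
have mfl : measurable_fun D f := measurable_fun_cvg mf ff.
have mfE k : measurable_fun D (fun x => (f_ k x)%:E) by exact/measurable_EFinP.
have mflE : measurable_fun D (EFin \o f) by exact/measurable_EFinP.
have ffE : {ae mu, forall x, D x -> (f_ k x)%:E @[k --> \oo] --> (f x)%:E}.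
  by apply: aeW => x Dx; apply/cvg_EFin; [exact: nearW|exact: ff].
have fgE : {ae mu, forall x k, D x -> (`|(f_ k x)%:E| <= (EFin \o g) x)%E}.
  by apply: aeW => x k Dx; rewrite /= lee_fin fg.
have [fi _ cv] := dominated_convergence mD mfE mflE ffE ig fgE.
split=> //; apply: fine_cvg; rewrite fineK//; exact: integrable_fin_num.
Qed.

(** * Continuous approximation of indicators of open sets *)

Section open_approximation.
Context (R : realType) (V : normedModType R) (U : set V).
Hypothesis oU : open U.

(** Its supremum plays the role of the distance to the complement of [U]; the cap at [1] keeps it
    finite when [U] is the whole space. *)
Let B (x : V) : set R := [set r | 0 <= r <= 1 /\ ball x r `<=` U].
Let depth x : R := sup (B x).

Let B0 x : B x 0.
Proof. by split; rewrite ?lexx ?ler01// => y; rewrite -ball_normE /ball_/= ltNge normr_ge0. Qed.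

Let Bub x : has_ubound (B x).
Proof. by exists 1 => r [/andP[]]. Qed.

Let depth_ge0 x : 0 <= depth x.
Proof. by apply: ub_le_sup => //; exact: B0. Qed.

Let depth_lip x y : depth x <= depth y + `|x - y|.
Proof.
apply: ge_sup; first by exists 0; exact: B0.
move=> r [/andP[r0 r1] rU]; rewrite -lerBlDr.
have [h|h] := leP 0 (r - `|x - y|); last by rewrite (le_trans (ltW h)).
apply: ub_le_sup => //; split.
  by rewrite h (le_trans _ r1)// lerBlDr lerDl.
move=> z; rewrite -ball_normE /ball_/= => yz; apply: rU; rewrite -ball_normE /ball_/=.
by rewrite (le_lt_trans (ler_distD y _ _))// addrC -ltrBrDr.
Qed.

Let depth_continuous : continuous depth.
Proof.
move=> x; apply/cvgrPdist_le => e e0; near=> y.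
have xy : `|x - y| <= e by near: y; exact: cvgr_dist_le.
rewrite ler_norml lerBrDr lerBlDr.
have h1 := depth_lip x y; have h2 := depth_lip y x; rewrite distrC in h2.
by lra.
Unshelve. all: by end_near.
Qed.

Lemma open_indicator_approx : exists f : nat -> V -> R,
  [/\ forall k, continuous (f k), forall k x, 0 <= f k x <= 1 &
      forall x, f k x @[k --> \oo] --> (\1_U x : R)].
Proof.
exists (fun k x => Num.min 1 (k%:R * depth x)); split.
- move=> k x; apply: (@continuous_min R V (cst 1) (fun x => k%:R * depth x)); first exact: cvg_cst.
  by apply: cvgMl_tmp; exact: depth_continuous.
- move=> k x; rewrite le_min ler01 mulr_ge0//= ?ler0n//.
  by rewrite ge_min lexx.
- move=> x; rewrite indicE; case: (boolP (x \in U)) => xU; last first.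
    rewrite (_ : (fun k => _) = fun=> 0); first exact: cvg_cst.
    apply/funext => k; suff -> : depth x = 0 by rewrite mulr0 min_r.
    apply/eqP; rewrite eq_le depth_ge0 andbT; apply: ge_sup; first by exists 0; exact: B0.
    move=> r [/andP[r0 _] rU]; rewrite leNgt; apply: contra xU => r_gt0.
    by apply/mem_set/rU; exact: ballxx.
  have d0 : 0 < depth x.
    have : nbhs x U by apply: open_nbhs_nbhs; split => //; exact: set_mem.
    move=> /nbhs_ballP[e /= e0 eU].
    apply: (@lt_le_trans _ _ (Num.min e 1)); first by rewrite lt_min e0 ltr01.
    apply: ub_le_sup => //; split.
      by rewrite le_min (ltW e0) ler01 ge_min lexx orbT.
    by move=> y by_; apply: eU; apply: le_ball by_; rewrite ge_min lexx.
  apply: cvg_near_cst; near=> k; rewrite min_l//.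
  rewrite -ler_pdivrMr// div1r.
  near: k; exact: nbhs_infty_ger.
Unshelve. all: by end_near.
Qed.

End open_approximation.

Section law.
Context (R : realType) (n : nat) (p : 'cV[R]_n -> R) (hp : is_density p).

Let mp : measurable_fun setT p. Proof. by case: hp. Qed.
Let p0 x : 0 <= p x. Proof. by case: hp. Qed.

Definition law := dens (leb n) mp p0.
HB.instance Definition _ := Measure.on law.

Lemma lawT : law setT = 1%E.
Proof. by case: hp. Qed.

HB.instance Definition _ := Measure_isProbability.Build _ _ _ law lawT.

Lemma expect_law (g : 'cV[R]_n -> R) : measurable_fun setT g ->
  expect p g = (\int[law]_x (g x)%:E)%E.
Proof. by move=> mg; rewrite [RHS](integral_dens (leb n) mp p0 mg). Qed.

End law.

Section measurable_laws.
Context (R : realType) (n : nat) (p : R -> 'cV[R]_n -> R).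
Hypothesis hp : forall t, is_density (p t).
Hypothesis np : forall f : 'cV[R]_n -> R, continuous f -> (exists M, forall x, `|f x| <= M) ->
  continuous (fun t => fine (expect (p t) f)).
Local Notation T := (measurableTypeR R).

(** This makes the path of laws a probability kernel. For open [U] the mass is a limit of
    expectations of bounded continuous functions, continuous in time by hypothesis; a Dynkin
    argument reaches all Borel sets. *)
Lemma measurable_law U : measurable U ->
  measurable_fun setT (fun t : T => law (hp t) U).
Proof.
pose P (U : set 'cV[R]_n) := measurable_fun setT (fun t : T => law (hp t) U).
apply: (@dynkin_induction _ _ [set U : set 'cV[R]_n | open U] P) => //.
- by move=> A B; exact: openI.
- rewrite /P (_ : (fun t => _) = fun=> 1%E)//.
  by apply/funext => t; exact: lawT.
- move=> V /= oV; have [f [cf f01 fV]] := open_indicator_approx oV.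
  have fM k x : `|f k x| <= 1 by have /andP[? ?] := f01 k x; rewrite ger0_norm.
  have mf k : measurable_fun setT (f k) by exact: continuous_measurable_mx.
  have mV : measurable V by exact: measurable_open_mx.
  have H (t : T) : (fine (expect (p t) (f k))) @[k --> \oo] --> fine (law (hp t) V).
    have [||||_] := @Rint_dct _ _ R (law (hp t)) setT f (\1_V) (cst 1) measurableT.
    + by move=> k; exact: mf.
    + by move=> x _; exact: fV.
    + exact: (finite_measure_integrable_cst (law (hp t))).
    + by move=> k x _; exact: fM.
    + rewrite /Rintegral integral_indic// setIT.
      by under eq_fun do rewrite -expect_law//.
  rewrite /P (_ : (fun t : T => law (hp t) V) = EFin \o (fun t : T => fine (law (hp t) V))); last first.
    by apply/funext => t /=; rewrite fineK//; exact: (fin_num_measure (law (hp t))).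
  apply/measurable_EFinP; apply: (measurable_fun_cvg (h := fun k t => fine (expect (p t) (f k)))).
    move=> k; apply: continuous_measurable_fun.
    by apply: np; [exact: cf|exists 1; exact: fM].
  by move=> t _; exact: H.
- move=> S mS PS; rewrite /P.
  have -> : (fun t : T => law (hp t) (~` S)) = (fun t => 1 - law (hp t) S)%E.
    apply/funext => t; exact: (probability_setC (law (hp t)) mS).
  by apply: emeasurable_funB.
- move=> F mF tF PF; rewrite /P.
  have -> : (fun t : T => law (hp t) (\bigcup_k F k)) = (fun t => \sum_(k <oo) law (hp t) (F k))%E.
    apply/funext => t; apply/esym/cvg_lim => //.
    exact: (measure_sigma_additive (mu := law (hp t)) mF tF).
  by apply: ge0_emeasurable_sum => // k _; exact: PF.
Qed.

Let k_ : T -> {measure set 'cV[R]_n -> \bar R} := fun t => law (hp t).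
HB.instance Definition _ := isKernel.Build _ _ _ _ _ k_ measurable_law.
HB.instance Definition _ := Kernel_isProbability.Build _ _ _ _ _ k_ (fun t => lawT (hp t)).

Lemma measurable_integral_law (g : T * 'cV[R]_n -> \bar R) : (forall z, 0 <= g z)%E ->
  measurable_fun setT g -> measurable_fun setT (fun t => \int[law (hp t)]_x g (t, x))%E.
Proof. by move=> g0 mg; exact: (@measurable_fun_integral_finite_kernel _ _ _ _ _ g k_). Qed.

Lemma measurable_Rint_law (g : T * 'cV[R]_n -> R) : measurable_fun setT g ->
  measurable_fun setT (fun t : T => \int[law (hp t)]_x g (t, x) : R).
Proof.
move=> mg; apply: measurableT_comp => //.
have mgE : measurable_fun setT (EFin \o g) by exact/measurable_EFinP.
have -> : (fun t : T => \int[law (hp t)]_x (g (t, x))%:E)%E =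
  (fun t : T => \int[law (hp t)]_x (EFin \o g)^\+ (t, x) - \int[law (hp t)]_x (EFin \o g)^\- (t, x))%E.
  apply/funext => t; rewrite [LHS]integralE.
  by congr (_ - _)%E; apply: eq_integral => x _; rewrite ?funeposE ?funenegE.
apply: emeasurable_funB; apply: measurable_integral_law.
- by move=> z; exact: funepos_ge0.
- exact: measurable_funepos.
- by move=> z; exact: funeneg_ge0.
- exact: measurable_funeneg.
Qed.

End measurable_laws.

(** * Weak derivatives *)

Section weak_derivative.
Variable R : realType.
Local Notation mu := (@lebesgue_measure R).
Implicit Types (f g m : R -> R) (s t u : R).

Lemma cts_int01 f : continuous f -> int01 f.
Proof.
move=> cf; apply: continuous_compact_integrable; first exact: segment_compact.
exact: continuous_subspaceT.
Qed.

Lemma acint_ftc (F f : R -> R) s t : s <= t -> (forall u : R, is_derive u 1 F (f u)) ->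
  continuous f -> acint f s t = F t - F s.
Proof.
rewrite le_eqVlt => /orP[/eqP ->|st] dF cf; first by rewrite acintxx subrr.
have cF : continuous F.
  by move=> u; apply/differentiable_continuous/derivable1_diffP; have [] := dF u.
rewrite /acint /Rintegral (continuous_FTC2 (F := F) st)//.
- exact: continuous_subspaceT.
- split=> //.
  + by apply: cvg_at_right_filter; exact: cF.
  + by apply: cvg_at_left_filter; exact: cF.
- by move=> u _; rewrite derive1E; have [_ ->] := dF u.
Qed.

Lemma acint_cst (k : R) s t : s <= t -> acint (fun=> k) s t = k * (t - s).
Proof.
move=> st; have dF (u : R) : is_derive u 1 (fun u => k * u) k.
  by apply: is_derive_eq; rewrite /GRing.scale/=; ring.
by rewrite (acint_ftc st dF (@cts_cst _ _ k)) mulrBr.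
Qed.

(** A kernel of mass one, supported in an interval of length [e] and of height at most [C / e], may
    change sign: this is why the error [d] is multiplied by [C]. *)
Lemma acint_kernel f m (c e C M d : R) : 0 <= c -> 0 < e -> c + e <= 1 -> cts01 m ->
  continuous f -> (forall u, ~~ (c < u < c + e) -> f u = 0) -> (forall u, `|f u| <= C / e) ->
  acint f 0 1 = 1 -> (forall u, c <= u <= c + e -> `|m u - M| <= d) ->
  `|acint (fun u => f u * m u) 0 1 - M| <= C * d.
Proof.
move=> c0 e0 ce1 cm cf f0 fC f1 md.
have ce : c <= c + e by rewrite lerDl ltW.
have i0 : int01 f by exact: cts_int01.
have i1 : int01 (fun u => f u * m u).
  have := int01M cm i0; apply: eq_int01 => u _; exact: mulrC.
have i2 : int01 (fun u => f u * m u + - M * f u) by apply: int01D => //; exact: int01Z.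
have -> : acint (fun u => f u * m u) 0 1 - M = acint (fun u => f u * m u + - M * f u) 0 1.
  by rewrite acintD// ?acintZ// ?f1 ?mulr1//; exact: int01Z.
have z s t : 0 <= s -> s <= t -> t <= 1 -> (forall u, s <= u <= t -> ~~ (c < u < c + e)) ->
    acint (fun u => f u * m u + - M * f u) s t = 0.
  move=> s0 st t1 h; rewrite (@eq_acint _ _ (fun=> 0)) ?acint_cst ?mul0r//.
  by move=> u su; rewrite f0 ?h// mul0r mulr0 addr0.
rewrite -(acint_chasles i2 (lexx 0) c0 _ (lexx 1)) ?(le_trans ce)//.
rewrite -(acint_chasles i2 c0 ce ce1 (lexx 1)).
rewrite [X in X + _]z// ?(le_trans ce)//; last first.
  by move=> u /andP[_ uc]; rewrite ltNge uc.
rewrite [X in _ + (_ + X)]z//; last 2 first.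
- exact: le_trans ce.
- by move=> u /andP[cu _]; rewrite negb_and orbC -leNgt cu.
rewrite add0r addr0; apply: (le_trans (le_norm_acint _ _ _)) => //.
apply: (@le_trans _ _ (acint (fun=> C / e * d) c (c + e))).
  apply: le_acint => //; first exact: int01_norm.
    by apply: cts_int01; exact: cts_cst.
  move=> u uc; rewrite mulNr [M * _]mulrC -mulrBr normrM.
  by apply: ler_pM => //; exact: md.
rewrite acint_cst// (addrC c) addrK le_eqVlt; apply/orP; left; apply/eqP.
by field; rewrite gt_eqF.
Qed.

Definition ramp (c e : R) (u : R) : R := step ((u - c) / e).

Lemma smooth_ramp c e : smooth (ramp c e).
Proof.
apply: sm_is_smooth; apply: (@sm_comp _ _ (@step R)); first exact: smooth_step.
rewrite (_ : (fun u => _) = (fun u : R => e^-1 * u + - (c / e))); last first.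
  by apply/funext => u; rewrite mulrBl mulrC.
apply: sm_D; last by apply: sm_smooth; exact: smooth_cst.
by apply: sm_M; apply: sm_smooth; [exact: smooth_cst|exact: smooth_id].
Qed.

Lemma ramp_le0 c e u : 0 < e -> u <= c -> ramp c e u = 0.
Proof. by move=> e0 uc; rewrite /ramp step_le0// pmulr_lle0 ?invr_gt0// subr_le0. Qed.

Lemma ramp_ge1 c e u : 0 < e -> c + e <= u -> ramp c e u = 1.
Proof. by move=> e0 uc; rewrite /ramp step_ge1// ler_pdivlMr// mul1r lerBrDl. Qed.

Lemma ramp_itv c e u : 0 <= ramp c e u <= 1.
Proof. exact: step_itv. Qed.

(** At the two junction points the derivative is obtained by continuity from the side where [step]
    is constant. *)
Lemma derive_step0 (u : R) : ~~ (0 < u < 1) -> 'D_1 (@step R) u = 0.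
Proof.
move=> u01; have cD : continuous ('D_1 (@step R)).
  by apply: smooth_continuous; apply: smooth_derive; exact: smooth_step.
have D0 w : w < 0 -> 'D_1 (@step R) w = 0.
  move=> w0; have [] // := @near_eq_is_derive R R R (cst 0) (@step R) w 1 0 _ (is_derive_cst _ _ _).
  by near=> y; rewrite /= step_le0// ltW//; near: y; exact: lt_nbhsl.
have D1 w : 1 < w -> 'D_1 (@step R) w = 0.
  move=> w0; have [] // := @near_eq_is_derive R R R (cst 1) (@step R) w 1 0 _ (is_derive_cst _ _ _).
  by near=> y; rewrite /= step_ge1// ltW//; near: y; exact: lt_nbhsr.
have [u0|u0|u0] := ltgtP u 0; first exact: D0.
- have [u1|u1|u1] := ltgtP u 1; [by rewrite u0 u1 in u01|exact: D1|].
  have c1 : 'D_1 (@step R) x @[x --> 1^'+] --> 'D_1 (@step R) 1 by apply: cvg_at_right_filter; exact: cD.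
  rewrite u1; apply: (cvg_unique (@norm_hausdorff _ _) c1).
  apply: cvg_near_cst; near=> y; apply: D1; near: y; exact: nbhs_right_gt.
- have c1 : 'D_1 (@step R) x @[x --> 0^'-] --> 'D_1 (@step R) 0 by apply: cvg_at_left_filter; exact: cD.
  rewrite u0; apply: (cvg_unique (@norm_hausdorff _ _) c1).
  apply: cvg_near_cst; near=> y; apply: D0; near: y; exact: nbhs_left_lt.
Unshelve. all: by end_near.
Qed.

Lemma derive_ramp c e u : 'D_1 (ramp c e) u = e^-1 * 'D_1 (@step R) ((u - c) / e).
Proof.
have d1 : is_derive u 1 (fun v : R => (v - c) / e) e^-1.
  apply: is_derive_eq; rewrite /GRing.scale/=; ring.
have d2 : is_derive u 1 (ramp c e) ('D_1 (@step R) ((u - c) / e) * e^-1).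
  apply: (@is_derive_comp_line R R (@step R) ('D_1 (@step R)) (fun v : R => (v - c) / e)) => //.
  by apply: derivableP; apply: smooth_derivable; exact: smooth_step.
by have [_ ->] := d2; rewrite mulrC.
Qed.

Lemma derive_step_bound : exists2 C : R, 0 <= C & forall u, `|'D_1 (@step R) u| <= C.
Proof.
apply: (@bounded_compact_support _ R _ `[0, 1]).
- by apply: smooth_continuous; apply: smooth_derive; exact: smooth_step.
- exact: segment_compact.
- move=> u u01; apply: derive_step0; apply/negP => /andP[u0 u1].
  by apply: u01; rewrite /= in_itv/= !ltW.
Qed.

(** The derivative of a ramp of width [e] is a kernel as in [acint_kernel], with [C] a bound on the
    derivative of [step], independent of the position and width of the ramp. *)
Lemma ramp_average m : cts01 m -> exists2 C : R, 0 <= C &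
  forall (c e M d : R), 0 <= c -> 0 < e -> c + e <= 1 ->
  (forall u, c <= u <= c + e -> `|m u - M| <= d) ->
  `|acint (fun u => 'D_1 (ramp c e) u * m u) 0 1 - M| <= C * d.
Proof.
move=> cm; have [C C0 sC] := derive_step_bound; exists C => // c e M d c0 e0 ce1 md.
apply: (@acint_kernel _ _ c e) => //.
- by apply: smooth_continuous; apply: smooth_derive; exact: smooth_ramp.
- move=> u uc; rewrite derive_ramp derive_step0 ?mulr0//; apply: contra uc => /andP[h1 h2].
  rewrite pmulr_lgt0 ?invr_gt0// in h1; rewrite ltr_pdivrMr// mul1r in h2.
  by rewrite -subr_gt0 h1 -ltrBlDl.
- move=> u; rewrite derive_ramp normrM ger0_norm ?invr_ge0 ?(ltW e0)// mulrC.
  by apply: ler_wpM2r => //; rewrite invr_ge0 ltW.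
- have dF (u : R) : is_derive u 1 (ramp c e) ('D_1 (ramp c e) u).
    by apply: derivableP; apply: smooth_derivable; exact: smooth_ramp.
  rewrite (acint_ftc ler01 dF); last by apply: smooth_continuous; apply: smooth_derive; exact: smooth_ramp.
  by rewrite (ramp_le0 e0 c0) (ramp_ge1 e0 ce1) subr0.
Qed.

(** The test functions are differences of two ramps tending to the indicator of []s, t[]. The
    derivative of each ramp averages the continuous function [m] near an end point, so the weak
    equation converges to [m s - m t + acint G s t = 0]. *)
Lemma weak_ac m G : cts01 m -> int01 G ->
  (forall eta, smooth eta -> (exists a b, [/\ 0 < a, b < 1 & forall u, ~~ (a <= u <= b) -> eta u = 0]) ->
    acint (fun u => 'D_1 eta u * m u + eta u * G u) 0 1 = 0) ->
  ac m G.
Proof.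
move=> cm Gi H; split=> // s t s0; rewrite le_eqVlt => /orP[/eqP <- _|st t1].
  by rewrite acintxx subrr.
(* Four lengths [e k] must fit into [[s, t]]: one for each ramp, and a margin at each end keeping
   the support inside []0, 1[] even when [s = 0] or [t = 1]. *)
pose e (k : nat) : R := (t - s) / 4 * k.+1%:R^-1.
have ts0 : 0 < t - s by rewrite subr_gt0.
have e0 k : 0 < e k by rewrite mulr_gt0 ?invr_gt0 ?ltr0n// divr_gt0.
have e4 k : 4 * e k <= t - s.
  rewrite /e mulrA [4 * _]mulrC divfK// ler_piMr// ?(ltW ts0)//.
  by rewrite invf_le1 ?ltr0n// ler1n.
pose eta k u := ramp (s + e k) (e k) u - ramp (t - 2 * e k) (e k) u.
have eta0 k u : ~~ (s + e k <= u <= t - e k) -> eta k u = 0.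
  have := e4 k; have := e0 k => h1 h2; rewrite negb_and -!ltNge => /orP[us|us]; rewrite /eta.
    by rewrite !ramp_le0 ?subrr//; lra.
  by rewrite !ramp_ge1 ?subrr//; lra.
have eta1 k u : `|eta k u| <= 1.
  have /andP[a0 a1] := ramp_itv (s + e k) (e k) u.
  by have /andP[b0 b1] := ramp_itv (t - 2 * e k) (e k) u; rewrite ler_norml /eta; lra.
have seta k : smooth (eta k).
  apply: sm_is_smooth; rewrite (_ : eta k = fun u => ramp (s + e k) (e k) u + (-1) * ramp (t - 2 * e k) (e k) u); last first.
    by apply/funext => u; rewrite mulN1r.
  apply: sm_D; first by apply: sm_smooth; exact: smooth_ramp.
  by apply: sm_M; apply: sm_smooth; [exact: smooth_cst|exact: smooth_ramp].
have deta k u : 'D_1 (eta k) u = 'D_1 (ramp (s + e k) (e k)) u - 'D_1 (ramp (t - 2 * e k) (e k)) u.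
  have d1 : is_derive u 1 (ramp (s + e k) (e k)) ('D_1 (ramp (s + e k) (e k)) u).
    by apply: derivableP; apply: smooth_derivable; exact: smooth_ramp.
  have d2 : is_derive u 1 (ramp (t - 2 * e k) (e k)) ('D_1 (ramp (t - 2 * e k) (e k)) u).
    by apply: derivableP; apply: smooth_derivable; exact: smooth_ramp.
  by have [_] := is_deriveB d1 d2.
have idm c k : int01 (fun u => 'D_1 (ramp c (e k)) u * m u).
  have := int01M cm (cts_int01 (smooth_continuous (smooth_derive (1 : R) (smooth_ramp c (e k))))).
  by apply: eq_int01 => u _; exact: mulrC.
have ieG k : int01 (fun u => eta k u * G u).
  by apply: int01M => //; apply: continuous_subspaceT; apply: smooth_continuous; exact: seta.
have split k : acint (fun u => 'D_1 (ramp (s + e k) (e k)) u * m u) 0 1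
    - acint (fun u => 'D_1 (ramp (t - 2 * e k) (e k)) u * m u) 0 1
    + acint (fun u => eta k u * G u) 0 1 = 0.
  have h1 := e4 k; have h2 := e0 k.
  rewrite -[RHS](H (eta k) (seta k)); last first.
    exists (s + e k), (t - e k); split; [lra|lra|exact: eta0].
  rewrite -mulN1r -acintZ// -acintD//; last by apply: int01Z; exact: idm.
  rewrite -acintD//; last by apply: int01D => //; apply: int01Z; exact: idm.
  by apply: eq_acint => u _; rewrite deta; ring.
have e_cvg : e k @[k --> \oo] --> (0 : R).
  rewrite -[X in _ --> X](mulr0 ((t - s) / 4)); apply: cvgMl_tmp; exact: cvg_harmonic.
have avg (c : nat -> R) (x : R) : 0 <= x <= 1 -> (forall k, 0 <= c k) -> (forall k, c k + e k <= 1) ->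
    (forall k, `|c k - x| <= 2 * e k) ->
    acint (fun u => 'D_1 (ramp (c k) (e k)) u * m u) 0 1 @[k --> \oo] --> m x.
  move=> x01 c0 c1 cx; have [C C0 HC] := ramp_average cm.
  apply/cvgrPdist_le => d d0.
  have [r r0 mr] := cts01_unif cm (divr_gt0 d0 (ltr_wpDl C0 ltr01)).
  near=> k.
  (* A ramp starts within [2 * e k] of the point and has width [e k]. *)
  have ek : 3 * e k < r.
    rewrite -ltr_pdivlMl//; near: k; apply: (cvgr_lt 0) => //.
    by rewrite mulr_gt0// invr_gt0.
  rewrite distrC; apply: (le_trans (HC _ _ (m x) (d / (C + 1)) (c0 k) (e0 k) (c1 k) _)).
    move=> u /andP[cu uc]; apply/ltW/mr => //.
      by rewrite (le_trans (c0 k) cu) (le_trans uc (c1 k)).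
    have := cx k; rewrite ler_norml => /andP[h1 h2]; rewrite ltr_norml; lra.
  by rewrite mulrA ler_pdivrMr ?ltr_wpDl// mulrC ler_wpM2l ?(ltW d0)// lerDl ler01.
have c1 : acint (fun u => 'D_1 (ramp (s + e k) (e k)) u * m u) 0 1 @[k --> \oo] --> m s.
  apply: (avg (fun k => s + e k)).
  - by rewrite s0 (ltW (lt_le_trans st t1)).
  - by move=> k; rewrite addr_ge0// ltW.
  - by move=> k; have := e4 k; have := e0 k; lra.
  - by move=> k; have := e0 k => h; rewrite (addrC s) addrK gtr0_norm//; lra.
have c2 : acint (fun u => 'D_1 (ramp (t - 2 * e k) (e k)) u * m u) 0 1 @[k --> \oo] --> m t.
  apply: (avg (fun k => t - 2 * e k)).
  - by rewrite t1 (ltW (le_lt_trans s0 st)).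
  - by move=> k; have := e4 k; have := e0 k; lra.
  - by move=> k; have := e4 k; have := e0 k; lra.
  - by move=> k; have := e0 k => h; rewrite addrAC subrr add0r normrN ger0_norm//; lra.
(* Since [|eta k| <= 1], dominated convergence applies with dominating function [|G|]. *)
have c3 : acint (fun u => eta k u * G u) 0 1 @[k --> \oo] --> acint G s t.
  have [||||_] := @Rint_dct _ _ R mu `[0, 1] (fun k u => eta k u * G u)
     (fun u => \1_(`]s, t[ : set R) u * G u) (fun u => `|G u|) (measurable_itv _).
  - by move=> k; apply/measurable_EFinP; exact: (measurable_int _ (ieG k)).
  - move=> u _; apply: cvgMr_tmp; rewrite indicE.
    have [ust|ust] := boolP (u \in (`]s, t[%classic : set R)).
      move: ust; rewrite inE/= in_itv/= => /andP[su ut].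
      apply: cvg_near_cst; near=> k.
      have h1 : e k < (u - s) / 2 by near: k; apply: (cvgr_lt 0) => //; rewrite divr_gt0 ?subr_gt0.
      have h2 : e k < (t - u) / 2 by near: k; apply: (cvgr_lt 0) => //; rewrite divr_gt0 ?subr_gt0.
      by rewrite /eta ramp_ge1 ?ramp_le0 ?subr0//; lra.
    rewrite (_ : (fun k => _) = fun=> 0); first exact: cvg_cst.
    apply/funext => k; apply: eta0; apply: contra ust => /andP[a b].
    by rewrite inE/= in_itv/=; have := e0 k; lra.
  - exact: int01_norm.
  - by move=> k u _; rewrite normrM ler_piMl.
  rewrite (_ : \int[mu]_(x in _) _ = acint G s t)//.
  have Gst : mu.-integrable `[s, t] (EFin \o G) by apply: int01S.
  rewrite /acint -Rintegral_itv_bndo_bndc; last first.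
    by apply: integrableS Gst => //; apply: subset_itvl; rewrite bnd_simp.
  rewrite -Rintegral_itv_obnd_cbnd; last first.
    by apply: integrableS Gst => //; apply: subset_itvW.
  have Iset : `[0, 1]%classic `&` `]s, t[%classic = `]s, t[%classic :> set R.
    apply/setIidr => u; rewrite /= !in_itv/= => /andP[su ut].
    by rewrite (ltW (le_lt_trans s0 su)) (ltW (lt_le_trans ut t1)).
  transitivity (\int[mu]_(u in `[0, 1]%classic `&` `]s, t[%classic) G u); last by rewrite Iset.
  rewrite Rintegral_mkcondr; apply: eq_Rintegral => u _.
  by rewrite patchE indicE; case: ifPn => _; rewrite ?mul1r ?mul0r.
have : (acint (fun u => 'D_1 (ramp (s + e k) (e k)) u * m u) 0 1
    - acint (fun u => 'D_1 (ramp (t - 2 * e k) (e k)) u * m u) 0 1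
    + acint (fun u => eta k u * G u) 0 1) @[k --> \oo] --> m s - m t + acint G s t.
  by apply: cvgD c3; exact: cvgB.
under eq_fun do rewrite split.
move=> h; have := cvg_unique _ (cvg_cst (0 : R)) h => E.
have : 0 = m s - m t + acint G s t by exact: E.
lra.
Unshelve. all: by end_near.
Qed.

End weak_derivative.

(** * Testing the continuity equation *)

Lemma int01_le (R : realType) (f g : R -> R) :
  measurable_fun setT (f : measurableTypeR R -> R) ->
  (forall t, 0 <= t <= 1 -> `|f t| <= g t) -> int01 g -> int01 f.
Proof.
move=> mf fg ig; rewrite /int01; apply: (le_integrable _ _ _ ig).
- exact: measurable01.
- by apply: measurable_funTS; exact/measurable_EFinP.
- by move=> t; rewrite /= in_itv/= => t01; rewrite lee_fin (le_trans (fg t t01))// ler_norm.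
Qed.

Section compact_boxes.
Context (R : realType) (n : nat).

Definition box (r : R) : set 'cV[R]_n := [set x | forall i, - r <= x i 0 <= r].

Lemma compact_box r : compact (box r).
Proof.
have K := @rV_compact R n (fun=> `[- r, r]%classic) (fun=> @segment_compact _ _ _).
have -> : box r = trmx @` [set v : 'rV[R]_n | forall i, `[- r, r]%classic (v ord0 i)].
  apply/seteqP; split=> [x xr|_ [y yr <-] i /=].
    exists x^T; last by rewrite trmxK.
    by move=> i /=; rewrite mxE in_itv/= xr.
  by rewrite mxE; have := yr i; rewrite /= in_itv.
apply: continuous_compact K; apply: continuous_subspaceT => y.
apply: (@cvg_mx_coord _ _ _ (nbhs_filter y)) => i j.
rewrite mxE (_ : (fun x : 'rV[R]_n => _) = (fun x : 'rV[R]_n => x j i)); last first.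
  by apply/funext => x; rewrite mxE.
exact: coord_continuous.
Qed.

Lemma bounded_box_support (f : R * 'cV[R]_n -> R) (a b r : R) : continuous f ->
  (forall t x, a <= t <= b -> ~ box r x -> f (t, x) = 0) ->
  exists2 C, 0 <= C & forall t x, a <= t <= b -> `|f (t, x)| <= C.
Proof.
move=> cf f0.
have cK : compact (`[a, b]%classic `*` box r).
  by apply: compact_setX; [exact: segment_compact|exact: compact_box].
have cfK : compact (f @` (`[a, b]%classic `*` box r)).
  by apply: continuous_compact => //; exact: continuous_subspaceT.
have [M [_ hM]] := compact_bounded cfK.
exists (`|M| + 1); first by rewrite addr_ge0.
move=> t x tab; have [Kx|nKx] := pselect (box r x); last by rewrite f0// normr0 addr_ge0.
apply: (hM (`|M| + 1)); first by rewrite (le_lt_trans (ler_norm _))// ltrDl.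
by exists (t, x) => //; split => //=; rewrite in_itv.
Qed.

Lemma derive_box_support (f : R * 'cV[R]_n -> R) (a b r : R) (w : R * 'cV[R]_n) :
  (forall t x, a < t < b -> ~ box r x -> f (t, x) = 0) ->
  forall t x, a < t < b -> ~ box r x -> 'D_w f (t, x) = 0.
Proof.
move=> f0 t x tab nx.
have nz : \forall z \near (t, x), f z = 0.
  exists (`]a, b[%classic, ~` box r) => /=; last by move=> [s y] /= [sab ny]; apply: f0.
  split; first by apply: open_nbhs_nbhs; split; [exact: interval_open|rewrite /= in_itv].
  apply: open_nbhs_nbhs; split => //; apply: closed_openC.
  by apply: compact_closed; [exact: norm_hausdorff|exact: compact_box].
have H := @near_eq_is_derive R _ R (cst 0) f (t, x) w 0.
have [] := H _ (is_derive_cst _ _ _); last by [].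
by apply: filterS nz => z ->.
Qed.

End compact_boxes.

Section sqnorm.
Context (R : realType) (n : nat).

Lemma sqnorm2E (x : 'cV[R]_n) : sqnorm2 x = \sum_i x i 0 ^+ 2.
Proof. by rewrite /sqnorm2 mxE; apply: eq_bigr => i _; rewrite mxE expr2. Qed.

Lemma sqnorm2_ge0 (x : 'cV[R]_n) : 0 <= sqnorm2 x.
Proof. by rewrite sqnorm2E sumr_ge0// => i _; exact: sqr_ge0. Qed.

Lemma sqr_coord_le (x : 'cV[R]_n) i : x i 0 ^+ 2 <= sqnorm2 x.
Proof. by rewrite sqnorm2E (bigD1 i)//= lerDl sumr_ge0// => j _; exact: sqr_ge0. Qed.

Lemma norm_coord_le (x : 'cV[R]_n) i : `|x i 0| <= 1 + sqnorm2 x.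
Proof.
apply: (le_trans _ (lerD (lexx 1) (sqr_coord_le x i))).
have [h|h] := leP `|x i 0| 1; first by rewrite (le_trans h)// lerDl sqr_ge0.
rewrite (@le_trans _ _ (x i 0 ^+ 2))// ?lerDr//.
by rewrite -real_normK ?num_real// expr2 ler_peMl// ltW.
Qed.

Lemma continuous_sqnorm2 : continuous (@sqnorm2 R n).
Proof.
rewrite (_ : @sqnorm2 R n = fun x => \sum_i x i 0 ^+ 2); last by apply/funext => x; rewrite sqnorm2E.
apply: cts_sum => i; apply: (@cts_comp _ _ (fun x => x ^+ 2)); first exact: exprn_continuous.
by move=> x; exact: coord_continuous.
Qed.

Lemma measurable_sqnorm2 : measurable_fun setT (@sqnorm2 R n).
Proof. by apply: continuous_measurable_mx; exact: continuous_sqnorm2. Qed.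

End sqnorm.

(** * Evolution of the mean of a test function *)

Section transport_of_test_functions.
Context (R : realType) (n : nat) (p : R -> 'cV[R]_n -> R) (v : R * 'cV[R]_n -> 'cV[R]_n).
Hypothesis hp : forall t, is_density (p t).
Hypothesis np : forall f : 'cV[R]_n -> R, continuous f -> (exists M, forall x, `|f x| <= M) ->
  continuous (fun t => fine (expect (p t) f)).
Hypothesis mv : measurable_fun setT v.
Hypothesis vi : forall t, itgb (law (hp t)) (fun x => sqnorm2 (v (t, x))).
Hypothesis Ei : int01 (fun t => \int[law (hp t)]_x sqnorm2 (v (t, x))).
Hypothesis CE : continuity_equation p (fun t x => v (t, x)).
Local Notation mu := (@lebesgue_measure R).
Local Notation T := (measurableTypeR R).

Lemma measurable_snd_section d (T2 : measurableType d) (g : T * T2 -> R) (t : R) :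
  measurable_fun setT g -> measurable_fun setT (fun x => g (t, x)).
Proof. by move=> mg; exact: (measurableT_comp mg (pair1_measurable t)). Qed.

Lemma continuous_snd_section (g : R * 'cV[R]_n -> R) (t : R) : continuous g ->
  continuous (fun x => g (t, x)).
Proof.
move=> cg x; apply: (@continuous_comp _ _ _ (fun x => (t, x)) g); last exact: cg.
by apply: (@cvg_pair _ _ _ (nbhs x) (nbhs t) (nbhs x)); [exact: cvg_cst|exact: cvg_id].
Qed.

Lemma measurable_v_coord i : measurable_fun setT (fun z : T * 'cV[R]_n => v z i 0).
Proof. exact: (measurableT_comp (measurable_coord i) mv). Qed.

Variables (phi : R * 'cV[R]_n -> R) (r : R).
Hypothesis sphi : smooth phi.
(** Compactness is asked in space only; the cutoff in time is supplied when the equation is tested.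
    The time interval exceeds [[0, 1]] so that [phi] and its derivatives are bounded on [[-1, 2]],
    where intermediate times of the mean value theorem may fall. *)
Hypothesis phi0 : forall t x, -2 < t < 3 -> ~ box r x -> phi (t, x) = 0.

Let D1 := 'D_((1, 0) : R * 'cV[R]_n) phi.
Let Dx i := 'D_((0, delta_mx i 0) : R * 'cV[R]_n) phi.
Let g (z : R * 'cV[R]_n) := D1 z + \sum_i v z i 0 * Dx i z.

Let gE z : 'D_(1, 0) phi z + 'D_(0, v z) phi z = g z.
Proof. by rewrite derive_cV. Qed.

Let cD w : continuous ('D_w phi).
Proof. by apply: smooth_continuous; exact: smooth_derive. Qed.

Let bound (f : R * 'cV[R]_n -> R) : continuous f -> (forall t x, -2 < t < 3 -> ~ box r x -> f (t, x) = 0) ->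
  exists2 C, 0 <= C & forall t x, -1 <= t <= 2 -> `|f (t, x)| <= C.
Proof.
by move=> cf f0; apply: (bounded_box_support cf) => t x /andP[t1 t2]; apply: f0; lra.
Qed.

Let boundD w : exists2 C, 0 <= C & forall t x, -1 <= t <= 2 -> `|'D_w phi (t, x)| <= C.
Proof. exact: (bound (@cD w) (@derive_box_support R n phi (-2) 3 r w phi0)). Qed.

Let mg : measurable_fun setT (g : T * 'cV[R]_n -> R).
Proof.
apply: measurable_funD; first by apply: continuous_measurable_prod; exact: cD.
apply: measurable_sum => i; apply: measurable_funM; first exact: measurable_v_coord.
by apply: continuous_measurable_prod; exact: cD.
Qed.

Let g_bound : exists2 C, 0 <= C & forall t x, -1 <= t <= 2 ->
  `|g (t, x)| <= C * (1 + sqnorm2 (v (t, x))).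
Proof.
have [C1 C10 hC1] := boundD (1, 0).
have /choice[C hC] : forall i, exists C, 0 <= C /\ forall t x, -1 <= t <= 2 -> `|Dx i (t, x)| <= C.
  by move=> i; have [C C0 H] := boundD (0, delta_mx i 0); exists C.
exists (C1 + \sum_i C i); first by rewrite addr_ge0// sumr_ge0// => i _; case: (hC i).
move=> t x t01; rewrite mulrDl; apply: (le_trans (ler_normD _ _)); apply: lerD.
  apply: (le_trans (hC1 t x t01)); rewrite ler_peMr// lerDl; exact: sqnorm2_ge0.
apply: (le_trans (ler_norm_sum _ _ _)); rewrite mulr_suml; apply: ler_sum => i _.
rewrite normrM mulrC; apply: ler_pM => //; last exact: norm_coord_le.
by have [_] := hC i; apply.
Qed.

Let itgb_g t : -1 <= t <= 2 -> itgb (law (hp t)) (fun x => g (t, x)).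
Proof.
move=> t01; have [C C0 hC] := g_bound.
apply: (@itgb_le _ _ _ _ _ (fun x => C * (1 + sqnorm2 (v (t, x))))).
- exact: measurable_snd_section mg.
- by move=> x; exact: hC.
- apply: itgbZ; apply: itgbD; last exact: vi.
  exact: (finite_measure_integrable_cst (law (hp t))).
Qed.

Let m t : R := \int[law (hp t)]_x phi (t, x).
Let G t : R := \int[law (hp t)]_x g (t, x).

Let int01_G : int01 G.
Proof.
have [C C0 hC] := g_bound.
have i1 : int01 (fun t => C * (1 + \int[law (hp t)]_x sqnorm2 (v (t, x)))).
  by apply: int01Z; apply: int01D => //; apply: cts_int01; exact: cts_cst.
apply: (int01_le _ _ i1); first exact: (measurable_Rint_law hp np mg).
move=> t t01.
have t12 : -1 <= t <= 2 by lra.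
have i2 : itgb (law (hp t)) (fun x => 1 + sqnorm2 (v (t, x))).
  by apply: itgbD; [exact: (finite_measure_integrable_cst (law (hp t)))|exact: vi].
have i4 := vi t.
have i3 : itgb (law (hp t)) (fun=> 1) by exact: (finite_measure_integrable_cst (law (hp t))).
rewrite -[X in C * (X + _)](Rint_cst (law (hp t))).
rewrite -RintD//.
rewrite -RintZ//; apply: norm_Rint; [exact: itgb_g|exact: itgbZ|].
by move=> x; exact: hC.
Qed.

Let itgb_phi t s : -1 <= s <= 2 -> itgb (law (hp t)) (fun x => phi (s, x)).
Proof.
move=> s01; have [C C0 hC] := bound (smooth_continuous sphi) phi0.
apply: (itgb_bounded (law (hp t)) (M := C)); last by move=> x; exact: hC.
apply: continuous_measurable_mx; apply: continuous_snd_section; exact: smooth_continuous.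
Qed.

(** Time enters twice. For [phi (t, .)] frozen, the change of law is controlled by narrow
    continuity; the change of [phi] itself is Lipschitz in time, uniformly in [x]. *)
Let cts_m : cts01 m.
Proof.
have [C C0 hC] := boundD (1, 0).
have [C' C'0 hC'] := bound (smooth_continuous sphi) phi0.
apply/cts01P => t t01; have t12 : -1 <= t <= 2 by lra.
have cphi : continuous (fun x => phi (t, x)) by apply: continuous_snd_section; exact: smooth_continuous.
have mphi : measurable_fun setT (fun x => phi (t, x)) by exact: continuous_measurable_mx.
have cm : continuous (fun u => \int[law (hp u)]_x phi (t, x) : R).
  have := np cphi (ex_intro _ C' (fun x => hC' t x t12)).
  by under eq_fun do rewrite expect_law//.
have lip u : 0 <= u <= 1 ->
    `|m u - \int[law (hp u)]_x phi (t, x)| <= C * `|u - t|.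
  move=> u01; have u12 : -1 <= u <= 2 by lra.
  rewrite -mulN1r -RintZ; last exact: itgb_phi.
  rewrite -RintD; [|exact: itgb_phi|apply: itgbZ; exact: itgb_phi].
  rewrite -[leRHS](Rint_cst (law (hp u))); apply: norm_Rint.
  - by apply: itgbD; [exact: itgb_phi|apply: itgbZ; exact: itgb_phi].
  - exact: (finite_measure_integrable_cst (law (hp u))).
  - move=> x; rewrite mulN1r.
    have [w wu E] := mean_value_line (t, x) (u - t) (fun y => @smooth_derivable _ _ phi y (1, 0) sphi).
    have E1 (k : R) : k *: (1, 0) + (t, x) = (k + t, x) :> R * 'cV[R]_n.
      by apply/eqP; rewrite -pair_eqE /= scaler0 add0r eqxx andbT [_%:A]mulr1.
    move: E; rewrite !E1 subrK => ->; rewrite normrM mulrC.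
    apply: ler_wpM2r => //; apply: hC.
    move: wu; rewrite ler_norml; have : `|u - t| <= 1 by rewrite ler_norml; lra.
    lra.
apply/cvgrPdist_le => e e0.
have cmt : \int[law (hp u)]_x phi (t, x) @[u --> within `[0, 1]%classic (nbhs t)] --> m t.
  by apply: cvg_within_filter; exact: cm.
have ct : (u - t) @[u --> within `[0, 1]%classic (nbhs t)] --> (0 : R).
  have h : u - t @[u --> t] --> t - t by apply: cvgB; [exact: cvg_id|exact: cvg_cst].
  by apply: cvg_within_filter; rewrite subrr in h.
have e20 : 0 < e / 2 by rewrite divr_gt0.
have eC0 : 0 < e / 2 / (C + 1) by rewrite divr_gt0// ltr_wpDl.
have /cvgrPdist_le/(_ _ e20) cmt' := cmt.
have /cvgrPdist_le/(_ _ eC0) ct' := ct.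
near=> u.
have u01 : 0 <= u <= 1.
  have : u \in `[0, 1] by near: u; exact: withinT.
  by rewrite in_itv.
have h1 : `|m t - \int[law (hp u)]_x phi (t, x)| <= e / 2.
  near: u; exact: cmt'.
have h2 : `|0 - (u - t)| <= e / 2 / (C + 1).
  by near: u; exact: ct'.
rewrite sub0r normrN in h2.
have h3 := lip u u01.
have h4 : C * `|u - t| <= e / 2.
  apply: (@le_trans _ _ ((C + 1) * `|u - t|)); first by rewrite ler_wpM2r// lerDl.
  by rewrite mulrC -ler_pdivlMr// ltr_wpDl.
have -> : m t - m u = (m t - \int[law (hp u)]_x phi (t, x)) - (m u - \int[law (hp u)]_x phi (t, x)) by ring.
by apply: (le_trans (ler_normB _ _)); lra.
Unshelve. all: by end_near.
Qed.

(** Multiplying [phi] by a function [eta] of time with compact support in []0, 1[] gives a genuine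
    test function, and the continuity equation becomes the weak derivative identity required by
    [weak_ac]. *)
Lemma ac_test : ac (fun t => \int[law (hp t)]_x phi (t, x) : R)
  (fun t => \int[law (hp t)]_x ('D_(1, 0) phi (t, x) + 'D_(0, v (t, x)) phi (t, x)) : R).
Proof.
have -> : (fun t => \int[law (hp t)]_x ('D_(1, 0) phi (t, x) + 'D_(0, v (t, x)) phi (t, x)) : R) = G.
  by apply/funext => t; apply: eq_Rintegral => x _; exact: gE.
apply: weak_ac => // eta seta [a [b [a0 b1 eta0]]].
pose psi (z : R * 'cV[R]_n) := eta z.1 * phi z.
have sfst : smooth (fun z : R * 'cV[R]_n => z.1).
  by apply: smooth_linear => // z; exact: cvg_fst.
have spsi : smooth psi.
  apply: sm_is_smooth; apply: sm_M; last exact: sm_smooth.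
  by apply: (sm_comp seta); exact: sm_smooth.
have deta (z w : R * 'cV[R]_n) : is_derive z w (fun z => eta z.1) ('D_1 eta z.1 * w.1).
  apply: (@is_derive_comp_line R _ eta ('D_1 eta) (fun z : R * 'cV[R]_n => z.1)).
    by apply: derivableP; exact: smooth_derivable.
  apply/is_derive_line; rewrite /=.
  by apply: is_derive_eq; rewrite /GRing.scale/=; ring.
have dpsi (z w : R * 'cV[R]_n) : 'D_w psi z = eta z.1 * 'D_w phi z + phi z * ('D_1 eta z.1 * w.1).
  have dphi : is_derive z w phi ('D_w phi z) by apply: derivableP; exact: smooth_derivable.
  by have [_ ->] := is_deriveM (deta z w) dphi.
have tpsi : test_function psi.
  pose S : set (R * 'cV[R]_n) := `[a, b]%classic `*` box r.
  have cS : compact S by apply: compact_setX; [exact: segment_compact|exact: compact_box].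
  have psiS : closure [set z | psi z != 0] `<=` S.
    have clS : closed S by apply: compact_closed => //; exact: norm_hausdorff.
    rewrite (closure_id S).1//; apply: closureS => -[t x] /= psi0.
    have tab : a <= t <= b.
      by apply: contraNT psi0 => /eta0 h; rewrite /psi/= h mul0r.
    split; first by rewrite /= in_itv.
    apply: contrapT => nx; move: psi0; rewrite /psi/= phi0 ?mulr0 ?eqxx//.
    by move: tab; lra.
  split=> //; first by apply: subclosed_compact psiS => //; exact: closed_closure.
  by move=> [t x] /psiS[/= + _]; rewrite !in_itv/= => /andP[ta tb]; split=> //=; rewrite ?in_itv/=; lra.
rewrite -[RHS](CE tpsi); apply: eq_Rintegral => t; rewrite inE/= in_itv/= => t01.
have t12 : -1 <= t <= 2 by lra.
transitivity (\int[law (hp t)]_x ('D_(1, 0) psi (t, x) + 'D_(0, v (t, x)) psi (t, x)) : R).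
  have i1 := itgb_phi t t12; have i2 := itgb_g t12.
  rewrite /m /G -(RintZ _ i1) -(RintZ _ i2) -RintD; [|exact: itgbZ|exact: itgbZ].
  apply: eq_Rintegral => x _; rewrite !dpsi -gE /=; ring.
rewrite /Rintegral; congr fine; rewrite -expect_law//.
have -> : (fun x => 'D_(1, 0) psi (t, x) + 'D_(0, v (t, x)) psi (t, x)) =
    (fun x => eta t * g (t, x) + phi (t, x) * 'D_1 eta t).
  by apply/funext => x; rewrite !dpsi -gE /=; ring.
apply: measurable_funD.
  by apply: measurable_funM => //; exact: measurable_snd_section mg.
apply: measurable_funM => //.
by apply: continuous_measurable_mx; apply: continuous_snd_section; exact: smooth_continuous.
Qed.

End transport_of_test_functions.

(** * Evolution of the second moments *)

(** The integrated form of absolute continuity passes to the limit, pointwise on increments and by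
    dominated convergence on integrals. *)
Lemma ac_limit (R : realType) (f G : R -> R) (f_ G_ : nat -> R -> R) (h : R -> R) :
  (forall k, ac (f_ k) (G_ k)) -> int01 h ->
  (forall k t, 0 <= t <= 1 -> `|G_ k t| <= h t) ->
  (forall t, 0 <= t <= 1 -> f_ k t @[k --> \oo] --> f t) ->
  (forall t, 0 <= t <= 1 -> G_ k t @[k --> \oo] --> G t) -> ac f G.
Proof.
move=> acG ih Gh ff GG.
have D s t : 0 <= s -> t <= 1 -> (@lebesgue_measure R).-integrable `[s, t] (EFin \o G) /\
    acint (G_ k) s t @[k --> \oo] --> acint G s t.
  move=> s0 t1.
  have sub u : `[s, t]%classic u -> 0 <= u <= 1.
    by rewrite /= in_itv/= => /andP[su ut]; rewrite (le_trans s0 su) (le_trans ut t1).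
  have H := @Rint_dct _ _ R (@lebesgue_measure R) `[s, t] G_ G h (measurable_itv _).
  apply: H.
  - move=> k; have [ig _] := acG k; apply/measurable_EFinP.
    exact: (measurable_int _ (int01S s0 t1 ig)).
  - by move=> u /sub; exact: GG.
  - exact: int01S.
  - by move=> k u /sub; exact: Gh.
split; first by have [] := D 0 1 (lexx _) (lexx _).
move=> s t s0 st t1; have [_ cv] := D s t s0 t1.
have s1 : 0 <= s <= 1 by rewrite s0 (le_trans st).
have t01 : 0 <= t <= 1 by rewrite t1 (le_trans s0).
have cf : f_ k t - f_ k s @[k --> \oo] --> f t - f s.
  by apply: cvgB; exact: ff.
apply: (cvg_unique (@norm_hausdorff _ _) cf); apply: cvg_trans cv; apply: near_eq_cvg; near=> k.
by have [_ ->] := acG k.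
Unshelve. all: by end_near.
Qed.

(** * Cutoffs and truncated squares *)

Section cutoff.
Variable R : realType.

Definition cutoff (u : R) : R := 1 - step (u - 1).

Lemma smooth_cutoff : smooth cutoff.
Proof.
apply: sm_is_smooth.
rewrite (_ : cutoff = fun u => 1 + (-1) * step (u + -1)); last by apply/funext => u; rewrite mulN1r.
apply: sm_D; first by apply: sm_smooth; exact: smooth_cst.
apply: sm_M; first by apply: sm_smooth; exact: smooth_cst.
apply: (@sm_comp _ _ (@step R)); first exact: smooth_step.
by apply: sm_D; apply: sm_smooth; [exact: smooth_id|exact: smooth_cst].
Qed.

Lemma cutoff_itv u : 0 <= cutoff u <= 1.
Proof. by have := step_itv (u - 1); rewrite /cutoff; lra. Qed.

Lemma cutoff1 u : u <= 1 -> cutoff u = 1.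
Proof. by move=> u1; rewrite /cutoff step_le0 ?subr0// subr_le0. Qed.

Lemma cutoff0 u : 2 <= u -> cutoff u = 0.
Proof. by move=> u2; rewrite /cutoff step_ge1 ?subrr//; lra. Qed.

Lemma derive_cutoff u : 'D_1 cutoff u = - 'D_1 (@step R) (u - 1).
Proof.
have d1 : is_derive u 1 (fun u : R => u - 1) 1 by apply: is_derive_eq; rewrite subr0.
have d2 : is_derive u 1 (fun u : R => step (u - 1)) ('D_1 (@step R) (u - 1) * 1).
  apply: (@is_derive_comp_line R R (@step R) ('D_1 (@step R)) (fun u : R => u - 1)) => //.
  by apply: derivableP; apply: smooth_derivable; exact: smooth_step.
have d3 : is_derive u 1 cutoff (0 - 'D_1 (@step R) (u - 1) * 1).
  exact: (is_deriveB (is_derive_cst _ _ _) d2).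
by have [_ ->] := d3; rewrite mulr1 sub0r.
Qed.

Lemma derive_cutoff0 u : ~~ (1 < u < 2) -> 'D_1 cutoff u = 0.
Proof.
move=> u12; rewrite derive_cutoff derive_step0 ?oppr0//; apply: contra u12 => /andP[u0 u1].
by lra.
Qed.

Lemma derive_cutoff_bound : exists2 C : R, 0 <= C & forall u, `|'D_1 cutoff u| <= C.
Proof.
have [C C0 hC] := derive_step_bound R; exists C => // u.
by rewrite derive_cutoff normrN.
Qed.

Definition truncid (u : R) : R := u * (cutoff u * cutoff u).

Lemma smooth_truncid : smooth truncid.
Proof.
apply: sm_is_smooth; apply: sm_M; first by apply: sm_smooth; exact: smooth_id.
by apply: sm_M; apply: sm_smooth; exact: smooth_cutoff.
Qed.

(* The square in [truncid] makes [truncid' ^ 2 <= C truncid / u], so that the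
   truncated second moment satisfies a closed differential inequality. *)
Lemma derive_truncid_sqr : exists2 C : R, 0 < C &
  forall u, 0 <= u -> u * 'D_1 truncid u ^+ 2 <= C * truncid u.
Proof.
(* The derivative is [cutoff u * (cutoff u + 2 * u * cutoff' u)]. Where [cutoff u] is nonzero one
   has [u < 2], so the second factor is at most [1 + 4 * C] in absolute value. *)
have [C C0 hC] := derive_cutoff_bound; exists ((1 + 4 * C) ^+ 2).
  by rewrite exprn_gt0// ltr_wpDr// mulr_ge0.
move=> u u0; have dc : is_derive u 1 cutoff ('D_1 cutoff u).
  by apply: derivableP; apply: smooth_derivable; exact: smooth_cutoff.
have d1 : is_derive u 1 (fun u : R => u * (cutoff u * cutoff u))
   (cutoff u * (cutoff u + 2 * u * 'D_1 cutoff u)).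
  by apply: is_derive_eq; rewrite /GRing.scale/=; ring.
have -> : 'D_1 truncid u = cutoff u * (cutoff u + 2 * u * 'D_1 cutoff u) by have [] := d1.
have [u2|u2] := leP 2 u.
  by rewrite /truncid cutoff0// !mul0r expr0n/= !mulr0.
rewrite /truncid; have /andP[c0 c1] := cutoff_itv u.
have h : `|cutoff u + 2 * u * 'D_1 cutoff u| <= 1 + 4 * C.
  apply: (le_trans (ler_normD _ _)); apply: lerD; first by rewrite ger0_norm.
  rewrite !normrM (ger0_norm u0) gtr0_norm//.
  apply: ler_pM => //; [exact: mulr_ge0|lra].
have h2 : (cutoff u + 2 * u * 'D_1 cutoff u) ^+ 2 <= (1 + 4 * C) ^+ 2.
  by rewrite -real_normK ?num_real// lerXn2r// ?nnegrE ?addr_ge0 ?mulr_ge0.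
have -> (X : R) : u * (cutoff u * X) ^+ 2 = u * (cutoff u * cutoff u) * X ^+ 2 by ring.
by rewrite [leRHS]mulrC ler_wpM2l// !mulr_ge0.
Qed.

End cutoff.

Section radial_functions.
Context (R : realType) (n : nat).
Implicit Types (z w : R * 'cV[R]_n).

Lemma smooth_coord i : smooth (fun z : R * 'cV[R]_n => z.2 i 0).
Proof.
apply: smooth_linear => [z|k x v]; last by rewrite /= !mxE.
apply: (@continuous_comp _ _ _ snd (fun x : 'cV[R]_n => x i 0)); first exact: cvg_snd.
exact: coord_continuous.
Qed.

Lemma is_derive_coord i z w : is_derive z w (fun z : R * 'cV[R]_n => z.2 i 0) (w.2 i 0).
Proof.
apply/is_derive_line; rewrite /=.
rewrite (_ : (fun h => _) = (fun h : R => h * w.2 i 0 + z.2 i 0)); last first.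
  by apply/funext => h; rewrite !mxE.
by apply: is_derive_eq; rewrite /GRing.scale/=; ring.
Qed.

Variable (k : nat).
Let K2 : R := k.+1%:R ^+ 2.

Definition radius2 z : R := sqnorm2 z.2 / K2.

Lemma radius2E : radius2 = fun z => \sum_i K2^-1 * (z.2 i 0 * z.2 i 0).
Proof.
apply/funext => z; rewrite /radius2 sqnorm2E mulrC mulr_sumr.
by apply: eq_bigr => i _; rewrite expr2.
Qed.

Lemma radius2_ge0 z : 0 <= radius2 z.
Proof. by rewrite divr_ge0 ?sqnorm2_ge0// exprn_ge0. Qed.

Lemma sm_sum (V : normedModType R) (I : Type) (r : seq I) (F : I -> V -> R) :
  (forall i, sm (F i)) -> sm (fun x => \sum_(i <- r) F i x).
Proof.
move=> sF; elim: r => [|i r IH].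
  rewrite (_ : (fun x => _) = fun=> 0); first by apply: sm_smooth; exact: smooth_cst.
  by apply/funext => x; rewrite big_nil.
rewrite (_ : (fun x => _) = fun x => F i x + \sum_(j <- r) F j x); first exact: sm_D.
by apply/funext => x; rewrite big_cons.
Qed.

Lemma smooth_radius2 : smooth radius2.
Proof.
rewrite radius2E; apply: sm_is_smooth; apply: sm_sum => i.
apply: sm_M; first by apply: sm_smooth; exact: smooth_cst.
by apply: sm_M; apply: sm_smooth; exact: smooth_coord.
Qed.

Lemma is_derive_radius2 z w :
  is_derive z w radius2 (2 * (\sum_i z.2 i 0 * w.2 i 0) / K2).
Proof.
have -> : 2 * (\sum_i z.2 i 0 * w.2 i 0) / K2 = \sum_(i < n) K2^-1 * (z.2 i 0 * w.2 i 0 + z.2 i 0 * w.2 i 0).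
  by rewrite -mulrA mulr_suml mulr_sumr; apply: eq_bigr => i _; ring.
have -> : radius2 = \sum_(i < n) (fun z : R * 'cV[R]_n => K2^-1 * (z.2 i 0 * z.2 i 0)).
  by rewrite radius2E; apply/funext => y; rewrite fct_sumE.
apply: is_derive_sum => i; have d1 := is_derive_coord i z w.
have d2 := is_deriveM d1 d1.
have d3 := is_deriveZ K2^-1 d2.
by apply: is_derive_eq.
Qed.

Lemma is_derive_radial (H : R -> R) z w : smooth H ->
  is_derive z w (fun z => H (radius2 z)) ('D_1 H (radius2 z) * (2 * (\sum_i z.2 i 0 * w.2 i 0) / K2)).
Proof.
move=> sH; apply: (@is_derive_comp_line R _ H ('D_1 H)); last exact: is_derive_radius2.
by apply: derivableP; exact: smooth_derivable.
Qed.

Lemma radius2_box z : ~ box (2 * k.+1%:R) z.2 -> 2 <= radius2 z.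
Proof.
move=> nb; apply: contrapT => /negP; rewrite -ltNge => h; apply: nb => i.
have K0 : 0 < k.+1%:R :> R by rewrite ltr0n.
rewrite -ler_norml -(ler_pXn2r (ltn0Sn 1)) ?nnegrE ?mulr_ge0// real_normK ?num_real//.
apply: (le_trans (sqr_coord_le _ _)); rewrite /radius2 ltr_pdivrMr ?exprn_gt0// in h.
by apply: (le_trans (ltW h)); rewrite exprMn ler_wpM2r ?exprn_ge0// expr2; lra.
Qed.

End radial_functions.

Lemma near_inftyS_gt (R : realType) (r : R) : \forall k \near \oo, r < k.+1%:R.
Proof.
near=> k; apply: (@lt_le_trans _ _ k%:R); last by rewrite ler_nat.
by near: k; exact: nbhs_infty_gtr.
Unshelve. all: by end_near.
Qed.

Section second_moments.
Context (R : realType) (n : nat) (p : R -> 'cV[R]_n -> R) (v : R * 'cV[R]_n -> 'cV[R]_n).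
Hypothesis hp : forall t, is_density (p t).
Hypothesis np : forall f : 'cV[R]_n -> R, continuous f -> (exists M, forall x, `|f x| <= M) ->
  continuous (fun t => fine (expect (p t) f)).
Hypothesis mv : measurable_fun setT v.
Hypothesis vi : forall t, itgb (law (hp t)) (fun x => sqnorm2 (v (t, x))).
Hypothesis Ei : int01 (fun t => \int[law (hp t)]_x sqnorm2 (v (t, x))).
Hypothesis CE : continuity_equation p (fun t x => v (t, x)).
Hypothesis xi : forall t, itgb (law (hp t)) (@sqnorm2 R n).
Local Notation T := (measurableTypeR R).

Let dot (x y : 'cV[R]_n) : R := \sum_i x i 0 * y i 0.

Let measurable_vi t i : measurable_fun setT (fun x => v (t, x) i 0).
Proof. exact: measurable_snd_section (measurable_v_coord mv i). Qed.

Let measurable_dot t : measurable_fun setT (fun x => dot x (v (t, x))).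
Proof.
by apply: measurable_sum => i; apply: measurable_funM; [exact: measurable_coord|exact: measurable_vi].
Qed.

Lemma mul_coord_le (x y : 'cV[R]_n) i j : `|x i 0 * y j 0| <= sqnorm2 x + sqnorm2 y.
Proof.
rewrite normrM; apply: le_trans (lerD (sqr_coord_le x i) (sqr_coord_le y j)).
rewrite -[X in _ <= X + _]real_normK ?num_real// -[X in _ <= _ + X]real_normK ?num_real//.
by have := sqr_ge0 (`|x i 0| - `|y j 0|); have := normr_ge0 (x i 0); have := normr_ge0 (y j 0); nra.
Qed.

Let dot_le (x y : 'cV[R]_n) : `|dot x y| <= sqnorm2 x + sqnorm2 y.
Proof.
apply: (le_trans (ler_norm_sum _ _ _)); rewrite !sqnorm2E -big_split/=; apply: ler_sum => i _.
rewrite normrM -[X in _ <= X + _]real_normK ?num_real// -[X in _ <= _ + X]real_normK ?num_real//.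
by have := sqr_ge0 (`|x i 0| - `|y i 0|); have := normr_ge0 (x i 0); have := normr_ge0 (y i 0); nra.
Qed.

Let e t : R := \int[law (hp t)]_x sqnorm2 (v (t, x)).
Let s t : R := \int[law (hp t)]_x sqnorm2 x.

(** A truncation of the squared norm: at most [sqnorm2], equal to it on the ball of radius [k.+1],
    and of bounded support in space. *)
Let phi k (z : R * 'cV[R]_n) : R := k.+1%:R ^+ 2 * truncid (radius2 k z).

Let K2_gt0 k : 0 < k.+1%:R ^+ 2 :> R. Proof. by rewrite exprn_gt0. Qed.

Let phi_ge0 k z : 0 <= phi k z.
Proof.
have := cutoff_itv (radius2 k z) => /andP[c0 _].
apply: mulr_ge0; first exact: ltW.
by apply: mulr_ge0; [exact: radius2_ge0|exact: mulr_ge0].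
Qed.

Let phi_le k z : phi k z <= sqnorm2 z.2.
Proof.
rewrite /phi /truncid mulrA -[leRHS]mulr1.
have -> : k.+1%:R ^+ 2 * radius2 k z = sqnorm2 z.2 by rewrite /radius2 mulrC divfK// gt_eqF.
have /andP[c0 c1] := cutoff_itv (radius2 k z).
by rewrite ler_wpM2l ?sqnorm2_ge0// mulr_ile1.
Qed.

Let smooth_phi k : smooth (phi k).
Proof.
apply: sm_is_smooth; apply: sm_M; first by apply: sm_smooth; exact: smooth_cst.
by apply: (sm_comp (@smooth_truncid R)); apply: sm_smooth; exact: smooth_radius2.
Qed.

Let phi0 k t x : -2 < t < 3 -> ~ box (2 * k.+1%:R) x -> phi k (t, x) = 0.
Proof.
move=> _ nx; rewrite /phi /truncid cutoff0 ?mulr0//.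
exact: (@radius2_box _ _ k (t, x)).
Qed.

Let derive_phi k z w : 'D_w (phi k) z = 2 * 'D_1 (@truncid R) (radius2 k z) * dot z.2 w.2.
Proof.
have d1 := is_deriveZ (k.+1%:R ^+ 2) (is_derive_radial k z w (@smooth_truncid R)).
have [_ ->] := d1; rewrite /GRing.scale/= /dot; field; by rewrite gt_eqF.
Qed.

Let sk k t : R := \int[law (hp t)]_x phi k (t, x).
Let Gk k t : R := \int[law (hp t)]_x ('D_(1, 0) (phi k) (t, x) + 'D_(0, v (t, x)) (phi k) (t, x)).

Let ac_sk k : ac (sk k) (Gk k).
Proof. have H := ac_test np mv vi Ei CE (@smooth_phi k) (@phi0 k).
exact: H. Qed.

Let integrandE k t x :
  'D_(1, 0) (phi k) (t, x) + 'D_(0, v (t, x)) (phi k) (t, x) =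
  2 * 'D_1 (@truncid R) (radius2 k (t, x)) * dot x (v (t, x)).
Proof.
rewrite !derive_phi /= [X in _ * X + _](_ : _ = 0) ?mulr0 ?add0r//.
by apply: big1 => i _; rewrite mxE mulr0.
Qed.

Let measurable_phi k t : measurable_fun setT (fun x => phi k (t, x)).
Proof.
by apply: continuous_measurable_mx; apply: continuous_snd_section; exact: smooth_continuous.
Qed.

Let measurable_radial (H : R -> R) (k : nat) (t : R) : continuous H -> measurable_fun setT (fun x : 'cV[R]_n => H (radius2 k (t, x))).
Proof.
move=> cH; apply: continuous_measurable_mx.
apply: (@continuous_snd_section R n (fun z => H (radius2 k z))).
by apply: cts_comp => //; apply: smooth_continuous; exact: smooth_radius2.
Qed.

Let itgb_phi k t : itgb (law (hp t)) (fun x => phi k (t, x)).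
Proof.
by apply: (itgb_le _ _ (xi t)) => // x; rewrite ger0_norm//; exact: (phi_le k (t, x)).
Qed.

(** A closed differential inequality whose constants do not depend on the truncation: the growth of
    the truncated moment is controlled by that same moment and the kinetic energy. *)
Let rate_bound : exists2 C : R, 0 < C & forall k t, Gk k t <= sk k t / 2 + C * e t.
Proof.
have [C C0 hC] := derive_truncid_sqr R; exists (2 * C); first exact: mulr_gt0.
move=> k t; rewrite /Gk /sk /e; pose q (x : 'cV[R]_n) := radius2 k (t, x).
have key x : `|2 * 'D_1 (@truncid R) (q x) * dot x (v (t, x))| <=
    2^-1 * phi k (t, x) + 2 * C * sqnorm2 (v (t, x)).
  pose D : R := 'D_1 (@truncid R) (q x); rewrite -/D; have hD : D ^+ 2 * sqnorm2 x <= C * phi k (t, x).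
    have := hC (q x) (radius2_ge0 k (t, x)).
    rewrite -(ler_pM2l (K2_gt0 k)) mulrA [_ * (C * _)]mulrCA -/(phi k (t, x)).
    rewrite {1}/q {1}/radius2 (mulrC (_ ^+ 2) (_ / _)) divfK ?gt_eqF//=.
    by rewrite [sqnorm2 x * _]mulrC.
  (* Young's inequality, coordinate by coordinate, with weight [2 * C]: after [hD] the first term is
     then at most half of [phi k]. *)
  have h1 : `|2 * D * dot x (v (t, x))| <= D ^+ 2 * sqnorm2 x / (2 * C) + 2 * C * sqnorm2 (v (t, x)).
    rewrite normrM; apply: (@le_trans _ _ (`|2 * D| * \sum_i `|x i 0| * `|v (t, x) i 0|)).
      rewrite ler_wpM2l// (le_trans (ler_norm_sum _ _ _))//; apply: ler_sum => i _.
      by rewrite normrM.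
    rewrite !sqnorm2E !mulr_sumr mulr_suml -big_split/=; apply: ler_sum => i _.
    rewrite normrM gtr0_norm// -[D ^+ 2]real_normK ?num_real//.
    rewrite -[x i 0 ^+ 2]real_normK ?num_real// -[v _ i 0 ^+ 2]real_normK ?num_real//.
    move: (`|D|) (`|x i 0|) (`|v (t, x) i 0|) => a b c.
    have -> : a ^+ 2 * b ^+ 2 / (2 * C) + 2 * C * c ^+ 2 =
      2 * a * (b * c) + (2 * C)^-1 * (a * b - 2 * C * c) ^+ 2.
      by field; rewrite gt_eqF.
    by rewrite lerDl mulr_ge0 ?sqr_ge0// invr_ge0 mulr_ge0 ?ltW.
  apply: (le_trans h1); rewrite lerD2r.
  rewrite ler_pdivrMr ?mulr_gt0//; apply: (le_trans hD).
  by rewrite le_eqVlt; apply/orP; left; apply/eqP; field.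
have i1 : itgb (law (hp t)) (fun x => 2^-1 * phi k (t, x)) by exact: itgbZ.
have i2 : itgb (law (hp t)) (fun x => 2 * C * sqnorm2 (v (t, x))) by exact: itgbZ.
have i3 := itgbD i1 i2.
rewrite (eq_Rintegral _ (fun x _ => integrandE k t x)).
have m1 : measurable_fun setT (fun x => 2 * 'D_1 (@truncid R) (q x) * dot x (v (t, x))).
  apply: measurable_funM; last exact: measurable_dot.
  apply: measurable_funM => //; apply: (@measurable_radial ('D_1 (@truncid R))).
  by apply: smooth_continuous; apply: smooth_derive; exact: smooth_truncid.
apply: (le_trans (le_Rint (itgb_le m1 key i3) i3 _)).
  by move=> x; apply: le_trans (key x); exact: ler_norm.
by rewrite (RintD i1 i2) (RintZ _ (itgb_phi k t)) (RintZ _ (vi t)) mulrC.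
Qed.

(** Finite second moments at each time give no uniform bound, yet one is needed to dominate in
    [ac_second_moment]. The bound is proved for the truncations, independently of [k], and passes to
    the limit. *)
Lemma second_moment_bounded : exists B, forall t, 0 <= t <= 1 -> s t <= B.
Proof.
have [C C0 hC] := rate_bound.
have e_ge0 u : 0 <= e u by apply: Rint_ge0 => x; exact: sqnorm2_ge0.
pose I := acint e 0 1; have I0 : 0 <= I by exact: acint_ge0.
exists (2 * s 0 + 2 * C * I) => t t01.
have skB k : sk k t <= 2 * s 0 + 2 * C * I.
  have [ig acG] := ac_sk k; have csk := ac_cts01 (ac_sk k).
  (* At the maximum over time the term [sk / 2] of the rate contributes at most half the maximum,
     which is absorbed on the left; this replaces a Gronwall argument and produces the factor
     [2]. *)
  have [t' t'01 tmax] := EVT_max ler01 csk.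
  rewrite in_itv/= in t'01; have /andP[t'0 t'1] := t'01.
  apply: (le_trans (tmax t _)); first by rewrite in_itv.
  have s0 : sk k 0 <= s 0 by apply: le_Rint => // x; exact: (phi_le k (0, x)).
  have := acG 0 t' (lexx _) t'0 t'1.
  have ih : int01 (fun u => sk k t' / 2 + C * e u).
    by apply: int01D; [apply: cts_int01; exact: cts_cst|exact: int01Z].
  have h : acint (Gk k) 0 t' <= acint (fun u => sk k t' / 2 + C * e u) 0 t'.
    apply: le_acint => // u /andP[u0 ut]; apply: (le_trans (hC k u)).
    rewrite lerD2r ler_pM2r ?invr_gt0//; apply: tmax; rewrite in_itv/=.
    by rewrite u0 (le_trans ut t'1).
  have skt : 0 <= sk k t' by apply: Rint_ge0.
  have h2 : acint (fun u => sk k t' / 2 + C * e u) 0 t' <= sk k t' / 2 + C * I.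
    rewrite acintD//; [|by apply: cts_int01; exact: cts_cst|exact: int01Z].
    rewrite acint_cst// subr0 acintZ//; apply: lerD; first by rewrite ler_piMr// divr_ge0.
    rewrite ler_wpM2l ?(ltW C0)// /I -(acint_chasles Ei (lexx 0) t'0 t'1 (lexx 1)).
    by rewrite lerDl; exact: acint_ge0.
  by move=> E; rewrite -E in h; lra.
have cv : sk k t @[k --> \oo] --> s t.
  have [||||_] := @Rint_dct _ _ R (law (hp t)) setT (fun k x => phi k (t, x)) (@sqnorm2 R n) (@sqnorm2 R n) measurableT.
  - by move=> k; exact: measurable_phi.
  - move=> x _; apply: cvg_near_cst; near=> k.
    rewrite /phi /truncid cutoff1 ?mulr1 /radius2 /=; last first.
      rewrite ler_pdivrMr// mul1r (@le_trans _ _ k.+1%:R)//; last first.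
        by rewrite expr2 ler_peMl// ler1n.
      by apply: ltW; near: k; exact: near_inftyS_gt.
    by rewrite mulrC divfK// gt_eqF.
  - exact: xi.
  - by move=> k x _; rewrite ger0_norm//; exact: phi_le.
  by [].
apply: (@cvgr_to_le _ _ _ _ _ _ _ cv); exact: nearW.
Unshelve. all: by end_near.
Qed.

Let chi k i j (z : R * 'cV[R]_n) : R := z.2 i 0 * z.2 j 0 * cutoff (radius2 k z).

(** The truncated products [chi k i j] are admissible in [ac_test]; both they and their rates are
    dominated uniformly in [k], so the truncation is removed by [ac_limit]. *)
Lemma ac_second_moment i j : ac (fun t => \int[law (hp t)]_x (x i 0 * x j 0) : R)
  (fun t => \int[law (hp t)]_x (x i 0 * v (t, x) j 0 + x j 0 * v (t, x) i 0) : R).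
Proof.
have [Cs Cs0 hCs] := derive_cutoff_bound R.
have [B hB] := second_moment_bounded.
have schi k : smooth (chi k i j).
  apply: sm_is_smooth; apply: sm_M.
    by apply: sm_M; apply: sm_smooth; exact: smooth_coord.
  by apply: (sm_comp (@smooth_cutoff R)); apply: sm_smooth; exact: smooth_radius2.
have chi0 k t x : -2 < t < 3 -> ~ box (2 * k.+1%:R) x -> chi k i j (t, x) = 0.
  by move=> _ nx; rewrite /chi cutoff0 ?mulr0//; exact: (@radius2_box _ _ k (t, x)).
pose K2 k : R := k.+1%:R ^+ 2.
pose q (k : nat) (t : R) (x : 'cV[R]_n) := radius2 k ((t, x) : R * 'cV[R]_n).
pose g (k : nat) (t : R) (x : 'cV[R]_n) := (x i 0 * v (t, x) j 0 + x j 0 * v (t, x) i 0) * cutoff (q k t x)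
   + x i 0 * x j 0 * ('D_1 (@cutoff R) (q k t x) * (2 * dot x (v (t, x)) / K2 k)).
have dchi k t x : 'D_(1, 0) (chi k i j) (t, x) + 'D_(0, v (t, x)) (chi k i j) (t, x) = g k t x.
  have H w : 'D_w (chi k i j) (t, x) =
      (x i 0 * w.2 j 0 + x j 0 * w.2 i 0) * cutoff (q k t x) +
      x i 0 * x j 0 * ('D_1 (@cutoff R) (q k t x) * (2 * dot x w.2 / K2 k)).
    have d1 : is_derive (t, x) w (fun z : R * 'cV[R]_n => z.2 i 0 * z.2 j 0) _ :=
      is_deriveM (is_derive_coord i (t, x) w) (is_derive_coord j (t, x) w).
    have d2 := is_deriveM d1 (is_derive_radial k (t, x) w (@smooth_cutoff R)).
    have [_ E] := d2; etransitivity; first exact: E.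
    by rewrite /GRing.scale/= /dot /q /K2/=; ring.
  rewrite !H /= !mxE [X in 2 * X / _](_ : _ = 0); last by apply: big1 => l _; rewrite mxE mulr0.
  by rewrite /g; ring.
have sum0 (x y : 'cV[R]_n) : 0 <= sqnorm2 x + sqnorm2 y by rewrite addr_ge0// sqnorm2_ge0.
(* The constant [2] comes from the two products of coordinates. The term with the derivative of the
   cutoff lives where [sqnorm2 x < 2 * K2 k], so the factor [x i 0 * x j 0] cancels the denominator
   [K2 k] and leaves [4 * Cs]. *)
have g_le k t x : `|g k t x| <= (2 + 4 * Cs) * (sqnorm2 x + sqnorm2 (v (t, x))).
  have /andP[c0 c1] := cutoff_itv (q k t x).
  rewrite /g [leRHS]mulrDl; apply: (le_trans (ler_normD _ _)); apply: lerD.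
    rewrite normrM (ger0_norm c0) -[leRHS]mulr1; apply: ler_pM => //.
    apply: (le_trans (ler_normD _ _)); rewrite mulr_natl mulr2n; apply: lerD; exact: mul_coord_le.
  have [q2|q2] := leP 2 (q k t x).
    rewrite derive_cutoff0 ?mul0r ?mulr0 ?normr0; first by rewrite !mulr_ge0.
    by rewrite negb_and -!leNgt q2 orbT.
  have xx : `|x i 0 * x j 0| <= 2 * K2 k.
    apply: (@le_trans _ _ (sqnorm2 x)).
      have h1 := sqr_coord_le x i; have h2 := sqr_coord_le x j.
      rewrite normrM; rewrite -real_normK ?num_real// in h1; rewrite -real_normK ?num_real// in h2.
      by have := sqr_ge0 (`|x i 0| - `|x j 0|); have := normr_ge0 (x i 0); have := normr_ge0 (x j 0); nra.
    by move: q2; rewrite /q /radius2 ltr_pdivrMr// => /ltW.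
  rewrite !normrM normfV (gtr0_norm (K2_gt0 k)) -normrM (gtr0_norm (ltr0Sn R 1)).
  have -> : 4 * Cs * (sqnorm2 x + sqnorm2 (v (t, x))) =
      (2 * K2 k) * (Cs * (2 * (sqnorm2 x + sqnorm2 (v (t, x))) / K2 k)).
    by field; rewrite gt_eqF// K2_gt0.
  have Kge : 0 <= (k.+1%:R ^+ 2)^-1 :> R by rewrite invr_ge0 (ltW (K2_gt0 k)).
  have h1 : 0 <= 2 * `|dot x (v (t, x))| / k.+1%:R ^+ 2 by rewrite !mulr_ge0.
  have h2 := mulr_ge0 (normr_ge0 ('D_1 (@cutoff R) (q k t x))) h1.
  apply: ler_pM => //; apply: ler_pM => //.
  rewrite ler_pM2r ?invr_gt0 ?K2_gt0// ler_pM2l//; exact: dot_le.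
have mg k t : measurable_fun setT (g k t).
  have mx l : measurable_fun setT (fun x : 'cV[R]_n => x l 0) by exact: measurable_coord.
  apply: measurable_funD; apply: measurable_funM.
  - by apply: measurable_funD; apply: measurable_funM => //; exact: measurable_vi.
  - exact: (measurable_radial k t (smooth_continuous (@smooth_cutoff R))).
  - exact: measurable_funM.
  - apply: measurable_funM.
      apply: (@measurable_radial ('D_1 (@cutoff R))).
      by apply: smooth_continuous; apply: smooth_derive; exact: smooth_cutoff.
    by apply: measurable_funM => //; apply: measurable_funM => //; exact: measurable_dot.
have idom t : itgb (law (hp t)) (fun x => (2 + 4 * Cs) * (sqnorm2 x + sqnorm2 (v (t, x)))).
  by apply: itgbZ; exact: itgbD.
have q_cvg (t : R) (x : 'cV[R]_n) : \forall k \near \oo, q k t x < 1.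
  near=> k; rewrite /q /radius2 /= ltr_pdivrMr// mul1r (@lt_le_trans _ _ k.+1%:R)//; last first.
    by rewrite expr2 ler_peMl// ler1n.
  near: k; exact: near_inftyS_gt.
apply: (@ac_limit _ _ _ (fun k t => \int[law (hp t)]_x chi k i j (t, x) : R)
   (fun k t => \int[law (hp t)]_x g k t x : R)
   (fun t => (2 + 4 * Cs) * (B + e t))).
- move=> k; have := ac_test np mv vi Ei CE (schi k) (chi0 k).
  apply: ac_ext => // t _; apply: eq_Rintegral => x _; exact: dchi.
- by apply: int01Z; apply: int01D => //; apply: cts_int01; exact: cts_cst.
- move=> k t t01; have ig := itgb_le (mg k t) (g_le k t) (idom t).
  apply: (le_trans (norm_Rint ig (idom t) (g_le k t))).
  rewrite RintZ; last exact: itgbD.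
  rewrite RintD//; apply: ler_wpM2l; first by rewrite addr_ge0// mulr_ge0.
  by rewrite lerD2r; exact: hB.
- move=> t t01.
  have [||||_] := @Rint_dct _ _ R (law (hp t)) setT (fun k x => chi k i j (t, x))
     (fun x => x i 0 * x j 0) (fun x => sqnorm2 x + sqnorm2 x) measurableT.
  + by move=> k; apply: continuous_measurable_mx; apply: continuous_snd_section; exact: smooth_continuous.
  + move=> x _; apply: cvg_near_cst; have := q_cvg t x; apply: filterS => k qk.
    by rewrite /chi cutoff1 ?mulr1// ltW.
  + exact: itgbD.
  + move=> k x _; have /andP[c0 c1] := cutoff_itv (q k t x).
    rewrite /chi normrM (ger0_norm c0) -[leRHS]mulr1; apply: ler_pM => //; exact: mul_coord_le.
  by [].
- move=> t t01.
  have [||||_] := @Rint_dct _ _ R (law (hp t)) setT (fun k x => g k t x)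
     (fun x => x i 0 * v (t, x) j 0 + x j 0 * v (t, x) i 0)
     (fun x => (2 + 4 * Cs) * (sqnorm2 x + sqnorm2 (v (t, x)))) measurableT.
  + by move=> k; exact: mg.
  + move=> x _; apply: cvg_near_cst; have := q_cvg t x; apply: filterS => k qk.
    rewrite /g cutoff1 ?mulr1 ?ltW// derive_cutoff0 ?mul0r ?mulr0 ?addr0//.
    by rewrite negb_and -!leNgt ltW.
  + exact: idom.
  + by move=> k x _; exact: g_le.
  by [].
Unshelve. all: by end_near.
Qed.

End second_moments.

(** * Nondegeneracy of second moments *)

Section nondegeneracy.
Variable R : realType.

(** Fubini in the first coordinate: if another coefficient is nonzero the slices are hyperplanes of
    smaller dimension, and otherwise every line in the first direction meets the set in one
    point. *)
Lemma leb_hyperplane n (a : 'I_n -> R) (c : R) : (exists i, a i != 0) ->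
  leb n [set x : 'cV[R]_n | \sum_i a i * x i 0 = c] = 0%E.
Proof.
have mH k (b : 'I_k -> R) d : measurable [set x : 'cV[R]_k | \sum_i b i * x i 0 = d].
  have mf : measurable_fun setT (fun x : 'cV[R]_k => \sum_i b i * x i 0).
    by apply: measurable_sum => i; apply: measurable_funM => //; exact: measurable_coord.
  by have := mf measurableT [set d] (measurable_set1 d); rewrite setTI.
elim: n a c => [|n IH] a c [i ai]; first by case: i ai.
set H := [set x | _].
have H0 x : (0 <= (\1_H x : R)%:E)%E by rewrite lee_fin indicE.
have mHf : measurable_fun setT (fun x : 'cV[R]_n.+1 => (\1_H x : R)%:E).
  by apply/measurable_EFinP; apply: measurable_indic; exact: mH.
have -> : leb n.+1 H = (\int[leb n.+1]_x (\1_H x : R)%:E)%E.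
  by rewrite integral_indic ?setIT//; exact: mH.
have HE x (y : 'cV[R]_n) : H (cons_cV (x, y)) <-> a 0 * x + \sum_j a (lift 0 j) * y j 0 = c.
  rewrite /H /= big_ord_recl cons_cV0.
  suff -> : \sum_(j < n) a (lift ord0 j) * cons_cV (x, y) (lift ord0 j) 0 =
    \sum_j a (lift 0 j) * y j 0 by [].
  by apply: eq_bigr => j _; rewrite -(cons_cV_lift x y j).
have [[j aj]|nj] := pselect (exists j, a (lift 0 j) != 0).
  rewrite integral_lebS// integral0_eq// => x _.
  transitivity (\int[leb n]_y (\1_[set y : 'cV[R]_n | (\sum_i (a (lift 0 i)) * y i 0)%R = (c - a 0 * x)%R] y : R)%:E)%E.
    apply: eq_integral => y _; rewrite !indicE; congr ((nat_of_bool _)%:R%:E).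
    apply/idP/idP; rewrite !inE => h.
      by have /= := (HE x y).1 h; move=> <-; rewrite [a 0 * x + _]addrC addrK.
    by apply/HE; rewrite h addrC subrK.
  rewrite integral_indic//; last exact: mH.
  by rewrite setIT; apply: IH; exists j.
have a0 : a 0 != 0.
  move: ai; have [j ->|->//] := unliftP 0 i => aj.
  by case: nj; exists j.
rewrite integral_lebS'// integral0_eq// => y _.
transitivity (\int[@lebesgue_measure R]_x (\1_[set c / a 0] x : R)%:E)%E.
  apply: eq_integral => x _; rewrite !indicE; congr ((nat_of_bool _)%:R%:E).
  have s0 : \sum_j a (lift 0 j) * y j 0 = 0.
    apply: big1 => j _; have [->|aj] := eqVneq (a (lift 0 j)) 0; first by rewrite mul0r.
    by case: nj; exists j.
  apply/idP/idP; rewrite !inE => h.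
    by move/HE: h => /=; rewrite s0 addr0 => <-; rewrite mulrC mulKf.
  by apply/HE; rewrite s0 addr0 h mulrC divfK.
rewrite integral_indic// setIT.
transitivity (lebesgue_measure [set c / a 0]); first by [].
exact: lebesgue_measure_set1.
Qed.

Section second_moment_matrix.
Context (n : nat) (p : 'cV[R]_n -> R) (hp : is_density p).

Lemma measurable_mul_coord (i j : 'I_n) : measurable_fun setT (fun x : 'cV[R]_n => x i 0 * x j 0).
Proof. by apply: measurable_funM; exact: measurable_coord. Qed.

Lemma second_momentE i j : second_moment p i j = \int[law hp]_x (x i 0 * x j 0).
Proof. by rewrite mxE expect_law//; exact: measurable_mul_coord. Qed.

Hypothesis xi : itgb (law hp) (@sqnorm2 R n).

Lemma itgb_mul_coord i j : itgb (law hp) (fun x : 'cV[R]_n => x i 0 * x j 0).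
Proof.
apply: (itgb_le (measurable_mul_coord i j) (fun x => mul_coord_le x x i j)).
exact: itgbD.
Qed.

Lemma second_moment_quadratic (u : 'cV[R]_n) :
  (u^T *m second_moment p *m u) 0 0 = \int[law hp]_x (\sum_i u i 0 * x i 0) ^+ 2.
Proof.
rewrite quadraticE; transitivity (\sum_i \sum_j \int[law hp]_x (u i 0 * u j 0 * (x i 0 * x j 0))).
  apply: eq_bigr => i _; apply: eq_bigr => j _.
  by rewrite (RintZ (u i 0 * u j 0) (itgb_mul_coord i j)) -second_momentE mulrC.
under eq_bigr => i _.
  rewrite -Rint_sum; last by move=> j; apply: itgbZ; exact: itgb_mul_coord.
  over.
rewrite -Rint_sum; last first.
  by move=> i; apply: itgb_sum => j; apply: itgbZ; exact: itgb_mul_coord.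
apply: eq_Rintegral => x _; rewrite expr2 mulr_suml; apply: eq_bigr => i _.
by rewrite mulr_sumr; apply: eq_bigr => j _; ring.
Qed.

(** If the quadratic form vanished at [u], the law would be carried by the hyperplane orthogonal to
    [u], which is Lebesgue-null and therefore null for a law with a density. *)
Lemma posdefmx_second_moment : posdefmx (second_moment p).
Proof.
split.
  by apply/matrixP => i j; rewrite mxE !second_momentE; apply: eq_Rintegral => x _; rewrite mulrC.
move=> u u0; rewrite second_moment_quadratic.
set f := fun x : 'cV[R]_n => (\sum_i u i 0 * x i 0) ^+ 2.
have f0 x : 0 <= f x by exact: sqr_ge0.
rewrite lt_neqAle Rint_ge0// andbT; apply/negP => /eqP/esym f_0.
have mf : measurable_fun setT f.
  apply: measurable_funX; apply: measurable_sum => i.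
  by apply: measurable_funM => //; exact: measurable_coord.
have fi : itgb (law hp) f.
  have -> : f = fun x => \sum_i \sum_j u i 0 * u j 0 * (x i 0 * x j 0).
    apply/funext => x; rewrite /f expr2 mulr_suml; apply: eq_bigr => i _.
    by rewrite mulr_sumr; apply: eq_bigr => j _; ring.
  by apply: itgb_sum => i; apply: itgb_sum => j; apply: itgbZ; exact: itgb_mul_coord.
have : ae_eq (law hp) setT (EFin \o f) (cst 0%E).
  apply/ae_eq_integral_abs => //; first exact/measurable_EFinP.
  under eq_integral do rewrite /= ger0_norm//.
  by rewrite itgb_integral// f_0.
move=> [N [mN N0 sN]].
pose H := [set x : 'cV[R]_n | \sum_i u i 0 * x i 0 = 0].
have mH : measurable H.
  have ms : measurable_fun setT (fun x : 'cV[R]_n => \sum_i u i 0 * x i 0).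
    by apply: measurable_sum => i; apply: measurable_funM => //; exact: measurable_coord.
  by have := ms measurableT [set 0] (measurable_set1 0); rewrite setTI.
have H0 : law hp H = 0%E.
  have [mp p0 _] := hp.
  apply: null_set_integral => //.
    by apply/measurable_EFinP; exact: measurable_funTS.
  apply: leb_hyperplane; apply: contrapT => nu; case/negP: u0; apply/eqP/colP => i.
  by apply: contrapT => /eqP ui; apply: nu; exists i; move: ui; rewrite mxE.
have : (law hp setT <= law hp (N `|` H))%E.
  apply: le_measure; rewrite ?inE//; first exact: measurableU.
  move=> x _; have [Hx|nHx] := pselect (H x); [by right|left; apply: sN => /= h].
  apply: nHx; have /= := h I => -[] /eqP; rewrite sqrf_eq0 => /eqP.
  by [].
rewrite lawT; apply/negP; rewrite -ltNge.
by rewrite measureU0// N0.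
Qed.

End second_moment_matrix.
End nondegeneracy.

(** * Regular representatives of admissible pairs *)

Lemma ae_sub d (T : measurableType d) (R : realType) (m : set T -> \bar R) (P Q : T -> Prop) :
  (forall x, P x -> Q x) -> {ae m, forall x, P x} -> {ae m, forall x, Q x}.
Proof.
move=> PQ [N [mN N0 sN]]; exists N; split=> // x nQ; apply: sN => /= Px.
exact/nQ/PQ.
Qed.

Section regular_representative.
Context (R : realType) (n : nat).
Local Notation mu := (@lebesgue_measure R).
Local Notation T := (measurableTypeR R).

(** The retraction onto [[0, 1]]. Precomposing with it extends a path to all real times, so that
    continuity, measurability and the kernel structure are stated without restriction to a
    subset. *)
Definition clip (t : R) : R := Num.max 0 (Num.min 1 t).

Lemma clip_itv t : 0 <= clip t <= 1.
Proof. by rewrite /clip le_max lexx/= ge_max ler01/= ge_min lexx. Qed.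

Lemma clip_id t : 0 <= t <= 1 -> clip t = t.
Proof. by move=> /andP[t0 t1]; rewrite /clip (min_r t1) (max_r t0). Qed.

Lemma continuous_clip : continuous clip.
Proof.
move=> t; apply: (@continuous_max R R (cst 0) (fun t => Num.min 1 t)); first exact: cvg_cst.
by apply: (@continuous_min R R (cst 1) id); [exact: cvg_cst|exact: cvg_id].
Qed.

Lemma within_comp_clip (f : R -> R) : {within `[0, 1], continuous f} -> continuous (f \o clip).
Proof.
move=> /subspace_continuousP cf t.
have ct : `[0, 1]%classic (clip t) by rewrite /= in_itv/=; exact: clip_itv.
apply: (@cvg_comp _ _ _ clip f _ (within `[0, 1]%classic (nbhs (clip t)))); last exact: cf.
move=> U /= WU; have := continuous_clip WU; rewrite /= => H.
have H' : nbhs t (fun s => clip s \in `[0, 1] -> U (clip s)) by exact: H.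
apply: filterS H' => s /=; apply.
by rewrite /= in_itv/=; exact: clip_itv.
Qed.

Lemma measurable_transport (phi : R * 'cV[R]_n -> R) (w : T * 'cV[R]_n -> 'cV[R]_n) :
  smooth phi -> measurable_fun setT w ->
  measurable_fun setT (fun z : T * 'cV[R]_n => 'D_(1, 0) phi z + 'D_(0, w z) phi z).
Proof.
move=> sphi mw.
have mD u : measurable_fun setT ('D_u phi).
  by apply: continuous_measurable_prod; apply: smooth_continuous; exact: smooth_derive.
rewrite (_ : (fun z => _) = fun z => 'D_(1, 0) phi z + \sum_i w z i 0 * 'D_(0, delta_mx i 0) phi z); last first.
  by apply/funext => z; rewrite derive_cV.
apply: measurable_funD; first exact: mD.
apply: measurable_sum => i; apply: measurable_funM; last exact: mD.
exact: (measurableT_comp (measurable_coord i) mw).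
Qed.

(** Admissibility with its exceptional times removed: the velocity is square integrable at every
    real time, and all measurability holds on the full space. *)
Record regular_path (p : R -> 'cV[R]_n -> R) (v : R * 'cV[R]_n -> 'cV[R]_n)
    (hp : forall t, is_density (p t)) : Prop := RegularPath {
  rp_narrow : forall f : 'cV[R]_n -> R, continuous f -> (exists M, forall x, `|f x| <= M) ->
    continuous (fun t => fine (expect (p t) f));
  rp_measurable : measurable_fun setT v;
  rp_velocity : forall t, itgb (law (hp t)) (fun x => sqnorm2 (v (t, x)));
  rp_energy : int01 (fun t => \int[law (hp t)]_x sqnorm2 (v (t, x)));
  rp_equation : continuity_equation p (fun t x => v (t, x));
  rp_moment : forall t, itgb (law (hp t)) (@sqnorm2 R n) }.

(** The path is extended by [clip], and the velocity is modified at a null set of times only, which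
    affects neither the continuity equation nor the cost. The last clause concerns the original
    velocity; it provides the measurability needed to compare the two costs. *)
Lemma regular_representative (p0 p1 : 'cV[R]_n -> R) p v : admissible p0 p1 p v ->
  exists (v' : R * 'cV[R]_n -> 'cV[R]_n) (hp : forall t, is_density (p (clip t))),
  [/\ regular_path v' hp,
      {ae mu, forall t : R, t \in `[0, 1] -> forall x, v' (t, x) = v t x}
    & forall W : R -> 'M[R]_n, (forall i j, measurable_fun setT (fun t : T => W t i j)) ->
      (forall t x, 0 <= sqnormW (W t) x) ->
      measurable_fun (`[0, 1]%classic : set T)
        (fun t => expect (p t) (fun x => sqnormW (W t) (v t x)))].
Proof.
move=> [[dp mp np] mv Ev CE _].
have hp t : is_density (p (clip t)) by apply: dp; rewrite in_itv/=; exact: clip_itv.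
have hn (f : 'cV[R]_n -> R) : continuous f -> (exists M, forall x, `|f x| <= M) ->
    continuous (fun t => fine (expect (p (clip t)) f)).
  by move=> cf fM; exact: (within_comp_clip (np f cf fM)).
pose vc (z : T * 'cV[R]_n) := v (clip z.1) z.2.
have mvc : measurable_fun setT vc.
  have mD : measurable ((`[0, 1]%classic : set R) `*` [set: 'cV[R]_n]).
    by apply: measurableX => //; exact: measurable_itv.
  have mc : measurable_fun setT (fun z : T * 'cV[R]_n => (clip z.1, z.2)).
    apply/measurable_fun_pairP; split; last exact: measurable_snd.
    apply: (measurableT_comp _ measurable_fst).
    exact: (continuous_measurable_fun continuous_clip).
  apply: (measurable_comp mD _ mv mc).
  by move=> _ [z _ <-]; split=> //=; rewrite in_itv/=; exact: clip_itv.
pose E t := (\int[law (hp t)]_x (sqnorm2 (vc (t, x)))%:E)%E.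
have msq : measurable_fun setT (fun z => sqnorm2 (vc z)).
  by apply: (measurableT_comp (@measurable_sqnorm2 R n)); exact: mvc.
have mE : measurable_fun setT (E : T -> \bar R).
  apply: (@measurable_integral_law R n _ hp hn (fun z => (sqnorm2 (vc z))%:E)).
    by move=> z; rewrite lee_fin; exact: sqnorm2_ge0.
  exact/measurable_EFinP.
have E0 t : (0 <= E t)%E by apply: integral_ge0 => x _; rewrite lee_fin; exact: sqnorm2_ge0.
have msq2 t : measurable_fun setT (fun x => sqnorm2 (vc (t, x))).
  exact: measurable_snd_section msq.
have EE t : 0 <= t <= 1 -> E t = expect (p t) (fun x => sqnorm2 (v t x)).
  move=> t01; rewrite /E -(expect_law (hp t) (msq2 t)).
  by rewrite /vc /= clip_id.
have Efin : (\int[mu]_(t in `[0%R, 1%R]) E t < +oo)%E.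
  rewrite (_ : (\int[mu]_(t in `[0%R, 1%R]) E t)%E = \int[mu]_(t in `[0%R, 1%R]) expect (p t) (fun x => sqnorm2 (v t x)))%E//.
  by apply: eq_integral => t; rewrite inE/= in_itv/=; exact: EE.
have iE : mu.-integrable `[0, 1] E.
  apply/integrableP; split; first exact: measurable_funTS.
  by under eq_integral do rewrite gee0_abs//.
pose b (t : T) : bool := (E t < +oo)%E.
have mb : measurable_fun setT b.
  have mset : measurable [set t : T | (E t < +oo)%E].
    have := mE measurableT _ (measurableC (emeasurable_set1 +oo%E)); rewrite setTI.
    rewrite (_ : E @^-1` (~` [set +oo%E]) = [set t : T | (E t < +oo)%E])//.
    by apply/seteqP; split=> t /=; rewrite ltey => /eqP.
  apply: (measurable_fun_bool true); rewrite setTI.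
  by rewrite (_ : b @^-1` [set true] = [set t : T | (E t < +oo)%E]).
(* At times of infinite kinetic energy, negligible in [[0, 1]], the velocity is replaced by zero. *)
pose v' (z : T * 'cV[R]_n) : 'cV[R]_n := if b z.1 then vc z else 0.
have mv' : measurable_fun setT v'.
  apply: measurable_fun_ifT; [exact: (measurableT_comp mb measurable_fst)|exact: mvc|].
  exact: measurable_cst.
have ae_b : {ae mu, forall t : R, `[0, 1]%classic t -> b t}.
  have := integrable_ae (@measurable01 R) iE; apply: filterS => t h t01.
  by have := h t01; rewrite fin_numE => /andP[_]; rewrite -ltey.
exists v', hp; split; last 2 first.
- apply: ae_sub ae_b => t h t01 x; rewrite /v' /= h; last by rewrite /=; exact: t01.
  by rewrite /vc/= clip_id//; move: t01; rewrite in_itv.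
- move=> W mW W0.
  pose g (z : T * 'cV[R]_n) := sqnormW (W z.1) (vc z).
  have mg : measurable_fun setT g.
    rewrite (_ : g = fun z => \sum_i \sum_j W z.1 i j * (vc z i 0 * vc z j 0)); last first.
      by apply/funext => z; exact: quadraticE.
    have mc i : measurable_fun setT (fun z => vc z i 0).
      exact: (measurableT_comp (measurable_coord i) mvc).
    apply: measurable_sum => i; apply: measurable_sum => j; apply: measurable_funM.
      exact: (measurableT_comp (mW i j) measurable_fst).
    exact: measurable_funM.
  have mI : measurable_fun setT (fun t : T => \int[law (hp t)]_x (g (t, x))%:E)%E.
    apply: (@measurable_integral_law R n _ hp hn (fun z => (g z)%:E)).
      by move=> z; rewrite lee_fin; exact: W0.
    exact/measurable_EFinP.
  apply: (eq_measurable_fun (fun t : T => \int[law (hp t)]_x (g (t, x))%:E)%E).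
    move=> t; rewrite inE/= in_itv/= => t01.
    rewrite -(expect_law (hp t) (measurable_snd_section t mg)).
    by rewrite /g /vc /= clip_id.
  exact: measurable_funTS.
have vi t : itgb (law (hp t)) (fun x => sqnorm2 (v' (t, x))).
  rewrite /v' /=; have [bt|bt] := boolP (b t); last first.
    rewrite (_ : (fun x => _) = fun=> 0); first exact: itgb0.
    by apply/funext => x; rewrite sqnorm2E big1// => i _; rewrite mxE expr0n.
  by apply: itgb_ge0 => // x; exact: sqnorm2_ge0.
have rE t : 0 <= t <= 1 -> b t -> \int[law (hp t)]_x sqnorm2 (v' (t, x)) = fine (E t).
  by move=> t01 bt; rewrite /v' /= bt.
split=> //.
- apply: (int01_le (g := fun t => fine (E t))).
  + apply: (@measurable_Rint_law R n _ hp hn (fun z => sqnorm2 (v' z))).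
    by apply: (measurableT_comp (@measurable_sqnorm2 R n)); exact: mv'.
  + move=> t t01; rewrite ger0_norm; last by apply: Rint_ge0 => x; exact: sqnorm2_ge0.
    have [bt|bt] := boolP (b t); first by rewrite rE.
    rewrite (_ : \int[law (hp t)]_x sqnorm2 (v' (t, x)) = 0) ?fine_ge0//.
    rewrite /Rintegral integral0_eq// => x _; rewrite /v' /= (negbTE bt).
    by rewrite sqnorm2E big1// => i _; rewrite mxE expr0n.
  + apply: (le_integrable (@measurable01 R) _ _ iE).
      by apply: measurable_funTS; apply/measurable_EFinP; exact: (measurableT_comp _ mE).
    by move=> t _ /=; have := E0 t; case: (E t) => [r||]//= _; rewrite leey.
- move=> phi tphi; rewrite -[RHS](CE phi tphi).
  have [sphi _ _] := tphi.
  pose G (w : T * 'cV[R]_n -> 'cV[R]_n) (t : T) : R :=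
    \int[law (hp t)]_x ('D_(1, 0) phi (t, x) + 'D_(0, w (t, x)) phi (t, x)).
  have mg w : measurable_fun setT w -> measurable_fun setT
      (fun z : T * 'cV[R]_n => 'D_(1, 0) phi z + 'D_(0, w z) phi z).
    exact: measurable_transport.
  have mG w : measurable_fun setT w -> measurable_fun setT (G w).
    move=> /mg mw.
    exact: (@measurable_Rint_law R n _ hp hn (fun z => 'D_(1, 0) phi z + 'D_(0, w z) phi z)).
  have GE w t : measurable_fun setT w -> 
      \int[leb n]_x (('D_(1, 0) phi (t, x) + 'D_(0, w (t, x)) phi (t, x)) * p (clip t) x) = G w t.
    move=> /mg mw; rewrite /G /Rintegral -expect_law//.
    exact: (measurable_snd_section t mw).
  transitivity (\int[mu]_(t in `[0, 1]) G v' t).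
    by apply: eq_Rintegral => t _; rewrite -GE.
  transitivity (\int[mu]_(t in `[0, 1]) G vc t); last first.
    apply: eq_Rintegral => t; rewrite inE/= in_itv/= => t01.
    by rewrite -GE// /vc/= clip_id.
  have mGD w : measurable_fun setT w -> measurable_fun (`[0, 1]%classic : set T) (EFin \o G w).
    by move=> mw; apply: measurable_funTS; apply/measurable_EFinP; exact: mG.
  have H : (\int[mu]_(t in `[0%R, 1%R]) (EFin \o G v') t = \int[mu]_(t in `[0%R, 1%R]) (EFin \o G vc) t)%E.
    apply: (@ae_eq_integral _ _ _ mu (`[0, 1]%classic : set T) (EFin \o G vc) (EFin \o G v') (@measurable01 R) (mGD v' mv') (mGD vc mvc)).
    by apply: ae_sub ae_b => t bt t01; rewrite /G /v' /= bt.
  by rewrite /Rintegral [in LHS]H.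
- move=> t; apply: itgb_ge0; first exact: measurable_sqnorm2.
    exact: sqnorm2_ge0.
  rewrite -expect_law; last exact: measurable_sqnorm2.
  by apply: mp; rewrite in_itv/=; exact: clip_itv.
Qed.

End regular_representative.

(** * Lower bound of the energy *)

Lemma measurable_inverse (R : realType) : measurable_fun setT (fun x : R => x^-1).
Proof.
(* The base [x ^+ 2] of the power is nonnegative, and at [x = 0] both sides are [0] by the
   convention on inverses. *)
rewrite (_ : (fun x => _) = fun x : R => x * (x ^+ 2) `^ (-1)); last first.
  apply/funext => x; rewrite powR_inv1 ?sqr_ge0//.
  have [->|x0] := eqVneq x 0; first by rewrite invr0 mul0r.
  by rewrite expr2 invfM mulrA divff// mul1r.
apply: measurable_funM => //; apply: (measurableT_comp (measurable_powR _)).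
exact: measurable_funX.
Qed.

Section measurable_inverse.
Context d (T : measurableType d) (R : realType).

Lemma measurable_det k (M : T -> 'M[R]_k) : (forall i j, measurable_fun setT (fun t => M t i j)) ->
  measurable_fun setT (fun t => \det (M t)).
Proof.
move=> mM; apply: measurable_sum => s; apply: measurable_funM; first exact: measurable_cst.
by apply: measurable_prod => i _; exact: mM.
Qed.

Lemma measurable_invmx k (M : T -> 'M[R]_k) : (forall t, M t \in unitmx) ->
  (forall i j, measurable_fun setT (fun t => M t i j)) ->
  forall i j, measurable_fun setT (fun t => invmx (M t) i j).
Proof.
move=> Mu mM i j.
rewrite (_ : (fun t => _) = fun t => (\det (M t))^-1 * ((-1) ^+ (j + i) * \det (row' j (col' i (M t))))); last first.
  by apply/funext => t; rewrite /invmx Mu !mxE.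
have mdet := measurable_det mM.
apply: measurable_funM.
  exact: (measurableT_comp (@measurable_inverse R) mdet).
apply: measurable_funM; first exact: measurable_cst.
apply: measurable_det => a b; under eq_fun do rewrite !mxE.
exact: mM.
Qed.

End measurable_inverse.

Section bilinear_means.
Context d (T : measurableType d) (R : realType) (mu : {measure set T -> \bar R}) (n : nat).
Variables X Y : T -> 'cV[R]_n.
Hypothesis XY : forall a b, itgb mu (fun w => X w a 0 * Y w b 0).

Lemma congr_entry (U M U' : 'M[R]_n) i j :
  (U *m M *m U'^T) i j = \sum_a \sum_b (U i a * U' j b) * M a b.
Proof.
rewrite mxE exchange_big; apply: eq_bigr => b _; rewrite !mxE mulr_suml.
by apply: eq_bigr => a _; ring.
Qed.

Let expand (U U' : 'M[R]_n) i j w : (U *m X w) i 0 * (U' *m Y w) j 0 =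
  \sum_a \sum_b (U i a * U' j b) * (X w a 0 * Y w b 0).
Proof.
rewrite !mxE mulr_suml; apply: eq_bigr => a _; rewrite mulr_sumr.
by apply: eq_bigr => b _; ring.
Qed.

Lemma itgb_bilinear (U U' : 'M[R]_n) i j : itgb mu (fun w => (U *m X w) i 0 * (U' *m Y w) j 0).
Proof.
rewrite (_ : (fun w => _) = fun w => \sum_a \sum_b (U i a * U' j b) * (X w a 0 * Y w b 0)); last first.
  by apply/funext => w; exact: expand.
by apply: itgb_sum => a; apply: itgb_sum => b; exact: itgbZ.
Qed.

Lemma Rint_bilinear (U U' : 'M[R]_n) i j :
  \int[mu]_w ((U *m X w) i 0 * (U' *m Y w) j 0) =
  (U *m (\matrix_(a, b) \int[mu]_w (X w a 0 * Y w b 0)) *m U'^T) i j.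
Proof.
under eq_Rintegral do rewrite expand.
rewrite Rint_sum; last by move=> a; apply: itgb_sum => b; exact: itgbZ.
rewrite congr_entry; apply: eq_bigr => a _.
rewrite Rint_sum; last by move=> b; exact: itgbZ.
by apply: eq_bigr => b _; rewrite RintZ// mxE.
Qed.

End bilinear_means.

Lemma ac_sum (R : realType) (I : Type) (r : seq I) (f g : I -> R -> R) :
  (forall i, ac (f i) (g i)) -> ac (fun t => \sum_(i <- r) f i t) (fun t => \sum_(i <- r) g i t).
Proof.
move=> fg; elim: r => [|i r IH].
  apply: (ac_ext _ _ (@ac_cst R 0)) => t _; by rewrite big_nil.
by apply: (ac_ext _ _ (acD (fg i) IH)) => t _; rewrite big_cons.
Qed.

Section energy.
Context (R : realType) (n : nat) (p : R -> 'cV[R]_n -> R) (v : R * 'cV[R]_n -> 'cV[R]_n).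
Context (hp : forall t, is_density (p t)) (rp : regular_path v hp).
Context (K : 'M[R]_n) (l : 'rV[R]_n).
Hypothesis Ku : K \in unitmx.
Hypothesis P0 : second_moment (p 0) = K *m K^T.
Hypothesis P1 : second_moment (p 1) = K *m diag_mx (map_mx expR l) *m K^T.
Local Notation mu := (@lebesgue_measure R).
Local Notation T := (measurableTypeR R).

Let A := invmx K.
Let P t := second_moment (p t).
Let Q t : 'M[R]_n := \matrix_(a, b) \int[law (hp t)]_x (x a 0 * v (t, x) b 0).
Let mv := rp_measurable rp.
Let vi := rp_velocity rp.
Let xi := rp_moment rp.

Let mvc t i : measurable_fun setT (fun x => v (t, x) i 0).
Proof. exact: (measurable_snd_section t (measurable_v_coord mv i)). Qed.

Let ixx t i j : itgb (law (hp t)) (fun x : 'cV[R]_n => x i 0 * x j 0).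
Proof. exact: itgb_mul_coord. Qed.

Let ixv t i j : itgb (law (hp t)) (fun x => x i 0 * v (t, x) j 0).
Proof.
apply: (itgb_le _ (fun x => mul_coord_le x (v (t, x)) i j)); last exact: itgbD.
by apply: measurable_funM => //; exact: measurable_coord.
Qed.

Let ivv t i j : itgb (law (hp t)) (fun x => v (t, x) i 0 * v (t, x) j 0).
Proof.
apply: (itgb_le _ (fun x => mul_coord_le (v (t, x)) (v (t, x)) i j)); last exact: itgbD.
exact: measurable_funM.
Qed.

Let PE t : P t = \matrix_(a, b) \int[law (hp t)]_x (x a 0 * x b 0).
Proof. by apply/matrixP => a b; rewrite [RHS]mxE; exact: second_momentE. Qed.

Let posP t : posdefmx (P t). Proof. exact: posdefmx_second_moment. Qed.

Let ac_P i j : ac (fun t => P t i j) (fun t => Q t i j + Q t j i).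
Proof.
have := ac_second_moment (rp_narrow rp) mv vi (rp_energy rp) (rp_equation rp) xi i j.
apply: ac_ext => t _; first by rewrite PE mxE.
rewrite RintD; [by rewrite !mxE|exact: ixv|exact: ixv].
Qed.

Definition energy_rate t : R := \int[law (hp t)]_x sqnormW (invmx (second_moment (p t))) (v (t, x)).

(** The index [i0] selects the order of elimination, hence how the energy splits into [D] and [g];
    the energy itself does not depend on it. The equality case can therefore be read for each [i0]
    from its own splitting. *)
Lemma energy_decomposition (i0 : 'I_n) : exists D g : R -> R,
  [/\ forall t, 0 <= D t, int01 g, acint g 0 1 = \sum_i l 0 i ^+ 2,
      forall t, 0 <= t <= 1 -> 4 * energy_rate t = D t + g t
    & forall t, 0 <= t <= 1 -> D t = 0 ->
      {ae law (hp t), forall x, (invmx K *m v (t, x)) i0 0 = l 0 i0 / 2 * (invmx K *m x) i0 0}].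
Proof.
pose Pn t := A *m P t *m A^T; pose B t := A *m Q t *m A^T.
have Au : A \in unitmx by rewrite unitmx_inv.
have AK : A *m K = 1%:M by rewrite mulVmx.
have KA : K^T *m A^T = 1%:M by rewrite -trmx_mul AK trmx1.
have [V [VPV ig Ig V0]] : exists V : R -> 'M[R]_n,
  [/\ forall t, 0 <= t <= 1 -> V t *m Pn t *m (V t)^T = 1%:M,
      int01 (fun t => \sum_i l 0 i * (2 * (V t *m B t *m (V t)^T) i i)),
      acint (fun t => \sum_i l 0 i * (2 * (V t *m B t *m (V t)^T) i i)) 0 1 = \sum_i l 0 i ^+ 2
    & forall t (j : 'I_n), 0 <= t <= 1 ->
        V t i0 j = (i0 == j)%:R / Num.sqrt (Pn t i0 i0)].
  apply: calibration_at.
  - by move=> t _; exact: posdefmx_congr.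
  - move=> i j; apply: (ac_ext _ _ (ac_sum (index_enum _) (fun a => ac_sum (index_enum _) (fun b => acZ (A i a * A j b) (ac_P a b))))) => t _.
      by rewrite congr_entry.
    rewrite [B t i j]congr_entry [B t j i]congr_entry [X in _ + X]exchange_big -big_split/=.
    apply: eq_bigr => a _; rewrite -big_split; apply: eq_bigr => b _ /=; ring.
  - by rewrite /Pn /P P0 !mulmxA AK mul1mx KA.
  - by rewrite /Pn /P P1 !mulmxA AK mul1mx -mulmxA KA mulmx1.
pose U t := V t *m A.
have UPU t : 0 <= t <= 1 -> U t *m P t *m (U t)^T = 1%:M.
  by move=> t01; rewrite -(VPV t t01) /U /Pn trmx_mul !mulmxA.
have UQU t : U t *m Q t *m (U t)^T = V t *m B t *m (V t)^T.
  by rewrite /U /B trmx_mul !mulmxA.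
pose om t x i := (U t *m v (t, x)) i 0.
pose ze t (x : 'cV[R]_n) i := (U t *m x) i 0.
pose D t := \sum_i \int[law (hp t)]_x (2 * om t x i - l 0 i * ze t x i) ^+ 2.
pose G t := \sum_i l 0 i * (2 * (V t *m B t *m (V t)^T) i i).
have iomom t i : itgb (law (hp t)) (fun x => om t x i * om t x i) by exact: itgb_bilinear (ivv t) _ _ _ _.
have izeom t i : itgb (law (hp t)) (fun x => ze t x i * om t x i) by exact: itgb_bilinear (ixv t) _ _ _ _.
have izeze t i : itgb (law (hp t)) (fun x => ze t x i * ze t x i) by exact: itgb_bilinear (ixx t) _ _ _ _.
have sqE t i x : (2 * om t x i - l 0 i * ze t x i) ^+ 2 =
    4 * (om t x i * om t x i) + ((- 4 * l 0 i) * (ze t x i * om t x i) + l 0 i ^+ 2 * (ze t x i * ze t x i)).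
  by ring.
have isq t i : itgb (law (hp t)) (fun x => (2 * om t x i - l 0 i * ze t x i) ^+ 2).
  rewrite (_ : (fun x => _) = fun x => 4 * (om t x i * om t x i) +
     ((- 4 * l 0 i) * (ze t x i * om t x i) + l 0 i ^+ 2 * (ze t x i * ze t x i))); last first.
    by apply/funext => x; exact: sqE.
  by apply: itgbD; [exact: itgbZ|apply: itgbD; exact: itgbZ].
(* Expanding the squares with [E[ze^2] = 1] gives this remainder; as [G] integrates to the sum of
   the [l 0 i ^+ 2], so does the remainder. *)
exists D, (fun t => 2 * G t + - \sum_i l 0 i ^+ 2); split.
- by move=> t; apply: sumr_ge0 => i _; apply: Rint_ge0 => x; exact: sqr_ge0.
- by apply: int01D; [exact: int01Z|apply: cts_int01; exact: cts_cst].
- rewrite acintD//; [|exact: int01Z|by apply: cts_int01; exact: cts_cst].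
  by rewrite acintZ// acint_cst// Ig; ring.
- move=> t t01.
  have Uu : U t \in unitmx by have := UPU t t01; rewrite -mulmxA => /mulmx1_unit[].
  have Pinv : invmx (P t) = (U t)^T *m U t.
    have h : (U t)^T *m U t *m P t = 1%:M.
      by have := mulmx1C (UPU t t01); rewrite mulmxA.
    have Pu : P t \in unitmx by exact: posdefmx_unit.
    by rewrite -[RHS](mulmxK Pu) h mul1mx.
  have -> : energy_rate t = \sum_i \int[law (hp t)]_x (om t x i * om t x i).
    rewrite -Rint_sum//; apply: eq_Rintegral => x _.
    rewrite /sqnormW -/(P t) Pinv mulmxA -trmx_mul -mulmxA mxE.
    by apply: eq_bigr => i _; rewrite mxE.
  have zeze i : \int[law (hp t)]_x (ze t x i * ze t x i) = 1 :> R.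
    by rewrite (Rint_bilinear (ixx t)) -PE UPU// mxE eqxx.
  have zeom i : \int[law (hp t)]_x (ze t x i * om t x i) = (V t *m B t *m (V t)^T) i i.
    by rewrite (Rint_bilinear (ixv t)) -/(Q t) UQU.
  have -> : D t = \sum_i (4 * \int[law (hp t)]_x (om t x i * om t x i) +
      (- 4 * l 0 i * (V t *m B t *m (V t)^T) i i + l 0 i ^+ 2)).
    apply: eq_bigr => i _.
    under eq_Rintegral do rewrite sqE.
    rewrite RintD; [|exact: itgbZ|by apply: itgbD; exact: itgbZ].
    rewrite RintD; [|exact: itgbZ|exact: itgbZ].
    by rewrite (RintZ 4 (iomom t i)) (RintZ _ (izeom t i)) (RintZ _ (izeze t i)) zeze zeom mulr1.
  rewrite mulr_sumr addrA /G mulr_sumr -big_split/= -sumrB; apply: eq_bigr => i _; ring.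
- move=> t t01 /eqP; rewrite psumr_eq0; last by move=> i _; apply: Rint_ge0 => x; exact: sqr_ge0.
  move=> /allP/(_ i0); rewrite mem_index_enum => /(_ isT)/eqP Z.
  have mf : measurable_fun setT (fun x => (2 * om t x i0 - l 0 i0 * ze t x i0) ^+ 2).
    exact: itgb_measurable (isq t i0).
  have : ae_eq (law (hp t)) setT (EFin \o (fun x => (2 * om t x i0 - l 0 i0 * ze t x i0) ^+ 2)) (cst 0%E).
    apply/ae_eq_integral_abs => //; first exact/measurable_EFinP.
    under eq_integral do rewrite /= ger0_norm ?sqr_ge0//.
    by rewrite itgb_integral// Z.
  apply: ae_sub => x /(_ I) /= [] /eqP; rewrite sqrf_eq0 subr_eq0 => /eqP.
  (* Row [i0] of [U t] is row [i0] of [A] up to a positive scalar depending on [t], which cancels in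
     the equality for position and velocity. *)
  have rowU (y : 'cV[R]_n) : (U t *m y) i0 0 = (A *m y) i0 0 / Num.sqrt (Pn t i0 i0).
    rewrite /U -mulmxA mxE (bigD1 i0)//= big1 ?addr0 => [|j ji].
      by rewrite V0// eqxx mulrC mul1r.
    by rewrite V0// eq_sym (negbTE ji) !mul0r.
  rewrite /om /ze !rowU => E.
  have Pi0 : 0 < Pn t i0 i0.
    have [_ pos] := posdefmx_congr (posP t) Au.
    have := pos (delta_mx i0 0); rewrite trmx_delta -rowE -colE !mxE; apply.
    by apply/eqP => /matrixP/(_ i0 0); rewrite !mxE !eqxx => /eqP; rewrite oner_eq0.
  have s0 : Num.sqrt (Pn t i0 i0) != 0 by rewrite gt_eqF// sqrtr_gt0.
  apply: (@mulfI _ (2 / Num.sqrt (Pn t i0 i0))); first by rewrite mulf_neq0// invr_eq0.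
  by rewrite mulrAC -mulrA E; field.
Qed.

End energy.

Lemma sqnormW_invmx_ge0 (R : realType) n (P : 'M[R]_n) (x : 'cV[R]_n) : posdefmx P ->
  0 <= sqnormW (invmx P) x.
Proof.
move=> pP; have Pu := posdefmx_unit pP; have [symP pos] := pP.
have -> : sqnormW (invmx P) x = ((invmx P *m x)^T *m P *m (invmx P *m x)) 0 0.
  by rewrite /sqnormW trmx_mul trmx_inv symP !mulmxA mulmxKV.
have [->|y0] := eqVneq (invmx P *m x) 0; first by rewrite mulmx0 mxE.
by apply/ltW/pos.
Qed.

Lemma ae_forall_ord d (T : measurableType d) (R : realType) (mu : {measure set T -> \bar R}) n
    (Q : 'I_n -> T -> Prop) :
  (forall i, {ae mu, forall x, Q i x}) -> {ae mu, forall x, forall i, Q i x}.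
Proof. by move=> H; apply: filter_forall. Qed.

(** * The energy inequality and its equality case *)

Section energy_bounds.
Context (R : realType) (n : nat) (p : R -> 'cV[R]_n -> R) (v : R * 'cV[R]_n -> 'cV[R]_n).
Context (hp : forall t, is_density (p t)) (rp : regular_path v hp).
Context (K : 'M[R]_n) (l : 'rV[R]_n).
Hypothesis Ku : K \in unitmx.
Hypothesis P0 : second_moment (p 0) = K *m K^T.
Hypothesis P1 : second_moment (p 1) = K *m diag_mx (map_mx expR l) *m K^T.
Local Notation mu := (@lebesgue_measure R).
Local Notation T := (measurableTypeR R).
Local Notation F := (energy_rate v hp).

Let posP t : posdefmx (second_moment (p t)).
Proof. exact: (posdefmx_second_moment (rp_moment rp t)). Qed.

Lemma measurable_second_moment i j : measurable_fun setT (fun t : T => second_moment (p t) i j).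
Proof.
rewrite (_ : (fun t => _) = fun t : T => \int[law (hp t)]_x (x i 0 * x j 0) : R); last first.
  by apply/funext => t; exact: second_momentE.
apply: (@measurable_Rint_law R n _ hp (rp_narrow rp) (fun z => z.2 i 0 * z.2 j 0)).
exact: (measurableT_comp (measurable_mul_coord i j) measurable_snd).
Qed.

Lemma measurable_inv_second_moment i j :
  measurable_fun setT (fun t : T => invmx (second_moment (p t)) i j).
Proof.
apply: measurable_invmx; last exact: measurable_second_moment.
by move=> t; exact: posdefmx_unit.
Qed.

Lemma energy_rate_ge0 t : 0 <= F t.
Proof. by apply: Rint_ge0 => x; exact: sqnormW_invmx_ge0. Qed.

Lemma measurable_energy_rate : measurable_fun setT (F : T -> R).
Proof.
apply: (@measurable_Rint_law R n _ hp (rp_narrow rp) (fun z => sqnormW (invmx (second_moment (p z.1))) (v z))).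
rewrite (_ : (fun z => _) = fun z => \sum_i \sum_j invmx (second_moment (p z.1)) i j * (v z i 0 * v z j 0)); last first.
  by apply/funext => z; exact: quadraticE.
have mc i := measurable_v_coord (rp_measurable rp) i.
apply: measurable_sum => i; apply: measurable_sum => j; apply: measurable_funM.
  exact: (measurableT_comp (measurable_inv_second_moment i j) measurable_fst).
exact: measurable_funM.
Qed.

Lemma energy_core (i0 : 'I_n) : int01 F ->
  \sum_i l 0 i ^+ 2 <= 4 * acint F 0 1 /\
  (4 * acint F 0 1 = \sum_i l 0 i ^+ 2 -> {ae mu, forall t : R, t \in `[0, 1] ->
    {ae law (hp t), forall x, (invmx K *m v (t, x)) i0 0 = l 0 i0 / 2 * (invmx K *m x) i0 0}}).
Proof.
move=> iF; have [D [g [D0 ig Ig FD Dv]]] := energy_decomposition rp Ku P0 P1 i0.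
have i4F : int01 (fun t => 4 * F t) by exact: int01Z.
have iNg : int01 (fun t => -1 * g t) by exact: int01Z.
(* Integrability of [D] is not part of the decomposition; [D'] agrees with it on [[0, 1]] and is
   integrable as a difference. *)
pose D' t := 4 * F t + -1 * g t.
have iD' : int01 D' by exact: int01D.
have D'E t : 0 <= t <= 1 -> D' t = D t by move=> t01; rewrite /D' FD//; ring.
have E : 4 * acint F 0 1 = acint D' 0 1 + \sum_i l 0 i ^+ 2.
  by rewrite /D' acintD// acintZ// acintZ// Ig; ring.
have A0 : 0 <= acint D' 0 1.
  rewrite (@eq_acint _ _ (fun t => `|D' t|)); first exact: acint_ge0.
  by move=> t t01; rewrite D'E// ger0_norm.
split; first by rewrite E lerDr.
move=> E2; have A_0 : acint D' 0 1 = 0 by lra.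
have : ae_eq mu (`[0, 1]%classic : set T) (EFin \o D') (cst 0%E).
  apply/ae_eq_integral_abs; first exact: measurable01.
    exact: measurable_int iD'.
  rewrite (_ : (\int[mu]_(t in `[0%R, 1%R]) _)%E = \int[mu]_(t in `[0%R, 1%R]) (EFin \o D') t)%E; last first.
    apply: eq_integral => t; rewrite inE/= in_itv/= => t01.
    by rewrite ger0_norm// D'E.
  rewrite -[LHS]fineK; last by apply: integrable_fin_num iD'; exact: measurable01.
  by rewrite -/(Rintegral _ _ _) -/(acint D' 0 1) A_0.
apply: ae_sub => t h t01; apply: Dv; first by move: t01; rewrite in_itv.
have [] := h t01; rewrite D'E//; by move: t01; rewrite in_itv.
Qed.

Let int01F : (\int[mu]_(t in `[0%R, 1%R]) (F t)%:E < +oo)%E -> int01 F.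
Proof.
move=> h; apply/integrableP; split.
  by apply: measurable_funTS; apply/measurable_EFinP; exact: measurable_energy_rate.
by under eq_integral do rewrite /= ger0_norm ?energy_rate_ge0//.
Qed.

Let integralF : int01 F ->
  (4%:E * \int[mu]_(t in `[0%R, 1%R]) (F t)%:E)%E = (4 * acint F 0 1)%:E.
Proof.
move=> iF; rewrite EFinM; congr (_ * _)%E.
rewrite /acint /Rintegral fineK//; apply: integrable_fin_num iF; exact: measurable01.
Qed.

Lemma energy_lower_bound :
  ((\sum_i l 0 i ^+ 2)%:E <= 4%:E * \int[mu]_(t in `[0%R, 1%R]) (F t)%:E)%E.
Proof.
(* In dimension zero there is no coordinate from which to start the elimination, but the sum is
   empty. *)
have [n0|i0] := posnP n.
  rewrite big1 => [|i _]; last by case: (i) => k kn; exfalso; move: kn; rewrite n0.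
  rewrite mule_ge0//; apply: integral_ge0 => t _; rewrite lee_fin; exact: energy_rate_ge0.
have [h|h] := ltP (\int[mu]_(t in `[0%R, 1%R]) (F t)%:E)%E +oo%E; last first.
  by rewrite leye_eq in h; rewrite (eqP h) gt0_muley ?leey.
have iF := int01F h; rewrite integralF// lee_fin.
by have [] := energy_core (Ordinal i0) iF.
Qed.

(** Each coordinate comes with its own null set of times and, at each time, its own null set of
    points; being finitely many, they are merged before multiplying back by [K]. *)
Lemma energy_equality :
  (4%:E * \int[mu]_(t in `[0%R, 1%R]) (F t)%:E = (\sum_i l 0 i ^+ 2)%:E)%E ->
  {ae mu, forall t : R, t \in `[0, 1] -> {ae law (hp t), forall x, v (t, x) = drift K l *m x}}.
Proof.
move=> E; have h : (\int[mu]_(t in `[0%R, 1%R]) (F t)%:E < +oo)%E.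
  rewrite ltey; apply/eqP => h; move: E; rewrite h gt0_muley//.
have iF := int01F h; rewrite integralF// in E; case: E => E.
have H : {ae mu, forall t : R, forall i : 'I_n, t \in `[0, 1] ->
    {ae law (hp t), forall x, (invmx K *m v (t, x)) i 0 = l 0 i / 2 * (invmx K *m x) i 0}}.
  by apply: ae_forall_ord => i; have [_] := energy_core i iF; exact.
apply: ae_sub H => t H t01.
have {}H : {ae law (hp t), forall x, forall i, (invmx K *m v (t, x)) i 0 = l 0 i / 2 * (invmx K *m x) i 0}.
  by apply: ae_forall_ord => i; exact: H.
apply: ae_sub H => x Hx; rewrite -[LHS](mulKVmx Ku) /drift -!mulmxA; congr (_ *m _).
by apply/colP => i; rewrite Hx mul_diag_mx !mxE; ring.
Qed.

End energy_bounds.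

(** * Uniqueness of the law *)

Section boxes.
Context (R : realType) (n : nat).

Definition open_boxes : set (set 'cV[R]_n) :=
  [set B | exists a b : 'cV[R]_n, B = [set z : 'cV[R]_n | forall i, a i 0 < z i 0 < b i 0]].

Lemma open_box_open B : open_boxes B -> open B.
Proof.
move=> [a [b ->]]; rewrite openE => z zB.
suff H : \forall y \near z, forall i, a i 0 < (y : 'cV[R]_n) i 0 < b i 0 by exact: H.
apply: (@filter_forall _ _ (fun i (y : 'cV[R]_n) => a i 0 < y i 0 < b i 0) (nbhs z)) => i.
have /andP[az zb] := zB i.
have ci : {for z, continuous (fun z : 'cV[R]_n => z i 0)} by exact: coord_continuous.
near=> y; apply/andP; split; near: y.
- exact: (cvgr_gt _ ci).
- exact: (cvgr_lt _ ci).
Unshelve. all: by end_near.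
Qed.

(** Open boxes form a generating pi-system: an open set is the countable union of the boxes with
    rational corners that it contains. *)
Lemma measurable_open_boxes : @measurable _ 'cV[R]_n = <<s open_boxes >>.
Proof.
apply/seteqP; split; last first.
  apply: smallest_sub; first exact: sigma_algebra_measurable.
  by move=> B /open_box_open; exact: measurable_open_mx.
apply: smallest_sub; first exact: smallest_sigma_algebra.
move=> U /= oU.
pose B (i : 'cV[rat]_n * 'cV[rat]_n) : set 'cV[R]_n :=
  [set z | forall j, ratr (i.1 j 0) < z j 0 < ratr (i.2 j 0)].
have -> : U = \bigcup_i (if `[< B i `<=` U >] then B i else set0).
  apply/seteqP; split=> [y Uy|y [i _]]; last by case: asboolP => // + By; exact.
  have : nbhs y U by exact: open_nbhs_nbhs.
  move=> /nbhs_ballP[e /= e0 eU].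
  have /choice[a ya] : forall j, exists q : rat, y j 0 - e < ratr q < y j 0.
    move=> j; have /rat_in_itvoo[q] : y j 0 - e < y j 0 by rewrite ltrBlDr ltrDl.
    by rewrite in_itv/= => h; exists q.
  have /choice[b yb] : forall j, exists q : rat, y j 0 < ratr q < y j 0 + e.
    move=> j; have /rat_in_itvoo[q] : y j 0 < y j 0 + e by rewrite ltrDl.
    by rewrite in_itv/= => h; exists q.
  exists (\col_j a j, \col_j b j) => //; case: asboolP => [_|[]].
    by move=> j /=; rewrite !mxE; have /andP[_ ->] := ya j; have /andP[-> _] := yb j.
  move=> z zB; apply: eU; split=> // j k; rewrite ord1 /ball/= ltr_distlC.
  have := zB j; rewrite /= !mxE => /andP[h1 h2].
  have /andP[h3 _] := ya j; have /andP[_ h4] := yb j.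
  by rewrite (lt_trans h3 h1) (lt_trans h2 h4).
apply: (@countable_bigcupT_measurable _ (g_sigma_algebraType open_boxes)) => // i.
case: ifP => _; last exact: measurable0.
apply: sub_sigma_algebra; exists (map_mx ratr i.1), (map_mx ratr i.2).
apply/seteqP; split=> z /= h j; have := h j; by rewrite !mxE.
Qed.

Lemma setI_closed_open_boxes : setI_closed open_boxes.
Proof.
move=> _ _ [a [b ->]] [c [d ->]].
exists (\col_i Num.max (a i 0) (c i 0)), (\col_i Num.min (b i 0) (d i 0)).
apply/seteqP; split=> z /=.
  move=> [h1 h2] i; rewrite !mxE gt_max lt_min; have /andP[-> ->] := h1 i.
  by have /andP[-> ->] := h2 i.
move=> h; split=> i; have := h i; rewrite !mxE gt_max lt_min => /andP[/andP[h1 h2] /andP[h3 h4]].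
  by rewrite h1 h3.
by rewrite h2 h4.
Qed.

Definition plateau (a b e u : R) : R := ramp a e u * (1 + -1 * ramp (b - e) e u).

Lemma smooth_plateau a b e : smooth (plateau a b e).
Proof.
apply: sm_is_smooth; apply: sm_M; first by apply: sm_smooth; exact: smooth_ramp.
apply: sm_D; first by apply: sm_smooth; exact: smooth_cst.
by apply: sm_M; apply: sm_smooth; [exact: smooth_cst|exact: smooth_ramp].
Qed.

Lemma plateau_itv a b e u : 0 <= plateau a b e u <= 1.
Proof.
have /andP[h1 h2] := ramp_itv a e u; have /andP[h3 h4] := ramp_itv (b - e) e u.
by rewrite /plateau; apply/andP; split; [apply: mulr_ge0|apply: mulr_ile1]; lra.
Qed.

Lemma plateau0 a b e u : 0 < e -> ~~ (a < u < b) -> plateau a b e u = 0.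
Proof.
move=> e0; rewrite negb_and -!leNgt => /orP[h|h]; rewrite /plateau.
  by rewrite ramp_le0// mul0r.
by rewrite (@ramp_ge1 _ (b - e))// ?subrK//; ring.
Qed.

Lemma plateau1 a b e u : 0 < e -> a + e <= u -> u <= b - e -> plateau a b e u = 1.
Proof. by move=> e0 h1 h2; rewrite /plateau ramp_ge1// ramp_le0//; ring. Qed.

End boxes.

(** Products of plateaus converge to the indicator of an open box, so the two laws agree on open
    boxes by dominated convergence, then on Borel sets by a Dynkin argument. The two sides may live
    on different probability spaces. *)
Lemma eq_law_of_products (R : realType) n d1 d2 (T1 : measurableType d1) (T2 : measurableType d2)
    (P : probability T1 R) (Q : probability T2 R) (X : T1 -> 'cV[R]_n) (Y : T2 -> 'cV[R]_n) :
  measurable_fun setT X -> measurable_fun setT Y ->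
  (forall chi : 'I_n -> R -> R, (forall i, smooth (chi i)) -> (forall i u, 0 <= chi i u <= 1) ->
     (exists c, forall i u, c < `|u| -> chi i u = 0) ->
     \int[P]_w \prod_i chi i (X w i 0) = \int[Q]_w \prod_i chi i (Y w i 0) :> R) ->
  forall B, measurable B -> P (X @^-1` B) = Q (Y @^-1` B).
Proof.
move=> mX mY PQ.
have mXB B : measurable B -> measurable (X @^-1` B).
  by move=> mB; have := mX measurableT B mB; rewrite setTI.
have mYB B : measurable B -> measurable (Y @^-1` B).
  by move=> mB; have := mY measurableT B mB; rewrite setTI.
move=> B mB; pose S (B : set 'cV[R]_n) := P (X @^-1` B) = Q (Y @^-1` B).
suff : S B by [].
apply: (@dynkin_induction _ _ (@open_boxes R n) S) => //.
- exact: measurable_open_boxes.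
- exact: setI_closed_open_boxes.
- by rewrite /S !preimage_setT !probability_setT.
- move=> C; move=> [a [b CE]].
  have mC : measurable C by apply: measurable_open_mx; apply: open_box_open; exists a, b.
  pose chi (k : nat) (i : 'I_n) := plateau (a i 0) (b i 0) k.+1%:R^-1.
  have e0 (k : nat) : 0 < k.+1%:R^-1 :> R by rewrite invr_gt0 ltr0n.
  have lim (z : 'cV[R]_n) : \prod_i chi k i (z i 0) @[k --> \oo] --> (\1_C z : R).
    apply: cvg_near_cst.
    have H : \forall k \near \oo, forall i, chi k i (z i 0) = ((a i 0 < z i 0 < b i 0)%R : bool)%:R :> R.
      apply: filter_forall => i.
      have [/andP[az zb]|nab] := boolP (a i 0 < z i 0 < b i 0); last first.
        by apply: nearW => k; rewrite /chi plateau0// (negbTE nab).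
      near=> k.
      have h1 : k.+1%:R^-1 < z i 0 - a i 0.
        near: k; apply: (cvgr_lt (0 : R)); [exact: cvg_harmonic|by rewrite subr_gt0].
      have h2 : k.+1%:R^-1 < b i 0 - z i 0.
        near: k; apply: (cvgr_lt (0 : R)); [exact: cvg_harmonic|by rewrite subr_gt0].
      rewrite /chi; move: h1 h2 (e0 k); move: (k.+1%:R^-1) => e h1 h2 e_gt0.
      by rewrite plateau1//; lra.
    apply: filterS H => k H; rewrite (eq_bigr _ (fun i _ => H i)) indicE.
    have [zC|zC] := boolP (z \in C).
      by rewrite big1// => i _; move: zC; rewrite inE CE /= => /(_ i) ->.
    have [i ni] : exists i, ~~ (a i 0 < z i 0 < b i 0).
      apply: contrapT => nex; move: zC; rewrite notin_setE; apply.
      by rewrite CE /= => i; apply: contrapT => /negP h; apply: nex; exists i.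
    by rewrite (bigD1 i)//= (negbTE ni) mul0r.
  have key d (T : measurableType d) (m : probability T R) (Z : T -> 'cV[R]_n) :
      measurable_fun setT Z -> \int[m]_w \prod_i chi k i (Z w i 0) @[k --> \oo] --> fine (m (Z @^-1` C)).
    move=> mZ; have mZC : measurable (Z @^-1` C).
      by have := mZ measurableT C mC; rewrite setTI.
    have [||||_] := @Rint_dct _ _ R m setT (fun k w => \prod_i chi k i (Z w i 0))
        (\1_(Z @^-1` C)) (cst 1) measurableT.
    + move=> k; apply: measurable_prod => i _.
      apply: (@measurableT_comp _ _ _ _ _ _ (chi k i)).
        apply: continuous_measurable_fun; apply: smooth_continuous; exact: smooth_plateau.
      exact: (measurableT_comp (measurable_coord i) mZ).
    + by move=> w _; exact: lim.
    + exact: finite_measure_integrable_cst.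
    + move=> k w _; rewrite ger0_norm; last first.
        by apply: prodr_ge0 => i _; have /andP[] := plateau_itv (a i 0) (b i 0) k.+1%:R^-1 (Z w i 0).
      apply: prodr_ile1 => i _; exact: plateau_itv.
    by rewrite /Rintegral integral_indic// setIT.
  have cP := key _ _ P X mX; have cQ := key _ _ Q Y mY.
  have E k : \int[P]_w \prod_i chi k i (X w i 0) = \int[Q]_w \prod_i chi k i (Y w i 0) :> R.
    apply: PQ.
    - by move=> i; exact: smooth_plateau.
    - by move=> i u; exact: plateau_itv.
    (* Summing over all coordinates gives one bound valid for every [i]. *)
    - exists (\sum_i (`|a i 0| + `|b i 0|)) => i u cu; rewrite /chi plateau0//.
      apply/negP => /andP[au ub]; move: cu; rewrite ltNge => /negP; apply.
      rewrite (bigD1 i)//= (@le_trans _ _ (`|a i 0| + `|b i 0|))//; last first.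
        by rewrite lerDl sumr_ge0// => j _; rewrite addr_ge0.
      have := ler_norm (b i 0); have := ler_norm (- a i 0); rewrite normrN => h1 h2.
      have := normr_ge0 (a i 0); have := normr_ge0 (b i 0) => h3 h4.
      by rewrite ler_norml; lra.
  have : fine (P (X @^-1` C)) = fine (Q (Y @^-1` C)).
    apply: (cvg_unique (@norm_hausdorff _ _) cP).
    by have <- : (fun k => \int[Q]_w \prod_i chi k i (Y w i 0)) = (fun k => \int[P]_w \prod_i chi k i (X w i 0)) by apply: funext => k; rewrite E.
  move=> h; rewrite /S -[LHS]fineK; last by apply: fin_num_measure; exact: mXB.
  by rewrite h fineK//; apply: fin_num_measure; exact: mYB.
- move=> C mC SC; rewrite /S.
  transitivity (1 - P (X @^-1` C))%E; first by have := probability_setC P (mXB _ mC).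
  by rewrite SC; apply/esym; have := probability_setC Q (mYB _ mC).
- move=> F mF tF SF; rewrite /S !preimage_bigcup.
  have E d (T : measurableType d) (m : probability T R) (Z : T -> 'cV[R]_n) : measurable_fun setT Z ->
      (m (\bigcup_k (Z @^-1` F k)) = \sum_(k <oo) m (Z @^-1` F k))%E.
    move=> mZ; apply/esym/cvg_lim => //; apply: measure_sigma_additive.
      by move=> k; have := mZ measurableT _ (mF k); rewrite setTI.
    by move=> i j _ _ [x [Fi Fj]]; apply: (tF i j) => //; exists (Z x).
  by rewrite !E//; apply: eq_eseriesr => k _; exact: SF.
- by rewrite -measurable_open_boxes.
Unshelve. all: by end_near.
Qed.

Section density_classes.
Context (R : realType) (n : nat).
Implicit Types (p q : 'cV[R]_n -> R).

Lemma expect_density_eq p q g : is_density p -> is_density q -> density_eq p q ->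
  measurable_fun setT g -> expect p g = expect q g.
Proof.
move=> [mp _ _] [mq _ _] pq mg; apply: ae_eq_integral => //.
- by apply/measurable_EFinP; exact: measurable_funM.
- by apply/measurable_EFinP; exact: measurable_funM.
- by apply: ae_sub pq => x px _; rewrite px.
Qed.

Lemma density_eq_of_law p q (hp : is_density p) (hq : is_density q) :
  (forall U, measurable U -> law hp U = law hq U) -> density_eq p q.
Proof.
move=> E; have [mp p0 p1] := hp; have [mq q0 q1] := hq.
have ip : (leb n).-integrable setT (EFin \o p).
  apply/integrableP; split; first exact/measurable_EFinP.
  rewrite (_ : (fun x => _) = (EFin \o p)); last by apply/funext => x /=; rewrite ger0_norm.
  by rewrite p1 ltry.
have H := @integral_ae_eq _ _ _ (leb n) setT measurableT (EFin \o q) (EFin \o p) ip.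
have {}H : ae_eq (leb n) setT (EFin \o p) (EFin \o q).
  by apply: H => [|U _ mU]; [exact/measurable_EFinP|exact: (E U mU)].
by apply: ae_sub H => x /(_ I) [].
Qed.

End density_classes.

Lemma sm_prod (R : realType) (V : normedModType R) (I : Type) (r : seq I) (F : I -> V -> R) :
  (forall i, sm (F i)) -> sm (fun x => \prod_(i <- r) F i x).
Proof.
move=> sF; elim: r => [|i r IH].
  rewrite (_ : (fun x => _) = fun=> 1); first by apply: sm_smooth; exact: smooth_cst.
  by apply/funext => x; rewrite big_nil.
rewrite (_ : (fun x => _) = fun x => F i x * \prod_(j <- r) F j x); first exact: sm_M.
by apply/funext => x; rewrite big_cons.
Qed.

Section uniqueness_along_flow.
Context (R : realType) (n : nat) (K : 'M[R]_n) (l : 'rV[R]_n).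
Hypothesis Ku : K \in unitmx.
Local Notation mu := (@lebesgue_measure R).

(** The coordinates of the initial point [z] from which the flow reaches [x] at time [t]; they are
    constants of the motion. *)
Definition pull (z : R * 'cV[R]_n) (i : 'I_n) : R :=
  expR (- (z.1 * (l 0 i / 2))) * (invmx K *m z.2) i 0.

Lemma smooth_pull i : smooth (fun z => pull z i).
Proof.
apply: sm_is_smooth; apply: sm_M.
  apply: (@sm_comp _ _ (@expR R)); first exact: smooth_exp.
  rewrite (_ : (fun z => _) = fun z : R * 'cV[R]_n => (- (l 0 i / 2)) * z.1); last first.
    by apply/funext => z; ring.
  apply: sm_M; apply: sm_smooth; first exact: smooth_cst.
  by apply: smooth_linear => // z; exact: cvg_fst.
rewrite (_ : (fun z => _) = fun z : R * 'cV[R]_n => \sum_j invmx K i j * z.2 j 0); last first.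
  by apply/funext => z; rewrite mxE.
by apply: sm_sum => j; apply: sm_M; apply: sm_smooth; [exact: smooth_cst|exact: smooth_coord].
Qed.

Lemma pull_flow t z i : pull (t, flow K l t *m z) i = z i 0.
Proof.
by rewrite /pull /flow -mulmxA mulKmx// mul_diag_mx !mxE mulrA -expRD addNr expR0 mul1r.
Qed.

Lemma flow_surj (t : R) (x : 'cV[R]_n) : exists z, x = flow K l t *m z.
Proof. by exists (invmx (flow K l t) *m x); rewrite mulKVmx// flow_unit. Qed.

Lemma flow_pull t x : flow K l t *m (\col_i pull (t, x) i) = x.
Proof.
have [z ->] := flow_surj t x; congr (_ *m _).
by apply/colP => i; rewrite mxE pull_flow.
Qed.

Section product_test_function.
Variables (chi : 'I_n -> R -> R) (c : R).
Hypothesis schi : forall i, smooth (chi i).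
Hypothesis chi0 : forall i u, c < `|u| -> chi i u = 0.

Definition pulled z : R := \prod_i chi i (pull z i).

Lemma smooth_pulled : smooth pulled.
Proof.
apply: sm_is_smooth; apply: sm_prod => i; apply: (sm_comp (schi i)).
by apply: sm_smooth; exact: smooth_pull.
Qed.

(** A function of the constants of the motion does not change along the flow, so its material
    derivative vanishes. *)
Lemma pulled_transport (t : R) (x : 'cV[R]_n) : 'D_(1, 0) pulled (t, x) + 'D_(0, drift K l *m x) pulled (t, x) = 0.
Proof.
have [z ->] := flow_surj t x.
have d := is_derive_along smooth_pulled (is_derive_flow l Ku t z).
have [_ <-] := d.
have -> : (fun s => pulled (s, flow K l s *m z)) = fun=> \prod_i chi i (z i 0).
  by apply/funext => s; apply: eq_bigr => i _; rewrite pull_flow.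
by have [] := is_derive_cst (\prod_i chi i (z i 0)) t (1 : R).
Qed.

Lemma pulled_support : exists r, forall (t : R) (x : 'cV[R]_n), -2 < t < 3 -> ~ box r x -> pulled (t, x) = 0.
Proof.
(* For [|t| <= 3] the factor [expR (t * (l 0 j / 2))] is at most [expR (3 * |l 0 j|)]. The outer sum
   makes the radius independent of the coordinate, and [|c|] keeps it nonnegative. *)
exists (\sum_i \sum_j `|K i j| * (expR (3 * `|l 0 j|) * `|c|)) => t x t23.
have [z ->] := flow_surj t x; apply: contra_notP => /eqP; move=> /prodf_neq0 nz i.
have zc j : `|z j 0| <= `|c|.
  have := nz j isT; rewrite pull_flow /= => /eqP h; rewrite (le_trans _ (ler_norm c))// leNgt.
  by apply/negP => /chi0.
rewrite -ler_norml flow_coord (le_trans (ler_norm_sum _ _ _))//.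
apply: (@le_trans _ _ (\sum_j `|K i j| * (expR (3 * `|l 0 j|) * `|c|))).
  apply: ler_sum => j _; rewrite !normrM ler_wpM2l// ler_pM//.
  rewrite ger0_norm ?expR_ge0// ler_expR (le_trans (ler_norm _))// !normrM.
  have t3 : `|t| <= 3 by rewrite ler_norml; lra.
  by have l0 := normr_ge0 (l 0 j); rewrite (@ger0_norm _ 2^-1)//; nra.
rewrite [leRHS](bigD1 i)//= lerDl sumr_ge0// => k _; apply: sumr_ge0 => j _.
by rewrite !mulr_ge0 ?expR_ge0.
Qed.

Variables (p : R -> 'cV[R]_n -> R) (v : R * 'cV[R]_n -> 'cV[R]_n) (hp : forall t, is_density (p t)).
Hypothesis rp : regular_path v hp.
Hypothesis vd : {ae mu, forall t : R, t \in `[0, 1] ->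
  {ae law (hp t), forall x, v (t, x) = drift K l *m x}}.

(** [ac_test] gives the derivative in time as the mean of the transport of [pulled] by [v]; for
    almost every time [v] is almost surely the drift, and that transport is zero. *)
Lemma integral_pulled_cst t : 0 <= t <= 1 ->
  \int[law (hp t)]_x pulled (t, x) = \int[law (hp 0)]_x pulled (0, x) :> R.
Proof.
move=> /andP[t0 t1]; have [r phi0] := pulled_support.
have [_ A] := ac_test (rp_narrow rp) (rp_measurable rp) (rp_velocity rp) (rp_energy rp)
  (rp_equation rp) smooth_pulled phi0.
apply/eqP; rewrite -subr_eq0 A//; apply/eqP; rewrite /acint /Rintegral.
pose G s : R := \int[law (hp s)]_x ('D_(1, 0) pulled (s, x) + 'D_(0, v (s, x)) pulled (s, x)).
have mT : measurable_fun setT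
    (fun z : measurableTypeR R * 'cV[R]_n => 'D_(1, 0) pulled z + 'D_(0, v z) pulled z).
  by apply: measurable_transport; [exact: smooth_pulled|exact: rp_measurable rp].
have G0 : {ae mu, forall s : R, `[0, t]%classic s -> (G s)%:E = 0%E}.
  apply: ae_sub vd => s vs; rewrite /= in_itv/= => /andP[s0 st].
  have /vs as0 : s \in `[0, 1] by rewrite in_itv/= s0 (le_trans st).
  rewrite /G /Rintegral.
  rewrite (_ : (\int[law (hp s)]_x _)%E = (\int[law (hp s)]_x cst 0 x)%E); last first.
    apply: ae_eq_integral => //.
      apply/measurable_EFinP.
      exact: (measurable_snd_section (g := fun z => 'D_(1, 0) pulled z + 'D_(0, v z) pulled z)).
    by apply: ae_sub as0 => x -> _; rewrite pulled_transport.
  by rewrite integral_cst// mul0e.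
have -> : (\int[mu]_(s in `[0%R, t]) (G s)%:E = \int[mu]_(s in `[0%R, t]) 0%:E)%E.
  apply: ae_eq_integral => //.
  apply: (@measurable_funS _ _ _ _ setT) => //; apply/measurable_EFinP.
  exact: (@measurable_Rint_law R n p hp (rp_narrow rp) (fun z => 'D_(1, 0) pulled z + 'D_(0, v z) pulled z)).
by rewrite integral0.
Qed.

End product_test_function.

Variables (p : R -> 'cV[R]_n -> R) (v : R * 'cV[R]_n -> 'cV[R]_n) (hp : forall t, is_density (p t)).
Hypothesis rp : regular_path v hp.
Hypothesis vd : {ae mu, forall t : R, t \in `[0, 1] ->
  {ae law (hp t), forall x, v (t, x) = drift K l *m x}}.

(** In pulled-back coordinates both laws are independent of time, as seen by products of bump
    functions: the first by [integral_pulled_cst], the second because it is always [gamma n]. They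
    agree at time [0], hence at every time. *)
Lemma density_eq_gpath t : density_eq (p 0) (gpath K l 0) -> 0 <= t <= 1 ->
  density_eq (p t) (gpath K l t).
Proof.
move=> d0 t01; pose X x : 'cV[R]_n := \col_i pull (t, x) i.
have XE x : X x = invmx (flow K l t) *m x.
  have [z ->] := flow_surj t x; rewrite mulKmx ?flow_unit//.
  by apply/colP => i; rewrite mxE pull_flow.
have mX : measurable_fun setT X.
  by rewrite (_ : X = mulmx (invmx (flow K l t))); [exact: measurable_mulmxl|exact/funext].
have hg : is_density (gpath K l t) by exact: gpath_density.
apply: (@density_eq_of_law R n (p t) (gpath K l t) (hp t) hg) => U mU.
(* The coordinate map is inverse to the flow, so equality of laws in the coordinates gives equality
   on every Borel set [U]. *)
have XB : X @^-1` (mulmx (flow K l t) @^-1` U) = U.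
  by apply/seteqP; split=> x; rewrite /preimage /= /X flow_pull.
rewrite -XB; apply: (@eq_law_of_products R n _ _ _ _ (law (hp t)) (law hg) X X) => //.
  move=> chi schi chi01 [c chi0].
  have mpulled s : measurable_fun setT (fun x => pulled chi (s, x)).
    apply: continuous_measurable_mx; apply: continuous_snd_section.
    by apply: smooth_continuous; exact: smooth_pulled.
  have gE s : (expect (gpath K l s) (fun x => pulled chi (s, x)) =
      \int[gamma n]_z (\prod_i chi i (z i 0))%:E)%E.
    rewrite expect_gpath//; apply: eq_integral => z _; congr EFin.
    by apply: eq_bigr => i _; rewrite pull_flow.
  have IE (m : probability 'cV[R]_n R) :
      \int[m]_w \prod_i chi i (X w i 0) = \int[m]_w pulled chi (t, w) :> R.
    by apply: eq_Rintegral => x _; apply: eq_bigr => i _; rewrite mxE.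
  have g0 : is_density (gpath K l 0) by exact: gpath_density.
  have e0 := expect_density_eq (hp 0) g0 d0 (mpulled 0).
  rewrite (IE (law (hp t))) (IE (law hg)).
  rewrite (integral_pulled_cst schi (c := c) chi0 rp vd t01).
  have -> : \int[law (hp 0)]_x pulled chi (0, x) = fine (expect (p 0) (fun x => pulled chi (0, x))).
    by rewrite expect_law.
  transitivity (fine (expect (gpath K l t) (fun x => pulled chi (t, x)))).
    by congr fine; exact: (etrans e0 (etrans (gE 0) (esym (gE t)))).
  by rewrite expect_law.
by have := measurable_mulmxl (flow K l t) measurableT mU; rewrite setTI.
Qed.

End uniqueness_along_flow.

(** * Optimality *)

Lemma ae_and d (T : measurableType d) (R : realType) (mu : {measure set T -> \bar R})
    (P Q : T -> Prop) :
  {ae mu, forall x, P x} -> {ae mu, forall x, Q x} -> {ae mu, forall x, P x /\ Q x}.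
Proof. by move=> HP HQ; apply: filterI. Qed.

Section optimal_path.
Context (R : realType) (n : nat) (K : 'M[R]_n) (l : 'rV[R]_n).
Hypothesis Ku : K \in unitmx.
Local Notation mu := (@lebesgue_measure R).
Local Notation T := (measurableTypeR R).
Let p0 : 'cV[R]_n -> R := gaussian_pdf (K *m K^T).
Let p1 : 'cV[R]_n -> R := gaussian_pdf (K *m diag_mx (map_mx expR l) *m K^T).

Lemma second_moment_density_eq (p q : 'cV[R]_n -> R) : is_density p -> is_density q ->
  density_eq p q -> second_moment p = second_moment q.
Proof.
move=> hp hq pq; apply/matrixP => i j; rewrite !mxE (expect_density_eq hp hq pq)//.
exact: measurable_mul_coord.
Qed.

Lemma flow0E : flow K l 0 *m (flow K l 0)^T = K *m K^T.
Proof.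
rewrite flow_cov; congr (_ *m _); rewrite -[RHS]mulmx1; congr (_ *m _).
apply/matrixP => i j; rewrite !mxE; case: eqP => // ->.
by rewrite mul0r expR0.
Qed.

Lemma flow1E : flow K l 1 *m (flow K l 1)^T = K *m diag_mx (map_mx expR l) *m K^T.
Proof. by rewrite flow_cov scale1r. Qed.

Section candidate.
Variables (p : R -> 'cV[R]_n -> R) (v : R -> 'cV[R]_n -> 'cV[R]_n).
Hypothesis adm : admissible p0 p1 p v.

(** The energy bounds are about regular paths; this transfers them, since the cost ignores a null
    set of times. *)
Lemma candidate_cost : exists (v' : R * 'cV[R]_n -> 'cV[R]_n) (hp : forall t, is_density (p (clip t))),
  [/\ regular_path v' hp,
      {ae mu, forall t : R, t \in `[0, 1] -> forall x, v' (t, x) = v t x}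
    & cost p v = (4%:E * \int[mu]_(t in `[0%R, 1%R]) (energy_rate v' hp t)%:E)%E].
Proof.
have [v' [hp [rp vv mW]]] := regular_representative adm.
exists v', hp; split=> //; rewrite /cost; congr (_ * _)%E.
pose W t := invmx (second_moment (p (clip t))).
have W0 t x : 0 <= sqnormW (W t) x.
  by apply: sqnormW_invmx_ge0; exact: (posdefmx_second_moment (rp_moment rp t)).
have clipE t : `[0, 1]%classic t -> clip t = t by rewrite /= in_itv/=; exact: clip_id.
pose F t := expect (p t) (fun x => sqnormW (W t) (v t x)).
transitivity (\int[mu]_(t in `[0%R, 1%R]) F t)%E.
  by apply: eq_integral => t; rewrite inE => t01; rewrite /F /W clipE.
have d01 t : `[0, 1]%classic t -> is_density (p t) by move=> /clipE tE; rewrite -tE.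
apply: ge0_ae_eq_integral.
- exact: measurable01.
- by apply: mW W0 => i j; exact: (measurable_inv_second_moment rp).
- by apply: measurable_funTS; apply/measurable_EFinP; exact: (measurable_energy_rate rp).
- move=> t /d01[_ pt0 _]; apply: integral_ge0 => x _; rewrite lee_fin mulr_ge0//; exact: W0.
- move=> t _; rewrite lee_fin; exact: (energy_rate_ge0 rp).
- apply: ae_sub vv => t vv t01.
  have vvt := vv t01.
  have itg i j : itgb (law (hp t)) (fun x => v' (t, x) i 0 * v' (t, x) j 0).
    have mvt k : measurable_fun setT (fun x => v' (t, x) k 0).
      exact: (measurable_snd_section (g := fun z => v' z k 0) t (measurable_v_coord (rp_measurable rp) k)).
    apply: (itgb_le _ (fun x => mul_coord_le (v' (t, x)) (v' (t, x)) i j)).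
      exact: measurable_funM.
    by apply: itgbD; exact: rp_velocity rp t.
  have iq : itgb (law (hp t)) (fun x => sqnormW (W t) (v' (t, x))).
    rewrite (_ : (fun x => _) = fun x => \sum_i \sum_j W t i j * (v' (t, x) i 0 * v' (t, x) j 0)); last first.
      by apply/funext => x; exact: quadraticE.
    by apply: itgb_sum => i; apply: itgb_sum => j; exact: itgbZ.
  rewrite /energy_rate -itgb_integral// -expect_law; last exact: itgb_measurable iq.
  rewrite /F /W clipE//; congr (expect (p t)).
  by apply/funext => x; rewrite vvt.
Qed.

Let end0 : density_eq (p (clip 0)) (gpath K l 0).
Proof.
have -> : clip 0 = 0 :> R by rewrite clip_id// lexx ler01.
by rewrite /gpath flow0E; case: adm => _ _ _ _ []. Qed.
Let end1 : density_eq (p (clip 1)) (gpath K l 1).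
Proof.
have -> : clip 1 = 1 :> R by rewrite clip_id// lexx ler01.
by rewrite /gpath flow1E; case: adm => _ _ _ _ []. Qed.

Let moment0 (hp : forall t, is_density (p (clip t))) : second_moment (p (clip 0)) = K *m K^T.
Proof.
rewrite (second_moment_density_eq (hp 0) (gpath_density l Ku 0) end0) /gpath.
by rewrite second_moment_gaussian ?flow_unit// flow0E.
Qed.

Let moment1 (hp : forall t, is_density (p (clip t))) :
  second_moment (p (clip 1)) = K *m diag_mx (map_mx expR l) *m K^T.
Proof.
rewrite (second_moment_density_eq (hp 1) (gpath_density l Ku 1) end1) /gpath.
by rewrite second_moment_gaussian ?flow_unit// flow1E.
Qed.

Lemma cost_lower_bound : ((\sum_i l 0 i ^+ 2)%:E <= cost p v)%E.
Proof.
have [v' [hp [rp _ ->]]] := candidate_cost.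
exact: (energy_lower_bound rp Ku (moment0 hp) (moment1 hp)).
Qed.

Lemma cost_equality : cost p v = (\sum_i l 0 i ^+ 2)%:E ->
  (forall t : R, t \in `[0, 1] -> density_eq (p t) (gpath K l t)) /\
  {ae mu, forall t : R, t \in `[0, 1] ->
    {ae density_measure (p t), forall x, v t x = drift K l *m x}}.
Proof.
have [v' [hp [rp vv ->]]] := candidate_cost.
move=> /(energy_equality rp Ku (moment0 hp) (moment1 hp)) vd; split.
  move=> t; rewrite in_itv/= => t01.
  by have := density_eq_gpath Ku rp vd end0 t01; rewrite clip_id.
apply: ae_sub (ae_and vv vd) => t [{}vv {}vd] t01; have := vd t01.
have -> : (law (hp t) : set _ -> \bar R) = density_measure (p t).
  by rewrite -[in RHS](@clip_id _ t)//; move: t01; rewrite in_itv.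
by apply: ae_sub => x <-; rewrite vv.
Qed.

End candidate.

Lemma gpath_minimizer : is_minimizer p0 p1 (gpath K l) (fun=> mulmx (drift K l)).
Proof.
split; first exact: gpath_admissible.
by move=> q w adm; rewrite (gpath_cost l Ku); exact: cost_lower_bound.
Qed.

(** The cost of a minimizer is squeezed between the lower bound and the cost of the Gaussian path,
    so the equality case applies. *)
Lemma minimizerE p v : is_minimizer p0 p1 p v ->
  (forall t : R, t \in `[0, 1] -> density_eq (p t) (gpath K l t)) /\
  {ae mu, forall t : R, t \in `[0, 1] ->
    {ae density_measure (p t), forall x, v t x = drift K l *m x}}.
Proof.
move=> [adm vmin]; apply: cost_equality => //; apply/eqP; rewrite eq_le cost_lower_bound// andbT.
by rewrite -(gpath_cost l Ku); apply: vmin; exact: gpath_admissible.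
Qed.

Lemma inf_cost : ereal_inf [set cost z.1 z.2 | z in
    [set z : (R -> 'cV[R]_n -> R) * (R -> 'cV[R]_n -> 'cV[R]_n) | admissible p0 p1 z.1 z.2]] =
  (\sum_i l 0 i ^+ 2)%:E.
Proof.
apply/eqP; rewrite eq_le; apply/andP; split.
  rewrite -(gpath_cost l Ku); apply: ereal_inf_lbound.
  by exists (gpath K l, fun=> mulmx (drift K l)) => //; exact: gpath_admissible.
by apply: le_ereal_inf_tmp => _ [z adm <-]; exact: cost_lower_bound.
Qed.

End optimal_path.

Theorem theorem1 (R : realType) (n : nat) (P0 P1 : 'M[R]_n)
    (hP0 : posdefmx P0) (hP1 : posdefmx P1) :
  let p0 := gaussian_pdf P0 in
  let p1 := gaussian_pdf P1 in
  let S := sqrtmx P0 in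
  let M := invmx S *m P1 *m invmx S in
  let Pinfo (t : R) := S *m powmx M t *m S in
  let Ainfo := 2^-1 *: (S *m logmx M *m invmx S) in
  [/\ exists p v, is_minimizer p0 p1 p v,
      forall p v, is_minimizer p0 p1 p v ->
        (forall t : R, t \in `[0, 1] -> density_eq (p t) (gaussian_pdf (Pinfo t))) /\
        {ae lebesgue_measure, forall t : R, t \in `[0, 1] ->
          {ae density_measure (p t), forall x, v t x = Ainfo *m x}}
    & ereal_inf [set cost z.1 z.2 | z in
        [set z : (R -> 'cV[R]_n -> R) * (R -> 'cV[R]_n -> 'cV[R]_n) |
          admissible p0 p1 z.1 z.2]]
      = (frobenius (logmx M) ^+ 2)%:E].
Proof.
move=> p0 p1 S M Pinfo Ainfo.
have [K [l [Ku P0E P1E PtE [AE FE]]]] := geodesic_diagonal hP0 hP1.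
rewrite -/S -/M -/Ainfo in PtE AE FE.
rewrite FE /p0 /p1 [in gaussian_pdf P0]P0E [in gaussian_pdf P1]P1E; split.
(* The lower bound is attained by the Gaussian path, so a minimizer exists. *)
- by exists (gpath K l), (fun=> mulmx (drift K l)); exact: gpath_minimizer.
- move=> p v /(minimizerE Ku)[pE vE]; split; last by rewrite AE.
  by move=> t t01; rewrite /Pinfo PtE -flow_cov; exact: pE.
- exact: inf_cost.
Qed.
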